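(* Let $\alpha\in(0,1)$ and suppose the expansion condition (E) stated in the context holds. For every $n$ let $\hat S_n$ be a Borel-measurable function on $\mathbb{R}^{n\times\ell}$ with values in the symmetric nonnegative definite matrices in $\mathbb{R}^{k\times k}$, such that for every $\varepsilon>0$ $$\mathbb{P}_n\left(\|\operatorname{corr}(\hat S_n)-\operatorname{corr}(\mathbb{V}_n(r_n))\|+\|\operatorname{diag}(\mathbb{V}_n(r_n))^{-1}\operatorname{diag}(\hat S_n)-I_k\|\ge\varepsilon\right)\to 0,$$ or, equivalently (the two requirements are equivalent), such that for every $\varepsilon>0$ $$\mathbb{P}_n\left(\|\operatorname{corr}(\hat S_n)-\operatorname{corr}(S_n)\|+\|\operatorname{diag}(S_n)^{\dagger}\operatorname{diag}(\hat S_n)-I_k\|\ge\varepsilon\right)\to 0 .$$ For every $\mathbb{M}\in\mathsf{M}_n$ and $j=1,\dots,m(\mathbb{M})$ define the interval $$\mathrm{CI}^{(j),\mathrm{est}}_{1-\alpha,\mathbb{M}}=\hat\theta^{(j)}_{\mathbb{M},n}\pm\sqrt{[\hat S_n]_{\rho(\mathbb{M})+j}}\;K_{1-\alpha}(\operatorname{corr}(\hat S_n)).$$ Then $$\mathbb{P}_n\left(\theta^{*(j)}_{\mathbb{M},n}\in\mathrm{CI}^{(j),\mathrm{est}}_{1-\alpha,\mathbb{M}}\text{ for all }\mathbb{M}\in\mathsf{M}_n\text{ and all }j=1,\dots,m(\mathbb{M})\right)\to 1-\alpha\quad (n\to\infty).$$ In particular, for every sequence of (measurable) model selection procedures $\hat{\mathbb{M}}_n:\mathbb{R}^{n\times\ell}\to\mathsf{M}_n$,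 $$\liminf_{n\to\infty}\mathbb{P}_n\left(\theta^{*(j)}_{\hat{\mathbb{M}}_n,n}\in\mathrm{CI}^{(j),\mathrm{est}}_{1-\alpha,\hat{\mathbb{M}}_n}\text{ for all }j=1,\dots,m(\hat{\mathbb{M}}_n)\right)\ge 1-\alpha .$$
   Context: Framework. Fix integers $\ell,d\ge1$. For each $n$, $\mathbb{P}_n=\bigotimes_{i=1}^n\mathbb{P}_{i,n}$ is a product probability measure on the Borel sets of $\mathbb{R}^{n\times\ell}$, with $\mathbb{P}_{i,n}$ the marginal law (on $\mathbb{R}^{1\times\ell}$) of the $i$-th row $y_i$ of $y\in\mathbb{R}^{n\times\ell}$. $\mathbb{E}_n,\mathbb{V}_n$ denote expectation and variance-covariance operator under $\mathbb{P}_n$; $\mathbb{E}_{i,n}$ denotes expectation under $\mathbb{P}_{i,n}$. $\mathsf{M}_n=\{\mathbb{M}_{1,n},\dots,\mathbb{M}_{d,n}\}$ is a set of $d$ nonempty sets of probability distributions (candidate models) on $\mathbb{R}^{n\times\ell}$; $\mathbb{P}_n$ need not belong to any of them. For each $\mathbb{M}\in\mathsf{M}_n$ there is given a nonrandom target $\theta^*_{\mathbb{M},n}\in\mathbb{R}^{m(\mathbb{M})}$ (possibly depending on $\mathbb{P}_n$) and a measurable estimator $\hat\theta_{\mathbb{M},n}:\mathbb{R}^{n\times\ell}\to\mathbb{R}^{m(\mathbb{M})}$; the dimension $m(\mathbb{M}_{j,n})$ does not depend on $n$. Let $\hat\theta_n$ and $\theta^*_n$ be the vectors obtained by stacking $\hat\theta_{\mathbb{M}_{j,n},n}$,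 respectively $\theta^*_{\mathbb{M}_{j,n},n}$, $j=1,\dots,d$; both have dimension $k=\sum_{j=1}^d m(\mathbb{M}_{j,n})$. For $\mathbb{M}=\mathbb{M}_{j,n}$ put $\rho(\mathbb{M})=\sum_{l=1}^{j-1}m(\mathbb{M}_{l,n})$ (empty sum $=0$). Superscript $(j)$ denotes the $j$-th coordinate of a vector. Condition (E). There exist Borel functions $g_{i,n}:\mathbb{R}^{1\times\ell}\to\mathbb{R}^k$ ($i=1,\dots,n$) and $\Delta_n:\mathbb{R}^{n\times\ell}\to\mathbb{R}^k$, possibly depending on $\theta_n^*$, with $\hat\theta_n(y)-\theta^*_n=\sum_{i=1}^n g_{i,n}(y_i)+\Delta_n(y)$ for all $y$, such that, writing $r_n(y)=\sum_{i=1}^n g_{i,n}(y_i)$, for every $i$ and every $j\in\{1,\dots,k\}$: $\mathbb{E}_{i,n}(g^{(j)}_{i,n})=0$ and $0<\mathbb{V}_n(r_n^{(j)})<\infty$; and, for every $j$ and every $\varepsilon>0$, as $n\to\infty$, $$\mathbb{V}_n^{-1}(r_n^{(j)})\sum_{i=1}^n\int [g_{i,n}^{(j)}]^2\,\mathbf{1}\{|g_{i,n}^{(j)}|\ge\varepsilon\mathbb{V}_n^{1/2}(r_n^{(j)})\}\,d\mathbb{P}_{i,n}\to0,\qquad \mathbb{P}_n\big(|\mathbb{V}_n^{-1/2}(r_n^{(j)})\Delta_n^{(j)}|\ge\varepsilon\big)\to0 .$$ $S_n(y)=\sum_{i=1}^n g_{i,n}(y_i)g_{i,n}(y_i)'$.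 Notation. $\operatorname{diag}(A)$: the matrix $A$ with off-diagonal entries set to $0$; $A^\dagger$: Moore–Penrose inverse; $A^{\dagger/2}=(A^\dagger)^{1/2}$ (nonnegative definite square root); $\operatorname{corr}(\Sigma)=\operatorname{diag}(\Sigma)^{\dagger/2}\Sigma\operatorname{diag}(\Sigma)^{\dagger/2}$; $[A]_j$: $j$-th diagonal entry; $\|\cdot\|$: operator norm. For a covariance matrix $\Gamma$, $K_{1-\alpha}(\Gamma)$ is the $(1-\alpha)$-quantile of $\|Z\|_\infty$ with $Z\sim N(0,\Gamma)$. $a\pm b$ denotes the interval $[a-b,a+b]$. *)

(* Defs.v *)
From HB Require Import structures.
From mathcomp Require Import all_boot all_order all_algebra.
From mathcomp Require Import all_classical all_reals all_analysis.

Set Implicit Arguments.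
Unset Strict Implicit.
Unset Printing Implicit Defensive.

Import Order.TTheory GRing.Theory Num.Theory.
Import numFieldNormedType.Exports.

Local Open Scope classical_set_scope.
Local Open Scope ring_scope.

(* Real m x n matrices carry the Borel sigma-algebra, generated by the open
   sets of the entrywise (product) topology. *)
Section borel_matrix.
Variables (R : realType) (m n : nat).

Let open_mx : set (set 'M[R]_(m, n)) := open.

HB.instance Definition _ := @isMeasurable.Build (sigma_display open_mx)
  'M[R]_(m, n) <<s open_mx >> (@sigma_algebra0 _ setT open_mx)
  (@sigma_algebraC _ open_mx) (@sigma_algebra_bigcup _ setT open_mx).

End borel_matrix.

Section linear_algebra.
Variable R : realType.

Definition psdmx k (A : 'M[R]_k) : Prop :=
  A^T = A /\ forall x : 'cV[R]_k, 0 <= (x^T *m A *m x) 0 0.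

Definition diagpart k (A : 'M[R]_k) : 'M[R]_k := diag_mx (\row_i A i i).

(* The four Penrose equations. *)
Definition is_mpinv m n (A : 'M[R]_(m, n)) (B : 'M[R]_(n, m)) : Prop :=
  [/\ A *m B *m A = A, B *m A *m B = B,
      (A *m B)^T = A *m B & (B *m A)^T = B *m A].

Definition mpinv m n (A : 'M[R]_(m, n)) : 'M[R]_(n, m) :=
  xget 0 [set B | is_mpinv A B].

(* The symmetric nonnegative definite square root; 0 if A is not symmetric
   nonnegative definite. *)
Definition sqrtmx k (A : 'M[R]_k) : 'M[R]_k :=
  xget 0 [set B | psdmx B /\ B *m B = A].

Definition corrmx k (A : 'M[R]_k) : 'M[R]_k :=
  let D := sqrtmx (mpinv (diagpart A)) in D *m A *m D.

Definition euclid_norm k (x : 'cV[R]_k) : R := Num.sqrt (\sum_i x i 0 ^+ 2).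

Definition opnorm m n (A : 'M[R]_(m, n)) : R :=
  sup [set euclid_norm (A *m x) | x in [set x : 'cV[R]_n | euclid_norm x <= 1]].

End linear_algebra.

Section gaussian.
Variable R : realType.

(* N(0, v) on the real line. The case v = 0 is separated because the library's
   [normal_prob] does not degenerate to a point mass at standard deviation 0. *)
Definition normal0 (v : R) (B : set R) : \bar R :=
  if v == 0 then \d_(0 : R) B else normal_prob 0 (Num.sqrt v) B.

(* mu = N(0, Gamma), with Gamma possibly singular: every linear functional
   t'z is univariate N(0, t' Gamma t). *)
Definition is_gaussian k (Gamma : 'M[R]_k) (mu : probability 'cV[R]_k R) : Prop :=
  psdmx Gamma /\
  forall (t : 'cV[R]_k) (B : set R), measurable B ->
    mu [set z | B ((t^T *m z) 0 0)] = normal0 ((t^T *m Gamma *m t) 0 0) B.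

Definition gaussian k (Gamma : 'M[R]_k) : probability 'cV[R]_k R :=
  xget (\d_(0 : 'cV[R]_k) : probability 'cV[R]_k R)
    [set mu | is_gaussian Gamma mu].

(* The p-quantile of the max-norm of Z ~ N(0, Gamma); the library norm `|z|
   of a matrix is the maximum of the absolute values of its entries. *)
Definition gauss_maxnorm_quantile (p : R) k (Gamma : 'M[R]_k) : R :=
  inf [set t : R | (p%:E <= gaussian Gamma [set z | (`|z| <= t)%R])%E].

End gaussian.

Section framework.
Variables (R : realType) (l k : nat).

(* P is the product of the laws Q i of the rows. *)
Definition is_product_law n (P : probability 'M[R]_(n, l) R)
    (Q : 'I_n -> probability 'rV[R]_l R) : Prop :=
  forall A : 'I_n -> set 'rV[R]_l, (forall i, measurable (A i)) ->
    P [set y | forall i, A i (row i y)] = (\prod_(i < n) Q i (A i))%E.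

Definition lead_sum n (g : 'I_n -> 'rV[R]_l -> 'cV[R]_k) (y : 'M[R]_(n, l)) :
    'cV[R]_k :=
  \sum_(i < n) g i (row i y).

Definition outer_sum n (g : 'I_n -> 'rV[R]_l -> 'cV[R]_k) (y : 'M[R]_(n, l)) :
    'M[R]_k :=
  \sum_(i < n) g i (row i y) *m (g i (row i y))^T.

Definition covmx n (P : probability 'M[R]_(n, l) R)
    (X : 'M[R]_(n, l) -> 'cV[R]_k) : 'M[R]_k :=
  \matrix_(a, b) fine (covariance P (fun y => X y a 0) (fun y => X y b 0)).

(* The requirements at fixed n are imposed for n >= 1 only: for n = 0 the sum
   is empty and its variance is 0. *)
Definition expansion_condition
    (P : forall n, probability 'M[R]_(n, l) R)
    (Q : forall n, 'I_n -> probability 'rV[R]_l R)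
    (thetahat : forall n, 'M[R]_(n, l) -> 'cV[R]_k)
    (thetastar : nat -> 'cV[R]_k)
    (g : forall n, 'I_n -> 'rV[R]_l -> 'cV[R]_k)
    (Delta : forall n, 'M[R]_(n, l) -> 'cV[R]_k) : Prop :=
  let V n j := 'V_(P n)[(fun y => lead_sum (g n) y j 0)%R]%E in
  let sd n j := Num.sqrt (fine (V n j)) in
  [/\ forall n, (0 < n)%N ->
        [/\ forall i, measurable_fun setT (g n i),
            measurable_fun setT (Delta n),
            forall y, thetahat n y - thetastar n = lead_sum (g n) y + Delta n y,
            forall i j, ('E_(Q n i)[(fun x => g n i x j 0)%R] = 0)%E &
            forall j, (0 < V n j < +oo)%E],
      forall (j : 'I_k) (e : R), 0 < e ->
        (((fine (V n j))^-1)%:E *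
          \sum_(i < n) \int[Q n i]_x
            (g n i x j 0 ^+ 2 *
             \1_[set x | e * sd n j <= `|g n i x j 0|] x)%R%:E)%E
          @[n --> \oo] --> 0%E &
      forall (j : 'I_k) (e : R), 0 < e ->
        P n [set y | e <= `|(sd n j)^-1 * Delta n y j 0|] @[n --> \oo] --> 0%E].

(* Shat n is consistent for the (possibly random) matrices A n; [inv] is the
   inverse applied to the diagonal part of A n. *)
Definition consistent_cov (inv : 'M[R]_k -> 'M[R]_k)
    (P : forall n, probability 'M[R]_(n, l) R)
    (A Shat : forall n, 'M[R]_(n, l) -> 'M[R]_k) : Prop :=
  forall e : R, 0 < e ->
    P n [set y | e <= opnorm (corrmx (Shat n y) - corrmx (A n y)) +
                      opnorm (inv (diagpart (A n y)) *m diagpart (Shat n y)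
                              - 1%:M)]
      @[n --> \oo] --> 0%E.

End framework.

(* With k = \sum_(j < d) m j, the coordinate [tagnat.Rank j i] of the stacked
   vector \mxcol_j theta_j is the i-th coordinate of theta_j; its (0-based)
   value is \sum_(l < j) m l + i, see [tagnat.RankEsum]. *)
Definition conf_interval (R : realType) d (m : 'I_d -> nat) (alpha : R)
    (theta : forall j, 'cV[R]_(m j)) (Sigma : 'M[R]_(\sum_(j < d) m j))
    (j : 'I_d) (i : 'I_(m j)) : interval R :=
  let s := tagnat.Rank j i in
  let w := Num.sqrt (Sigma s s) *
    gauss_maxnorm_quantile (1 - alpha) (corrmx Sigma) in
  `[theta j i 0 - w, theta j i 0 + w].
Arguments conf_interval {R d m} alpha theta Sigma j i.

(* Main.v *)
Require Import Defs.
From HB Require Import structures.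
From mathcomp Require Import all_boot all_order all_algebra.
From mathcomp Require Import all_classical all_reals all_analysis.
From mathcomp Require Import measurable_realfun ring lra.
Set Implicit Arguments.
Unset Strict Implicit.
Unset Printing Implicit Defensive.
Import Order.TTheory GRing.Theory Num.Theory.
Import numFieldNormedType.Exports.
Local Open Scope classical_set_scope.
Local Open Scope ring_scope.

(* Standardize the leading sum: W_n has coordinates r_n^(j) / sd(r_n^(j)), and its covariance
   matrix Gamma_n = corr(V_n(r_n)) has unit diagonal. Everything is done with fixed-n bounds that
   are uniform over correlation matrices, so that no subsequence along which Gamma_n converges has
   to be extracted.

   CLT. For a vector t, the real characteristic function E cos(t'W_n) is compared with
   exp(- t' Gamma_n t / 2) one row at a time; the Lindeberg condition controls the error. The
   indicator of a cube is sandwiched, up to a small shift and a small error, by a finite linear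
   combination of functions cos(t'x), which is obtained by applying a Bernstein polynomial to
   cos(x_j / M) in each coordinate. Hence P(|W_n| <= u) is asymptotically squeezed between the
   values at u - eta and u + eta of the distribution function F_n of |Z|, Z ~ N(0, Gamma_n). The same
   sandwich shows that the distribution function depends continuously on the correlation matrix,
   and the unit diagonal makes F_n Lipschitz with a constant that only depends on k.

   LLN. Truncation shows that S_n - V_n(r_n), rescaled by the standard deviations, tends to 0 in
   probability; this makes the two forms of the consistency requirement equivalent.

   Conclusion. The grid points at which F_n crosses the levels 1 - alpha +- delta bracket the
   random quantile K(corr(S^_n)) with probability tending to one, and the coverage event is
   |W_n| <= K(corr(S^_n)) up to factors tending to one. *)

(** * Elementary inequalities and integrals *)

(** The events to be compared are symmetric, so cosines of linear forms suffice as test functions.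
    But the cosine is not multiplicative over independent sums: the sine of each partial sum has to
    be carried along, and its contribution is small because the rows are centred. Cosines are also
    periodic, so a cube is well approximated only inside a large ball; Chebyshev bounds from
    variances at most 1 dispose of the rest. These bounds hold for W_n and for N(0, Gamma) alike, so
    one combination of cosines, fixed before the law, serves both. The Gaussian law is obtained by
    choice, so its existence is proved first, by adding independent terms xi v (xi standard normal,
    v a vector) to the point mass at 0. The standard normal characteristic function comes from
    stability under convolution and from the second moment, without differentiation under the
    integral. The law of the sample is given on rectangles only; independence is rebuilt from it for
    bounded functions of all rows and for integrable functions of two rows. Comparing the estimated
    quantile with deterministic grid points leaves only finitely many asymptotically sure events to
    intersect. *)

Section elementary.
Variable R : realType.
Implicit Types x y a b e : R.

(** Mean value theorem on [[0, x]]. It turns bounds on [cos] into bounds of one degree higher on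
    [sin]; the half-angle formula [cos_half] leads back to [cos]. *)
Lemma sin_eq_cos_mul x : 0 <= x -> exists2 c, 0 <= c <= x & sin x = cos c * x.
Proof.
move=> x0.
have ds z : z \in `]0, x[ -> is_derive z 1 sin (cos z) by move=> _; exact: is_derive_sin.
have cs : {within `[0, x], continuous (@sin R)} by exact/continuous_subspaceT/continuous_sin.
have [c cx] := MVT_segment x0 ds cs.
by rewrite sin0 !subr0 => ->; exists c => //; move: cx; rewrite in_itv.
Qed.

Lemma sin_le_id x : 0 <= x -> sin x <= x.
Proof.
move=> x0; have [c _ ->] := sin_eq_cos_mul x0.
by rewrite ler_piMl// cos_le1.
Qed.

Lemma normr_sin_le x : `|sin x| <= `|x|.
Proof.
wlog x0 : x / 0 <= x => [h|].
  have [/h//|x0] := leP 0 x; rewrite -normrN -(normrN x) -sinN.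
  by apply: h; rewrite oppr_ge0 ltW.
rewrite (ger0_norm x0) ler_norml sin_le_id// andbT.
have [x1|x1] := leP 1 x.
  by rewrite (le_trans _ (sin_geN1 x))// lerN2.
have [c /andP[c0 cx] ->] := sin_eq_cos_mul x0.
by rewrite -mulN1r ler_wpM2r// cos_geN1.
Qed.

Lemma cos_half x : cos x = 1 - 2 * sin (x / 2) ^+ 2.
Proof.
rewrite {1}(splitr x) cosD -!expr2 cos2sin2; lra.
Qed.

Lemma cos_ge x : 1 - x ^+ 2 / 2 <= cos x.
Proof.
rewrite cos_half.
have : sin (x / 2) ^+ 2 <= (x / 2) ^+ 2.
  by rewrite -(real_normK (num_real (sin _))) -(real_normK (num_real (x / 2)))
    lerXn2r ?nnegrE// normr_sin_le.
by rewrite expr_div_n; lra.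
Qed.

Lemma sin_ge x : 0 <= x -> x - x ^+ 3 / 2 <= sin x.
Proof.
move=> x0; have [c /andP[c0 cx] ->] := sin_eq_cos_mul x0.
have := cos_ge c; have : c ^+ 2 <= x ^+ 2 by rewrite lerXn2r.
have -> : x - x ^+ 3 / 2 = (1 - x ^+ 2 / 2) * x by ring.
by move=> ? ?; rewrite ler_wpM2r//; lra.
Qed.

Lemma cos_le x : cos x <= 1 - x ^+ 2 / 2 + x ^+ 4 / 8.
Proof.
wlog x0 : x / 0 <= x => [h|].
  have [/h//|x0] := leP 0 x; rewrite -cosN; have := h (- x).
  have -> : (- x) ^+ 4 = x ^+ 4 by ring.
  by rewrite sqrrN oppr_ge0 ltW// => /(_ isT).
rewrite cos_half; have y0 : 0 <= x / 2 by rewrite divr_ge0.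
have [y y2] : exists y, x = 2 * y by exists (x / 2); lra.
have -> : x / 2 = y by lra.
have yy : 0 <= y by lra.
have := sin_ge yy; have := sin_le_id yy.
have [ys|ys] := leP 0 (sin y).
  move=> h1 h2; rewrite y2.
  have : y ^+ 2 - sin y ^+ 2 <= (y ^+ 3 / 2) * (2 * y).
    rewrite subr_sqr ler_pM//; lra.
  rewrite (_ : y ^+ 3 / 2 * (2 * y) = y ^+ 4); last by field.
  rewrite !exprMn; lra.
(* If [sin y < 0], then [sin_ge] forces [y ^+ 2 >= 2], and the right-hand side is at least 1. *)
move=> _ h2; rewrite y2.
have y21 : 2 <= y ^+ 2.
  rewrite leNgt; apply/negP => y22.
  have : 0 <= y * (2 - y ^+ 2) by rewrite mulr_ge0// subr_ge0 ltW.
  rewrite mulrBr -exprS; lra.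
have := sqr_ge0 (sin y); rewrite !exprMn => ?.
have : 0 <= y ^+ 2 * (y ^+ 2 - 2) by rewrite mulr_ge0// ?sqr_ge0//; lra.
have -> : y ^+ 4 = y ^+ 2 * y ^+ 2 by rewrite -exprD.
lra.
Qed.

(** The Lindeberg split: below the threshold [e] the fourth-order remainder is at most [e * x ^+ 2];
    above it a plain quadratic bound is kept. *)
Lemma cos_taylor_le e x : 0 < e <= 1 ->
  `|cos x - 1 + x ^+ 2 / 2| <= e * x ^+ 2 + (if e <= `|x| then x ^+ 2 else 0).
Proof.
move=> /andP[e0 e1]; have := cos_ge x; have := cos_le x; have := cos_le1 x.
move=> c1 c2 c3; rewrite ger0_norm; last lra.
have x2 := sqr_ge0 x; have [ex|ex] := leP e `|x|.
  have := mulr_ge0 (ltW e0) x2; lra.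
have : x ^+ 4 <= e * x ^+ 2.
  rewrite (_ : x ^+ 4 = x ^+ 2 * x ^+ 2); last by rewrite -exprD.
  rewrite ler_wpM2r// -(real_normK (num_real x)).
  rewrite (le_trans (y := e ^+ 2))//; last by rewrite expr2 ler_piMl// ltW.
  by rewrite lerXn2r ?nnegrE// ltW.
have := sqr_ge0 (x ^+ 2); rewrite -exprM => ? ?; lra.
Qed.

Lemma sin_taylor_le e x : 0 < e <= 1 ->
  `|sin x - x| <= e * x ^+ 2 + (if e <= `|x| then x ^+ 2 else 0).
Proof.
move=> /andP[e0 e1]; wlog x0 : x / 0 <= x => [h|].
  have [/h//|x0] := leP 0 x; have := h (- x).
  rewrite oppr_ge0 ltW// => /(_ isT).
  by rewrite sinN -opprD !normrN sqrrN.
have := sin_le_id x0; have := sin_ge x0 => h1 h2.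
rewrite ler0_norm; last lra.
rewrite ger0_norm//; have x2 := sqr_ge0 x.
have exx := mulr_ge0 (ltW e0) x2.
have xs : x - sin x <= x ^+ 2.
  have [x2'|x2'] := leP 2 x.
    have : - 1 <= sin x by exact: sin_geN1.
    have : 0 <= x * (x - 2) by rewrite mulr_ge0// subr_ge0.
    rewrite mulrBr -expr2; lra.
  have : 0 <= x ^+ 2 * (2 - x) by rewrite mulr_ge0// subr_ge0 ltW.
  rewrite (_ : x ^+ 3 = x ^+ 2 * x) in h1; last by rewrite exprSr.
  lra.
have [ex|ex] := leP e x; first lra.
have : 0 <= x ^+ 2 * (e - x) by rewrite mulr_ge0// subr_ge0 ltW.
rewrite (_ : x ^+ 3 = x ^+ 2 * x) in h1; last by rewrite exprSr.
lra.
Qed.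

Lemma expRN_le1 a : 0 <= a -> expR (- a) <= 1.
Proof. by move=> a0; rewrite -[leRHS]expR0 ler_expR oppr_le0. Qed.

Lemma expRN_taylor_le a : 0 <= a -> `|expR (- a) - 1 + a| <= a ^+ 2.
Proof.
move=> a0; have h1 := expR_ge1Dx (- a); rewrite ger0_norm; last lra.
have h2 := expR_ge1Dx a.
have : expR (- a) <= (1 + a)^-1.
  by rewrite expRN lef_pV2// ?posrE ?expR_gt0//; lra.
have : (1 + a)^-1 <= 1 - a + a ^+ 2.
  rewrite -div1r ler_pdivrMr; last lra.
  have : 0 <= a ^+ 3 by rewrite exprn_ge0.
  have -> : (1 - a + a ^+ 2) * (1 + a) = 1 + a ^+ 3 by ring.
  lra.
lra.
Qed.

Lemma expRN_lip a b : 0 <= a -> 0 <= b -> `|expR (- a) - expR (- b)| <= `|a - b|.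
Proof.
wlog ab : a b / a <= b => [h a0 b0|].
  have [|/ltW] := leP a b; first by move=> /h; apply.
  by move=> /h/(_ b0 a0); rewrite distrC (distrC b).
move=> a0 b0; rewrite (ler0_norm (x := a - b)) ?subr_le0// opprB.
rewrite ger0_norm ?subr_ge0 ?ler_expR ?lerN2//.
have -> : expR (- b) = expR (- a) * expR (- (b - a)).
  by rewrite -expRD; congr expR; ring.
have h := expR_ge1Dx (- (b - a)).
rewrite -[X in X - _]mulr1 -mulrBr.
apply: (le_trans (y := 1 * (1 - expR (- (b - a))))); last by rewrite mul1r; lra.
rewrite ler_wpM2r ?expRN_le1//; have := expRN_le1 (_ : 0 <= b - a); lra.
Qed.

Lemma exists_natSinv_lt e : 0 < e -> exists N, N.+1%:R^-1 < e.
Proof.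
move=> e0; have [N _ /(_ N (leqnn N)) h] := near_infty_natSinv_lt (PosNum e0).
by exists N.
Qed.

End elementary.

(** * Integrals of bounded functions under a probability *)

Section bounded.
Context d (T : measurableType d) (R : realType) (P : probability T R).

Lemma bounded_integrable (f : T -> R) (C : R) : measurable_fun setT f ->
  (forall x, `|f x| <= C) -> P.-integrable setT (EFin \o f).
Proof.
move=> mf fC; apply: measurable_bounded_integrable => //.
  by apply: (le_lt_trans (probability_le1 P measurableT)); rewrite ltry.
exists C; split; first exact: num_real.
by move=> M CM x _ /=; rewrite (le_trans (fC x))// ltW.
Qed.

Lemma integrable_cstR (C : R) : P.-integrable setT (EFin \o (fun=> C)).
Proof. exact: (@bounded_integrable (fun=> C) `|C|). Qed.

Lemma integrableDR (f g : T -> R) : P.-integrable setT (EFin \o f) ->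
  P.-integrable setT (EFin \o g) -> P.-integrable setT (EFin \o (fun x => f x + g x)).
Proof.
move=> fi gi; rewrite (_ : EFin \o _ = (EFin \o f) \+ (EFin \o g))%E//.
exact: integrableD.
Qed.

Lemma integrableBR (f g : T -> R) : P.-integrable setT (EFin \o f) ->
  P.-integrable setT (EFin \o g) -> P.-integrable setT (EFin \o (fun x => f x - g x)).
Proof.
move=> fi gi; rewrite (_ : EFin \o _ = (EFin \o f) \- (EFin \o g))%E//.
exact: integrableB.
Qed.

Lemma integrableZR a (f : T -> R) : P.-integrable setT (EFin \o f) ->
  P.-integrable setT (EFin \o (fun x => a * f x)).
Proof.
move=> fi; rewrite (_ : EFin \o _ = fun x => (a%:E * (EFin \o f) x)%E)//.
exact: integrableZl.
Qed.

Lemma Rintegral_cstT (C : R) : \int[P]_x C = C.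
Proof.
rewrite Rintegral_cst// -[RHS]mulr1; congr *%R.
exact: (congr1 fine (probability_setT P)).
Qed.

Lemma Rintegral_bound (f : T -> R) (C : R) : measurable_fun setT f ->
  (forall x, `|f x| <= C) -> `|\int[P]_x f x| <= C.
Proof.
move=> mf fC; have fi := bounded_integrable mf fC.
apply: (le_trans (le_normr_Rintegral _ fi)) => //.
rewrite -[leRHS]Rintegral_cstT.
apply: le_Rintegral => //.
  by apply: integrable_norm.
exact: (@bounded_integrable (fun=> C) `|C|).
Qed.

Lemma Rintegral_sum I (s : seq I) (f : I -> T -> R) :
  (forall i, P.-integrable setT (EFin \o f i)) ->
  \int[P]_x (\sum_(i <- s) f i x) = \sum_(i <- s) \int[P]_x f i x.
Proof.
move=> fi; elim: s => [|i s ih].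
  by under eq_Rintegral do rewrite big_nil; rewrite Rintegral_cstT big_nil.
under eq_Rintegral do rewrite big_cons.
rewrite RintegralD// ?ih ?big_cons//.
rewrite (_ : EFin \o _ = fun x => (\sum_(j <- s) (EFin \o f j) x)%E).
  by apply: integrable_sum.
by apply/funext => x /=; rewrite sumEFin.
Qed.

Lemma integrable_sumR I (s : seq I) (f : I -> T -> R) :
  (forall i, P.-integrable setT (EFin \o f i)) ->
  P.-integrable setT (EFin \o (fun x => \sum_(i <- s) f i x)).
Proof.
move=> fi.
rewrite (_ : EFin \o _ = fun x => (\sum_(j <- s) (EFin \o f j) x)%E).
  by apply: integrable_sum.
by apply/funext => x /=; rewrite sumEFin.
Qed.

Lemma Rintegral_indic (A : set T) : measurable A -> \int[P]_x (\1_A x : R) = fine (P A).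
Proof. by move=> mA; rewrite /Rintegral integral_indic// setIT. Qed.

End bounded.

(** * Borel measurability of matrix-valued maps *)

Section measurable_matrix.
Variable R : realType.

Lemma open_measurable_mx m n (U : set 'M[R]_(m, n)) : open U -> measurable U.
Proof. by move=> oU; exact: sub_sigma_algebra. Qed.

Lemma measurable_to_mx d (T : measurableType d) m n (f : T -> 'M[R]_(m, n)) :
  (forall U, open U -> measurable (f @^-1` U)) -> measurable_fun setT f.
Proof.
move=> fU; apply: (@measurability _ _ _ _ setT f (@open 'M[R]_(m, n))) => //.
by move=> _ [U oU <-]; rewrite setTI; exact: fU.
Qed.

Lemma continuous_measurable_mxR m n (f : 'M[R]_(m, n) -> R) :
  continuous f -> measurable_fun setT f.
Proof.
move=> cf; apply: (measurability _ (RGenOInfty.measurableE R)).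
move=> _ [_ [x ->] <-]; rewrite setTI; apply: open_measurable_mx.
by apply: open_comp => [y _|]; [exact: cf|exact: interval_open].
Qed.

Lemma measurable_coord m n i j :
  measurable_fun setT (fun y : 'M[R]_(m, n) => y i j).
Proof. by apply: continuous_measurable_mxR => y; exact: coord_continuous. Qed.

Lemma mx_norm_ltP m n (y : 'M[R]_(m, n)) (e : R) : 0 < e ->
  `|y| < e <-> forall i j, `|y i j| < e.
Proof.
move=> e0; rewrite /Num.norm/= mx_normrE; split.
  move=> /bigmax_ltP[_ h] i j; exact: (h (i, j)).
by move=> h; apply/bigmax_ltP; split => // -[i j] _; exact: h.
Qed.

Lemma mx_norm_leP m n (y : 'M[R]_(m, n)) (e : R) : 0 <= e ->
  `|y| <= e <-> forall i j, `|y i j| <= e.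
Proof.
move=> e0; rewrite /Num.norm/= mx_normrE; split.
  move=> /bigmax_leP[_ h] i j; exact: (h (i, j)).
by move=> h; apply/bigmax_leP; split => // -[i j] _; exact: h.
Qed.

(** The Borel sets are generated by all open sets, not by the coordinates. Second countability
    bridges the gap: an open set is the union of the boxes with rational centre and radius
    [c.2.+1%:R^-1] that it contains, and there are countably many of them. *)
Lemma measurable_mx d (T : measurableType d) m n (f : T -> 'M[R]_(m, n)) :
  (forall i j, measurable_fun setT (fun x => f x i j)) -> measurable_fun setT f.
Proof.
move=> mf; apply: measurable_to_mx => U oU.
pose B (c : 'M[rat]_(m, n) * nat) : set 'M[R]_(m, n) :=
  [set y | forall i j, `|y i j - ratr (c.1 i j)| < c.2.+1%:R^-1].
pose D := [set c | B c `<=` U].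
have -> : f @^-1` U = \bigcup_(c in D) (f @^-1` B c).
  apply/seteqP; split => x /=; last by move=> [c Dc /Dc].
  move=> Ux; have /nbhs_ballP[e /= e0 eU] : nbhs (f x) U by exact: open_nbhs_nbhs.
  have [N Ne] : exists N, N.+1%:R^-1 < e / 2.
    have [N _ /(_ N (leqnn N))] := near_infty_natSinv_lt (PosNum (divr_gt0 e0 (ltr0n R 2))).
    by exists N.
  have rq (a : R) : exists q, `|a - ratr q| < N.+1%:R^-1.
    have [|q] := @rat_in_itvoo R (a - N.+1%:R^-1) (a + N.+1%:R^-1).
      by rewrite ltrD2l gtrN.
    rewrite in_itv/= => /andP[h1 h2]; exists q.
    by rewrite ltr_distlC; apply/andP.
  exists (\matrix_(i, j) sval (cid (rq (f x i j))), N).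
    move=> y By; apply: eU; rewrite -ball_normE/=; apply/mx_norm_ltP => // i j.
    have := By i j; rewrite !mxE; case: cid => q /= h1 h2.
    rewrite (le_lt_trans (ler_distD (ratr q) _ _))// (distrC (ratr q)).
    by rewrite (splitr e) ltrD// (lt_trans _ Ne).
  by move=> i j; rewrite mxE; case: cid.
rewrite bigcup_mkcond; apply: countable_bigcupT_measurable.
  exact: countableP.
move=> c; case: ifP => // _.
have -> : f @^-1` B c = \bigcap_(p in [set: 'I_m * 'I_n])
    (fun x => f x p.1 p.2 - ratr (c.1 p.1 p.2)) @^-1` (ball 0 c.2.+1%:R^-1).
  apply/seteqP; split => x /=.
    by move=> h [i j] _ /=; rewrite -ball_normE/= sub0r normrN; exact: h.
  by move=> h i j; have := h (i, j) Logic.I; rewrite /= -ball_normE/= sub0r normrN.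
apply: fin_bigcap_measurable => // -[i j] _.
rewrite -[X in measurable X]setTI.
apply: measurable_funB => //.
exact: measurable_ball.
Qed.
End measurable_matrix.

(** * Uniform approximation by staircase functions *)

Section staircase.
Variable R : realType.

Lemma sum_ord_lt (N q : nat) : (q <= N)%N -> (\sum_(j < N) (j < q)%N)%N = q.
Proof.
move=> qN; rewrite (_ : (\sum_(j < N) _)%N = minn q N); first exact/minn_idPl.
elim: N {qN} => [|N ih]; first by rewrite big_ord0 minn0.
rewrite big_ord_recr/= ih; case: (ltnP N q) => h.
  by rewrite (minn_idPr h) addn1.
by rewrite (minn_idPl (leqW h)) addn0.
Qed.

(** The sum counts the levels [j.+1 / N.+1] that [a] has reached, which is the integer part of
    [N.+1 * a]. *)
Lemma staircase_le (N : nat) (a : R) : 0 <= a <= 1 ->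
  `|a - N.+1%:R^-1 * \sum_(j < N.+1) (j.+1%:R <= N.+1%:R * a)%R%:R| <= N.+1%:R^-1.
Proof.
move=> /andP[a0 a1]; have y0 : 0 <= N.+1%:R * a by rewrite mulr_ge0.
have yN : N.+1%:R * a <= N.+1%:R by rewrite ler_piMr.
set y := N.+1%:R * a in y0 yN *; have := truncn_itv y0.
set q := Num.truncn y => /andP[q1 q2].
have qN : (q <= N.+1)%N by rewrite -(ler_nat R) (le_trans q1).
rewrite (eq_bigr (fun j : 'I_N.+1 => ((j < q)%N : nat)%:R)); last first.
  by move=> j _; rewrite -truncn_ge_nat.
rewrite -natr_sum sum_ord_lt// (_ : a = N.+1%:R^-1 * y); last by rewrite mulKf.
rewrite -mulrBr normrM ger0_norm ?invr_ge0// ler_piMr ?invr_ge0//.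
by rewrite ger0_norm ?subr_ge0// lerBlDl -natr1 in q2 *; exact: ltW.
Qed.
End staircase.

(** * From indicators to bounded functions in an integral formula *)

Section weighted_law.
Context d d' (T : measurableType d) (T' : measurableType d') (R : realType).
Variables (P : probability T R) (Q : probability T' R).
Variables (X : T -> T') (mX : measurable_fun setT X).
Variables (H : T -> R) (mH : measurable_fun setT H).
Variables (C : R) (HC : forall y, `|H y| <= C) (c : R).
Hypothesis lawA : forall A, measurable A ->
  \int[P]_y (\1_A (X y) * H y) = c * fine (Q A).

(** The defect of the identity to be proved. It is linear, bounded for the sup norm and zero on
    indicators, hence zero on uniform limits of staircases. The weight [H] may change sign, so the
    left-hand integral is not treated as one against a measure. *)
Let G f := \int[P]_y (f (X y) * H y) - c * \int[Q]_x f x.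

Let C0 : 0 <= C. Proof. exact: (le_trans (normr_ge0 _) (HC point)). Qed.

Let mfH (f : T' -> R) : measurable_fun setT f ->
  measurable_fun setT (fun y => f (X y) * H y).
Proof. by move=> mf; apply: measurable_funM => //; exact: measurableT_comp. Qed.

Let ifH (f : T' -> R) (K : R) : measurable_fun setT f -> (forall x, `|f x| <= K) ->
  P.-integrable setT (EFin \o (fun y => f (X y) * H y)).
Proof.
move=> mf fK; apply: (@bounded_integrable _ _ _ _ _ (K * C)); first exact: mfH.
by move=> y; rewrite normrM ler_pM.
Qed.

Let GD (f g : T' -> R) (K L : R) : measurable_fun setT f -> measurable_fun setT g ->
  (forall x, `|f x| <= K) -> (forall x, `|g x| <= L) ->
  G (fun x => f x + g x) = G f + G g.
Proof.
move=> mf mg fK gL; rewrite /G.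
under eq_Rintegral do rewrite mulrDl.
rewrite (RintegralD measurableT (ifH mf fK) (ifH mg gL)).
rewrite (RintegralD measurableT (bounded_integrable Q mf fK) (bounded_integrable Q mg gL)).
ring.
Qed.

Let GZ (f : T' -> R) (K : R) (a : R) : measurable_fun setT f ->
  (forall x, `|f x| <= K) -> G (fun x => a * f x) = a * G f.
Proof.
move=> mf fK; rewrite /G.
under eq_Rintegral do rewrite -mulrA.
rewrite (RintegralZl _ measurableT (ifH mf fK)).
rewrite (RintegralZl _ measurableT (bounded_integrable Q mf fK)); ring.
Qed.

Let G_bound (f : T' -> R) (K : R) : measurable_fun setT f ->
  (forall x, `|f x| <= K) -> `|G f| <= K * (C + `|c|).
Proof.
move=> mf fK; rewrite /G (le_trans (ler_normB _ _))// mulrDr lerD//.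
  apply: Rintegral_bound; first exact: mfH.
  by move=> y; rewrite normrM ler_pM.
by rewrite normrM mulrC ler_wpM2r//; exact: Rintegral_bound.
Qed.

Let G_indic A : measurable A -> G \1_A = 0.
Proof. by move=> mA; rewrite /G lawA// Rintegral_indic// subrr. Qed.

Let G_sum (I : Type) (s : seq I) (f : I -> T' -> R) (K : R) :
  (forall i, measurable_fun setT (f i)) -> (forall i x, `|f i x| <= K) ->
  (forall i, G (f i) = 0) -> G (fun x => \sum_(i <- s) f i x) = 0.
Proof.
move=> mf fK Gf.
elim: s => [|i s ih].
  rewrite /G; under eq_Rintegral do rewrite big_nil mul0r.
  rewrite Rintegral_cstT; under eq_Rintegral do rewrite big_nil.
  by rewrite Rintegral_cstT mulr0 subrr.
rewrite (_ : (fun x => _) = fun x => f i x + \sum_(j <- s) f j x); last first.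
  by apply/funext => x; rewrite big_cons.
rewrite (@GD _ _ K ((size s)%:R * K))// ?Gf ?ih ?addr0//.
  exact: measurable_sum.
move=> x; rewrite (le_trans (ler_norm_sum _ _ _))//.
by rewrite (le_trans (ler_sum _ (fun i _ => fK i x)))// big_const_seq count_predT iter_addr_0
  mulr_natl.
Qed.

Let G01 (f : T' -> R) : measurable_fun setT f -> (forall x, 0 <= f x <= 1) -> G f = 0.
Proof.
move=> mf f01; apply/eqP; rewrite -normr_le0 leNgt; apply/negP => Gf0.
(* By [G_bound] a uniform error of [f] is multiplied by at most [C + |c|]; a staircase of step below
   [|G f| / (C + |c| + 1)] therefore contradicts [|G f| > 0]. *)
have K0 : 0 < C + `|c| + 1 by rewrite ltr_wpDl// addr_ge0.
have [N] := exists_natSinv_lt (divr_gt0 Gf0 K0).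
rewrite ltr_pdivlMr//; apply/negP; rewrite -leNgt.
pose A (j : nat) := [set x | j.+1%:R <= N.+1%:R * f x].
have mA j : measurable (A j).
  rewrite -[X in measurable X]setTI; apply: measurable_fun_le => //.
  exact: measurable_funM.
pose s x : R := N.+1%:R^-1 * \sum_(j < N.+1) \1_(A j) x.
have sE x : s x = N.+1%:R^-1 * \sum_(j < N.+1) (j.+1%:R <= N.+1%:R * f x)%R%:R.
  congr *%R; apply: eq_bigr => j _; rewrite indicE; congr ((nat_of_bool _)%:R).
  by apply/idP/idP; rewrite inE.
have i1 A' (x : T') : `|\1_A' x : R| <= 1.
  by rewrite indicE; case: (_ \in _); rewrite ?normr1 ?normr0.
have ms : measurable_fun setT s.
  by apply: measurable_funM => //; apply: measurable_sum => j; exact: measurable_indic.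
have s1 x : `|s x| <= 1.
  rewrite /s normrM ger0_norm ?invr_ge0// mulrC ler_pdivrMr// mul1r.
  rewrite (le_trans (ler_norm_sum _ _ _))//.
  by rewrite (le_trans (ler_sum _ (fun i _ => i1 _ _)))// sumr_const card_ord.
have fs x : `|f x - s x| <= N.+1%:R^-1 by rewrite sE; exact: staircase_le.
have Gs : G s = 0.
  rewrite /s (@GZ _ N.+1%:R).
  - rewrite (_ : G _ = 0) ?mulr0//.
    apply: (@G_sum 'I_N.+1 _ (fun j => \1_(A j)) 1) => j.
    + exact: measurable_indic.
    + exact: i1.
    + exact: G_indic.
  - by apply: measurable_sum => j; exact: measurable_indic.
  - move=> x; rewrite (le_trans (ler_norm_sum _ _ _))//.
    by rewrite (le_trans (ler_sum _ (fun i _ => i1 _ _)))// sumr_const card_ord.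
have -> : G f = G (fun x => f x - s x).
  rewrite (_ : f = fun x => (f x - s x) + s x); last first.
    by apply/funext => x; rewrite subrK.
  rewrite (@GD _ _ N.+1%:R^-1 1)//; last exact: measurable_funB.
  by rewrite Gs addr0; congr G; apply/funext => x; rewrite subrK.
rewrite (le_trans (G_bound _ fs))//; first exact: measurable_funB.
by rewrite ler_wpM2l ?invr_ge0// lerDl.
Qed.

Lemma weighted_law (f : T' -> R) (K : R) : measurable_fun setT f ->
  (forall x, `|f x| <= K) ->
  \int[P]_y (f (X y) * H y) = c * \int[Q]_x f x.
Proof.
move=> mf fK; apply/eqP; rewrite -subr_eq0; apply/eqP; rewrite -/(G f).
pose L := `|K| + 1; have L0 : 0 < L by rewrite ltr_wpDl.
have fL x : - L <= f x <= L.
  rewrite -ler_norml (le_trans (fK x))// /L (le_trans (ler_norm K))// lerDl//.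
pose h x := (f x + L) / (2 * L).
have mh : measurable_fun setT h by apply: measurable_funM => //; exact: measurable_funD.
have h01 x : 0 <= h x <= 1.
  have := fL x; rewrite /h ler_pdivrMr ?mulr_gt0// mul1r => /andP[h1 h2].
  by rewrite divr_ge0 ?mulr_ge0 ?(ltW L0)//=; lra.
have hb x : `|h x| <= 1 by have /andP[h1 h2] := h01 x; rewrite ger0_norm.
have i1 (x : T') : `|\1_setT x : R| <= 1 by rewrite indicE in_setT normr1.
have m1 : measurable_fun setT (\1_setT : T' -> R) by exact: measurable_indic.
have fE : f = fun x => (2 * L) * h x + (- L) * \1_setT x.
  apply/funext => x; rewrite indicE in_setT mulr1 /h; field.
  by rewrite gt_eqF.
rewrite fE (@GD _ _ (2 * L) L).
- by rewrite (@GZ h 1)// (@GZ \1_setT 1)// G01// G_indic// !mulr0 addr0.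
- exact: measurable_funM.
- exact: measurable_funM.
- by move=> x; rewrite normrM ger0_norm ?mulr_ge0 ?(ltW L0)// ler_piMr ?mulr_ge0 ?(ltW L0).
- by move=> x; rewrite normrM normrN (ger0_norm (ltW L0)) ler_piMr// ltW.
Qed.
End weighted_law.

(** * A single row: truncated second moments and characteristic function *)

Section one_variable.
Context d (T : measurableType d) (R : realType) (Q : probability T R).
Variables (X : T -> R) (mX : measurable_fun setT X).
Hypothesis iX2 : Q.-integrable setT (EFin \o (fun x => X x ^+ 2)).

Lemma integrable_of_sqr : Q.-integrable setT (EFin \o X).
Proof.
apply: (@le_integrable _ _ _ Q setT measurableT _ (EFin \o (fun x => X x ^+ 2 + 1))).
- exact/measurable_EFinP.
- move=> x _ /=; rewrite lee_fin (ger0_norm (_ : 0 <= X x ^+ 2 + 1)); last first.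
    by rewrite addr_ge0 ?sqr_ge0.
  rewrite -(real_normK (num_real (X x))).
  have := sqr_ge0 (`|X x| - 1); rewrite sqrrB1.
  have := normr_ge0 (X x); rewrite -mulr_natr; lra.
- by apply: integrableDR => //; exact: integrable_cstR.
Qed.

(** The integrand of the Lindeberg sum in [expansion_condition], with [e] in place of [e * sd]. *)
Definition tail2 (e : R) (x : T) : R := X x ^+ 2 * \1_[set z | e <= `|X z|] x.

Lemma tail2E e x : tail2 e x = if e <= `|X x| then X x ^+ 2 else 0.
Proof.
rewrite /tail2 indicE; have [h|h] := boolP (e <= `|X x|).
  by rewrite mem_set// mulr1.
by rewrite memNset ?mulr0//=; exact/negP.
Qed.

Lemma measurable_tail2 e : measurable_fun setT (tail2 e).
Proof.
apply: measurable_funM; first exact: measurable_funX.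
apply: measurable_indic.
rewrite -[X in measurable X]setTI; apply: measurable_fun_le => //.
exact: measurableT_comp.
Qed.

Lemma tail2_ge0 e x : 0 <= tail2 e x.
Proof. by rewrite tail2E; case: ifP => // _; exact: sqr_ge0. Qed.

Lemma integrable_tail2 e : Q.-integrable setT (EFin \o tail2 e).
Proof.
apply: (@le_integrable _ _ _ Q setT measurableT _ (EFin \o (fun x => X x ^+ 2))) => //.
  apply/measurable_EFinP; exact: measurable_tail2.
move=> x _ /=; rewrite lee_fin (ger0_norm (tail2_ge0 _ _)) ger0_norm ?sqr_ge0//.
by rewrite tail2E; case: ifP => // _; exact: sqr_ge0.
Qed.

Let v := \int[Q]_x (X x ^+ 2).

(** Makes every single row negligible: its variance is bounded by quantities that become small, so
    the sum of the squared variances is small against the total variance. *)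
Lemma sqr_le_tail2 e : 0 < e -> v <= e ^+ 2 + \int[Q]_x tail2 e x.
Proof.
move=> e0.
rewrite -(Rintegral_cstT Q (e ^+ 2)) -RintegralD//; last 2 first.
  exact: integrable_cstR.
  exact: integrable_tail2.
apply: le_Rintegral => //.
  by apply: integrableDR; [exact: integrable_cstR|exact: integrable_tail2].
move=> x _; rewrite tail2E; have [h|h] := leP e `|X x|.
  by rewrite lerDr sqr_ge0.
by rewrite addr0 -(real_normK (num_real (X x))) lerXn2r ?nnegrE// ltW.
Qed.

Lemma Rintegral_le_tail2 (f : T -> R) e : measurable_fun setT f ->
  (forall x, `|f x| <= e * X x ^+ 2 + tail2 e x) ->
  `|\int[Q]_x f x| <= e * v + \int[Q]_x tail2 e x.
Proof.
move=> mf fe.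
have ie := integrableZR e iX2.
have iet := integrableDR ie (integrable_tail2 e).
have i_f : Q.-integrable setT (EFin \o f).
  apply: (le_integrable _ _ _ iet) => //; first exact/measurable_EFinP.
  by move=> x _ /=; rewrite lee_fin (le_trans (fe x))//; exact: ler_norm.
rewrite (le_trans (le_normr_Rintegral _ i_f))//.
rewrite -(RintegralZl _ measurableT iX2) -(RintegralD measurableT ie (integrable_tail2 e)).
apply: le_Rintegral => //; exact: integrable_norm.
Qed.

Hypothesis EX0 : \int[Q]_x X x = 0.

Let mcos : measurable_fun setT (cos \o X).
Proof. by apply: measurableT_comp => //; exact: (continuous_measurable_fun (@continuous_cos R)). Qed.
Let msin : measurable_fun setT (sin \o X).
Proof. by apply: measurableT_comp => //; exact: (continuous_measurable_fun (@continuous_sin R)). Qed.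

(** Both sides are compared with [1 - v / 2]. The error [v ^+ 2] of the exponential is written as a
    small factor times [v], so that over all rows the errors add up to a small factor times the
    total variance. *)
Lemma char_cos_le e : 0 < e <= 1 ->
  `|\int[Q]_x cos (X x) - expR (- (v / 2))| <=
  (e * v + \int[Q]_x tail2 e x) + (e ^+ 2 + \int[Q]_x tail2 e x) * v.
Proof.
move=> e01; have /andP[e0 e1] := e01.
have v0 : 0 <= v by apply: Rintegral_ge0 => x _; exact: sqr_ge0.
have icos : Q.-integrable setT (EFin \o (fun x => cos (X x))).
  by apply: (@bounded_integrable _ _ _ Q _ 1) => // x; exact: cos_max.
have i1 : Q.-integrable setT (EFin \o (fun=> 1)) := integrable_cstR Q 1.
have ihalf : Q.-integrable setT (EFin \o (fun x => X x ^+ 2 / 2)).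
  rewrite (_ : (fun x => _) = fun x => 2^-1 * X x ^+ 2); first exact: integrableZR.
  by apply/funext => x; rewrite mulrC.
have E1 : \int[Q]_x (cos (X x) - 1 + X x ^+ 2 / 2) = \int[Q]_x cos (X x) - 1 + v / 2.
  rewrite RintegralD//; last first.
    exact: integrableBR.
  by rewrite RintegralB// Rintegral_cstT (RintegralZr _ measurableT iX2).
have h1 : `|\int[Q]_x cos (X x) - 1 + v / 2| <= e * v + \int[Q]_x tail2 e x.
  rewrite -E1; apply: Rintegral_le_tail2.
    apply: measurable_funD; first exact: measurable_funB.
    by apply: measurable_funM => //; exact: measurable_funX.
  by move=> x; rewrite tail2E; exact: cos_taylor_le.
have h2 : `|expR (- (v / 2)) - 1 + v / 2| <= (e ^+ 2 + \int[Q]_x tail2 e x) * v.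
  apply: (le_trans (expRN_taylor_le _)); first by rewrite divr_ge0.
  have h3 := ler_wpM2r v0 (sqr_le_tail2 e0).
  rewrite expr_div_n; have := sqr_ge0 v; rewrite expr2 in h3 *; lra.
rewrite (_ : _ - _ = (\int[Q]_x cos (X x) - 1 + v / 2) -
  (expR (- (v / 2)) - 1 + v / 2)); last by ring.
by rewrite (le_trans (ler_normB _ _))// lerD.
Qed.

Lemma char_sin_le e : 0 < e <= 1 ->
  `|\int[Q]_x sin (X x)| <= e * v + \int[Q]_x tail2 e x.
Proof.
move=> e01; have iX := integrable_of_sqr.
have isin : Q.-integrable setT (EFin \o (fun x => sin (X x))).
  by apply: (@bounded_integrable _ _ _ Q _ 1) => // x; exact: sin_max.
have -> : \int[Q]_x sin (X x) = \int[Q]_x (sin (X x) - X x).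
  by rewrite RintegralB// EX0 subr0.
apply: Rintegral_le_tail2; first exact: measurable_funB.
by move=> x; rewrite tail2E; exact: sin_taylor_le.
Qed.
End one_variable.

(** * Product laws *)

Section product_law.
Variables (R : realType) (l n : nat) (P : probability 'M[R]_(n, l) R)
  (Q : 'I_n -> probability 'rV[R]_l R).
Hypothesis hPQ : is_product_law P Q.

Lemma measurable_row (i : 'I_n) : measurable_fun setT (fun y : 'M[R]_(n, l) => row i y).
Proof.
apply: measurable_mx => a b.
by under eq_fun do rewrite mxE; exact: measurable_coord.
Qed.

Let mfr (f : 'rV[R]_l -> R) i : measurable_fun setT f ->
  measurable_fun setT (fun y : 'M[R]_(n, l) => f (row i y)).
Proof. by move=> mf; apply: measurableT_comp => //; exact: measurable_row. Qed.

Lemma normr_prod_le1 (I : Type) (s : seq I) (p : pred I) (F : I -> R) :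
  (forall i, `|F i| <= 1) -> `|\prod_(i <- s | p i) F i| <= 1.
Proof.
move=> F1; rewrite normr_prod.
suff /andP[] : 0 <= \prod_(i <- s | p i) `|F i| <= 1 by [].
elim/big_ind : _ => [|x y /andP[x0 x1] /andP[y0 y1]|i _].
- by rewrite ler01 lexx.
- by rewrite mulr_ge0// mulr_ile1.
- by rewrite normr_ge0 F1.
Qed.

(** The law is known on rectangles, that is, for indicators. The rows are freed from being
    indicators one at a time: with the other factors frozen in the weight, [weighted_law] passes to
    a bounded function of one row. *)
Lemma Rintegral_prod_rows (f : 'I_n -> 'rV[R]_l -> R) :
  (forall i, measurable_fun setT (f i)) -> (forall i x, `|f i x| <= 1) ->
  \int[P]_y (\prod_(i < n) f i (row i y)) = \prod_(i < n) \int[Q i]_x f i x.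
Proof.
(* Induction on [m]: rows of index at least [m] carry indicators, the others arbitrary functions
   bounded by 1. For [m = 0] this is the rectangle formula. *)
suff H m : (m <= n)%N -> forall f : 'I_n -> 'rV[R]_l -> R,
    (forall i, measurable_fun setT (f i)) -> (forall i x, `|f i x| <= 1) ->
    (forall i : 'I_n, (m <= i)%N -> exists2 A, measurable A & f i = \1_A) ->
    \int[P]_y (\prod_(i < n) f i (row i y)) = \prod_(i < n) \int[Q i]_x f i x.
  by move=> mf f1; apply: (H n) => // i; rewrite leqNgt ltn_ord.
elim: m => [_|m ih mn] {}f mf f1 fA.
  have /choice[A fAi] : forall i, exists A, measurable A /\ f i = \1_A.
    by move=> i; have [A mA fE] := fA i (leq0n _); exists A.
  rewrite (eq_bigr (fun i => fine (Q i (A i)))); last first.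
    by move=> i _; have [mA ->] := fAi i; rewrite Rintegral_indic.
  under eq_Rintegral do rewrite (eq_bigr _ (fun i _ => congr1 (@^~ _) (fAi i).2)).
  have -> : \prod_(i < n) fine (Q i (A i)) = fine (P [set y | forall i, A i (row i y)]).
    rewrite hPQ; last by move=> i; exact: (fAi i).1.
    apply: EFin_inj; rewrite -prodEFin.
    rewrite (eq_bigr (fun i => Q i (A i))); last first.
      by move=> i _; rewrite fineK// fin_num_measure//; exact: (fAi i).1.
    rewrite fineK//; elim/big_ind : _ => // [x y|i _]; first exact: fin_numM.
    by rewrite fin_num_measure//; exact: (fAi i).1.
  rewrite -Rintegral_indic; last first.
    rewrite (_ : [set y | _] = \bigcap_(i in [set: 'I_n]) (fun y => row i y) @^-1` A i).
      apply: fin_bigcap_measurable => // i _; rewrite -[X in measurable X]setTI.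
      by apply: measurable_row => //; exact: (fAi i).1.
    by apply/seteqP; split => y /= h i; [move=> _; exact: h|exact: (h i Logic.I)].
  apply: eq_Rintegral => y _; rewrite indicE.
  have [h|h] := pselect (forall i, A i (row i y)).
    by rewrite mem_set// big1// => i _; rewrite indicE mem_set//; exact: h.
  rewrite memNset//; have /existsNP[i Ai] := h.
  by rewrite (bigD1 i)//= indicE memNset// mul0r.
pose i0 := Ordinal mn.
pose upd (h : 'rV[R]_l -> R) i := if i == i0 then h else f i.
pose H y := \prod_(i < n | i != i0) f i (row i y).
have H1 y : `|H y| <= 1.
  exact: normr_prod_le1.
have updE h y : \prod_(i < n) upd h i (row i y) = h (row i0 y) * H y.
  rewrite (bigD1 i0)//= {1}/upd eqxx; congr *%R.
  by apply: eq_bigr => i /negPf ni; rewrite /upd ni.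
have updQ h : \prod_(i < n) \int[Q i]_x upd h i x =
    (\prod_(i < n | i != i0) \int[Q i]_x f i x) * \int[Q i0]_x h x.
  rewrite (bigD1 i0)//= {1}/upd eqxx mulrC; congr *%R.
  by apply: eq_bigr => i /negPf ni; rewrite /upd ni.
have fupd : f = upd (f i0).
  by apply/funext => i; rewrite /upd; case: eqP => // ->.
rewrite fupd updQ; under eq_Rintegral do rewrite updE.
apply: (weighted_law (measurable_row i0) _ H1 _ (mf i0) (f1 i0)).
  rewrite /H; under eq_fun do rewrite -big_filter.
  by apply: measurable_prod => i _; exact: mfr.
move=> A mA; rewrite -(Rintegral_indic _ mA) -updQ.
under eq_Rintegral do rewrite -updE.
have i1 (x : 'rV[R]_l) : `|\1_A x : R| <= 1.
  by rewrite indicE; case: (_ \in _); rewrite ?normr1 ?normr0.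
apply: ih; first exact: ltnW.
- by move=> i; rewrite /upd; case: ifP => // _; exact: measurable_indic.
- by move=> i x; rewrite /upd; case: ifP => // _; exact: i1.
- move=> i mi; rewrite /upd; case: eqP => [_|/eqP ni]; first by exists A.
  apply: fA; rewrite ltn_neqAle mi andbT; apply: contra ni => /eqP mE.
  by apply/eqP/val_inj.
Qed.

Lemma row_law (i : 'I_n) A : measurable A -> P ((fun y => row i y) @^-1` A) = Q i A.
Proof.
move=> mA; have := @hPQ (fun j => if j == i then A else setT).
rewrite (bigD1 i)//= eqxx big1; last first.
  by move=> j /negPf ->; exact: probability_setT.
rewrite mule1 => <-; last by move=> j; case: ifP.
congr (P _); apply/seteqP; split => y /=.
  by move=> Ay j; case: eqP => // ->.
by move=> /(_ i); rewrite eqxx.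
Qed.

Let rowm i : {mfun 'M[R]_(n, l) >-> 'rV[R]_l} :=
  HB.pack (fun y : 'M[R]_(n, l) => row i y) (isMeasurableFun.Build _ _ _ _ _ (measurable_row i)).

Lemma integral_row (i : 'I_n) (f : 'rV[R]_l -> \bar R) : measurable_fun setT f ->
  (forall x, 0 <= f x)%E -> (\int[P]_y f (row i y) = \int[Q i]_x f x)%E.
Proof.
move=> mf f0.
rewrite -[LHS](@ge0_integral_distribution _ _ _ _ _ P (rowm i))//.
apply: eq_measure_integral => A mA _. exact: (row_law i mA).
Qed.

Lemma integrable_row (i : 'I_n) (f : 'rV[R]_l -> R) :
  (Q i).-integrable setT (EFin \o f) -> P.-integrable setT (EFin \o (fun y => f (row i y))).
Proof.
move=> /integrableP[/measurable_EFinP mf foo]; apply/integrableP; split.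
  by apply/measurable_EFinP; exact: mfr.
rewrite (integral_row i (f := fun x => `|(f x)%:E|%E))//.
by apply: measurableT_comp => //; exact/measurable_EFinP.
Qed.

Lemma Rintegral_row (i : 'I_n) (f : 'rV[R]_l -> R) :
  (Q i).-integrable setT (EFin \o f) -> \int[P]_y f (row i y) = \int[Q i]_x f x.
Proof.
move=> fi; have /integrableP[/measurable_EFinP mf foo] := fi.
congr fine; rewrite [LHS]integralE [RHS]integralE; congr (_ - _)%E.
  rewrite -(@integral_row i (EFin \o f)^\+%E)//.
    by apply: eq_integral => y _; rewrite !funeposE.
  by apply: measurable_funepos; exact/measurable_EFinP.
rewrite -(@integral_row i (EFin \o f)^\-%E)//.
  by apply: eq_integral => y _; rewrite !funenegE.
by apply: measurable_funeneg; exact/measurable_EFinP.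
Qed.

End product_law.

(** * Independence of two rows *)

Section two_rows.
Variables (R : realType) (l n : nat) (P : probability 'M[R]_(n, l) R)
  (Q : 'I_n -> probability 'rV[R]_l R).
Hypothesis hPQ : is_product_law P Q.
Variables (i j : 'I_n) (ij : i != j).

Let prow (y : 'M[R]_(n, l)) := (row i y, row j y).
Let mprow : measurable_fun setT prow.
Proof. by apply: measurable_fun_pair; exact: measurable_row. Qed.
Let prow_m : {mfun 'M[R]_(n, l) >-> ('rV[R]_l * 'rV[R]_l)%type} :=
  HB.pack prow (isMeasurableFun.Build _ _ _ _ _ mprow).

(** A rectangle in the rows [i] and [j] is a rectangle in all rows whose other sides are [setT], and
    a product measure is determined by its rectangles. *)
Lemma two_rows_law X : measurable X -> ((Q i) \x (Q j))%E X = distribution P prow_m X.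
Proof.
apply: product_measure_unique => A B mA mB.
have := @hPQ (fun k => if k == i then A else if k == j then B else setT).
rewrite (bigD1 i)//= eqxx (bigD1 j)//= 1?eq_sym// (negPf ij) eqxx big1; last first.
  move=> k /andP[/negPf -> /negPf ->]; exact: probability_setT.
rewrite mule1 => <-; last by move=> k; do 2 case: ifP => // _.
congr (P _); apply/seteqP; split => y /=.
  by move=> [Ay By] k; case: eqP => [->//|_]; case: eqP => // ->.
move=> h; split; first by have := h i; rewrite eqxx.
by have := h j; rewrite eq_sym (negPf ij) eqxx.
Qed.

Lemma integral_two_rows (F : ('rV[R]_l * 'rV[R]_l)%type -> \bar R) : measurable_fun setT F ->
  (forall x, 0 <= F x)%E ->
  (\int[P]_y F (row i y, row j y) = \int[Q i]_x \int[Q j]_z F (x, z))%E.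
Proof.
move=> mF F0.
rewrite -[LHS](@ge0_integral_distribution _ _ _ _ _ P prow_m)//.
rewrite -(fubini_tonelli1 (m1 := Q i) (m2 := Q j))//.
by apply: eq_measure_integral => A mA _; exact: (esym (two_rows_law mA)).
Qed.

Variables (f h : 'rV[R]_l -> R).
Hypotheses (fi : (Q i).-integrable setT (EFin \o f)) (hi : (Q j).-integrable setT (EFin \o h)).

Let mf : measurable_fun setT f. Proof. by case/integrableP: fi => /measurable_EFinP. Qed.
Let mh : measurable_fun setT h. Proof. by case/integrableP: hi => /measurable_EFinP. Qed.

Let F (z : ('rV[R]_l * 'rV[R]_l)%type) : R := f z.1 * h z.2.
Let mF : measurable_fun setT (EFin \o F).
Proof. by apply/measurable_EFinP/measurable_funM; exact: measurableT_comp. Qed.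

Let iF : ((Q i) \x (Q j))%E.-integrable setT (EFin \o F).
Proof.
apply/integrable12ltyP => //=.
have s x : (\int[Q j]_y `|(EFin \o F) (x, y)| = `|f x|%:E * \int[Q j]_y `|h y|%:E)%E.
  rewrite -ge0_integralZl//; last by apply/measurable_EFinP/measurableT_comp.
  by apply: eq_integral => y _; rewrite /F/= normrM EFinM.
rewrite (eq_integral (fun x => `|f x|%:E * \int[Q j]_y `|h y|%:E)%E); last by move=> x _; exact: s.
rewrite ge0_integralZr//; last 2 first.
  by apply/measurable_EFinP/measurableT_comp.
  exact: integral_ge0.
have /integrableP[_ /= foo] := fi; have /integrableP[_ /= hoo] := hi.
by rewrite lte_mul_pinfty//; [exact: integral_ge0|rewrite ge0_fin_numE//; exact: integral_ge0].
Qed.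

Lemma integrable_mul_rows : P.-integrable setT (EFin \o (fun y => f (row i y) * h (row j y))).
Proof.
apply/integrableP; split.
  by apply/measurable_EFinP/measurable_funM; apply: measurableT_comp => //; exact: measurable_row.
rewrite (@integral_two_rows (fun z => `|(F z)%:E|%E))//; last exact: measurableT_comp.
have /integrable12ltyP := iF; exact.
Qed.

(** [Rintegral_prod_rows] covers bounded factors; here [f] and [h] are merely integrable, and Fubini
    for the joint law of the two rows is used instead. *)
Lemma Rintegral_mul_rows :
  \int[P]_y (f (row i y) * h (row j y)) = (\int[Q i]_x f x) * (\int[Q j]_x h x).
Proof.
have e1 : (\int[P]_y (f (row i y) * h (row j y))%:E = \int[distribution P prow_m]_z (EFin \o F) z)%E.
  by rewrite integral_distribution//; exact: integrable_mul_rows.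
have e2 : (\int[distribution P prow_m]_z (EFin \o F) z = \int[(Q i) \x (Q j)]_z (EFin \o F) z)%E.
  by apply: eq_measure_integral => A mA _; exact: (esym (two_rows_law mA)).
rewrite /Rintegral e1 e2 -integral12_prod_meas1// /F/= /fubini_F/=.
rewrite -fineM; [|exact: integrable_fin_num|exact: integrable_fin_num].
congr fine; have hE := fineK (integrable_fin_num measurableT hi).
rewrite -hE [RHS]muleC -integralZl//.
apply: eq_integral => x _; rewrite [in RHS]muleC hE -integralZl//.
Qed.
End two_rows.

(** * Second moments of sums over the rows *)

Section integrable_products.
Context d (T : measurableType d) (R : realType) (P : probability T R).

Lemma integrable_mul (X Y : T -> R) : measurable_fun setT X -> measurable_fun setT Y ->
  P.-integrable setT (EFin \o (fun x => X x ^+ 2)) ->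
  P.-integrable setT (EFin \o (fun x => Y x ^+ 2)) ->
  P.-integrable setT (EFin \o (fun x => X x * Y x)).
Proof.
move=> mX mY iX iY.
apply: (@le_integrable _ _ _ P setT measurableT _ _ _ _ (integrableDR iX iY)).
  by apply/measurable_EFinP; exact: measurable_funM.
move=> x _ /=; rewrite lee_fin (ger0_norm (_ : 0 <= X x ^+ 2 + Y x ^+ 2)); last first.
  by rewrite addr_ge0 ?sqr_ge0.
have := sqr_ge0 (X x + Y x); have := sqr_ge0 (X x - Y x).
have := sqr_ge0 (X x); have := sqr_ge0 (Y x).
have -> : (X x + Y x) ^+ 2 = X x ^+ 2 + Y x ^+ 2 + 2 * (X x * Y x) by ring.
have -> : (X x - Y x) ^+ 2 = X x ^+ 2 + Y x ^+ 2 - 2 * (X x * Y x) by ring.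
by rewrite ler_norml => ? ? ? ?; apply/andP; split; lra.
Qed.

Lemma integrable_sqrZ a (X : T -> R) :
  P.-integrable setT (EFin \o (fun x => X x ^+ 2)) ->
  P.-integrable setT (EFin \o (fun x => (a * X x) ^+ 2)).
Proof.
move=> iX.
rewrite (_ : (fun x => _) = fun x => a ^+ 2 * X x ^+ 2); last first.
  by apply/funext => x; rewrite exprMn.
exact: integrableZR.
Qed.

Lemma markov_ineq (Z : T -> R) (e : R) : 0 < e -> P.-integrable setT (EFin \o Z) ->
  (P [set x | (e <= `|Z x|)%R] <= (e^-1 * \int[P]_x `|Z x|)%:E)%E.
Proof.
move=> e0 iZ; have iZn := integrable_norm iZ.
have /integrableP[/measurable_EFinP mZ _] := iZ.
have mA : measurable [set x | e <= `|Z x|].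
  rewrite -[X in measurable X]setTI; apply: measurable_fun_le => //.
  exact: measurableT_comp.
rewrite -(fineK (fin_num_measure P _ mA)) lee_fin ler_pdivlMl// -Rintegral_indic//.
rewrite -RintegralZl//; last by apply: (@bounded_integrable _ _ _ P _ 1) => // x;
  rewrite indicE; case: (_ \in _); rewrite ?normr1 ?normr0.
apply: le_Rintegral => //.
  apply: integrableZR; apply: (@bounded_integrable _ _ _ P _ 1) => // x.
  by rewrite indicE; case: (_ \in _); rewrite ?normr1 ?normr0.
move=> x _; rewrite indicE; have [h|h] := boolP (e <= `|Z x|).
  by rewrite mem_set// mulr1.
by rewrite memNset ?mulr0//; exact/negP.
Qed.
End integrable_products.

Section triangular_array.
Variables (R : realType) (l n : nat) (P : probability 'M[R]_(n, l) R)
  (Q : 'I_n -> probability 'rV[R]_l R).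
Hypothesis hPQ : is_product_law P Q.

Section covariance.
Variables (X Y : 'I_n -> 'rV[R]_l -> R).
Hypotheses (mX : forall i, measurable_fun setT (X i)) (mY : forall i, measurable_fun setT (Y i)).
Hypotheses (iX2 : forall i, (Q i).-integrable setT (EFin \o (fun x => X i x ^+ 2)))
  (iY2 : forall i, (Q i).-integrable setT (EFin \o (fun x => Y i x ^+ 2))).
Hypotheses (EX0 : forall i, \int[Q i]_x X i x = 0).

Let iXY i j : P.-integrable setT (EFin \o (fun y => X i (row i y) * Y j (row j y))).
Proof.
have [<-{j}|ij] := eqVneq i j.
  by apply: (integrable_row hPQ (f := fun x => X i x * Y i x)); exact: integrable_mul.
by apply: (integrable_mul_rows hPQ ij); exact: integrable_of_sqr.
Qed.

Let sumXY : (fun y => (\sum_i X i (row i y)) * (\sum_i Y i (row i y))) =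
  fun y => \sum_i \sum_j X i (row i y) * Y j (row j y).
Proof.
by apply/funext => y; rewrite mulr_suml; apply: eq_bigr => i _; rewrite mulr_sumr.
Qed.

Lemma integrable_sum_mul_sum :
  P.-integrable setT (EFin \o (fun y => (\sum_i X i (row i y)) * (\sum_i Y i (row i y)))).
Proof. by rewrite sumXY; apply: integrable_sumR => i; exact: integrable_sumR. Qed.

(** Independence factors the off-diagonal terms and centring kills them. *)
Lemma Rintegral_sum_mul_sum :
  \int[P]_y ((\sum_i X i (row i y)) * (\sum_i Y i (row i y))) =
  \sum_i \int[Q i]_x (X i x * Y i x).
Proof.
rewrite sumXY Rintegral_sum; last by move=> i; exact: integrable_sumR.
apply: eq_bigr => i _; rewrite Rintegral_sum// (bigD1 i)//= big1 ?addr0.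
  by rewrite -(Rintegral_row hPQ (f := fun x => X i x * Y i x))//; exact: integrable_mul.
move=> j ji; rewrite (Rintegral_mul_rows hPQ) 1?eq_sym//; try exact: integrable_of_sqr.
by rewrite EX0 mul0r.
Qed.
End covariance.

Variables (X : 'I_n -> 'rV[R]_l -> R).
Hypotheses (mX : forall i, measurable_fun setT (X i)).
Hypotheses (iX2 : forall i, (Q i).-integrable setT (EFin \o (fun x => X i x ^+ 2))).

Let v i := \int[Q i]_x (X i x ^+ 2).
Let s := \sum_i v i.
Let L e := \sum_i \int[Q i]_x tail2 (X i) e x.

Let v0 i : 0 <= v i. Proof. by apply: Rintegral_ge0 => x _; exact: sqr_ge0. Qed.
Let s0 : 0 <= s. Proof. exact: sumr_ge0. Qed.
Let tail0 i e : 0 <= \int[Q i]_x tail2 (X i) e x.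
Proof. by apply: Rintegral_ge0 => x _; exact: tail2_ge0. Qed.

(** Split [X i ^+ 2] into a part [t i] in [[0, e ^+ 2]] and the tail. Since
    [t i ^+ 2 <= e ^+ 2 * X i ^+ 2], the centred sum of the bounded parts has second moment at most
    [e ^+ 2 * s]; the centred tails contribute at most twice their mean. *)
Lemma lln_bound e : 0 < e ->
  \int[P]_y `|\sum_i X i (row i y) ^+ 2 - s| <= e * (s + 1) / 2 + 2 * L e.
Proof.
move=> e0.
pose t i x := X i x ^+ 2 - tail2 (X i) e x.
have tE i x : t i x = if e <= `|X i x| then 0 else X i x ^+ 2.
  by rewrite /t tail2E; case: ifP; rewrite ?subrr ?subr0.
have mt i : measurable_fun setT (t i).
  by apply: measurable_funB; [exact: measurable_funX|exact: measurable_tail2].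
have t0 i x : 0 <= t i x by rewrite tE; case: ifP => // _; exact: sqr_ge0.
have te i x : t i x <= e ^+ 2.
  rewrite tE; case: (leP e `|X i x|) => h; first by rewrite sqr_ge0.
  by rewrite -(real_normK (num_real (X i x))) lerXn2r ?nnegrE// ltW.
have tX i x : t i x <= X i x ^+ 2 by rewrite /t lerBlDr lerDl tail2_ge0.
have it i : (Q i).-integrable setT (EFin \o t i).
  by apply: (@bounded_integrable _ _ _ (Q i) _ (e ^+ 2)) => // x; rewrite ger0_norm.
pose Y i x := t i x - \int[Q i]_x t i x.
have mY i : measurable_fun setT (Y i) by exact: measurable_funB.
have iY i : (Q i).-integrable setT (EFin \o Y i).
  by apply: integrableBR => //; exact: integrable_cstR.
have EY0 i : \int[Q i]_x Y i x = 0.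
  by rewrite (RintegralB measurableT (it i) (integrable_cstR _ _)) Rintegral_cstT subrr.
have Et0 i : 0 <= \int[Q i]_x t i x <= e ^+ 2.
  rewrite Rintegral_ge0//=; apply: le_trans (ler_norm _) _.
  by apply: Rintegral_bound => // x; rewrite ger0_norm.
have it2 i : (Q i).-integrable setT (EFin \o (fun x => t i x ^+ 2)).
  apply: (@bounded_integrable _ _ _ (Q i) _ ((e ^+ 2) ^+ 2)); first exact: measurable_funX.
  by move=> x; rewrite ger0_norm ?sqr_ge0// lerXn2r ?nnegrE// sqr_ge0.
have Y2E i x : Y i x ^+ 2 = t i x ^+ 2 - (2 * (\int[Q i]_x t i x)) * t i x + (\int[Q i]_x t i x) ^+ 2.
  by rewrite /Y; ring.
have iY2 i : (Q i).-integrable setT (EFin \o (fun x => Y i x ^+ 2)).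
  under eq_fun do rewrite Y2E.
  apply: integrableDR; last exact: integrable_cstR.
  by apply: integrableBR => //; exact: integrableZR.
have EY2 i : \int[Q i]_x (Y i x ^+ 2) <= e ^+ 2 * v i.
  under eq_Rintegral do rewrite Y2E.
  have iB := integrableZR (2 * \int[Q i]_x t i x) (it i).
  rewrite (RintegralD measurableT (integrableBR (it2 i) iB) (integrable_cstR _ _)).
  rewrite (RintegralB measurableT (it2 i) iB) (RintegralZl _ measurableT (it i)).
  rewrite Rintegral_cstT.
  have : \int[Q i]_x t i x ^+ 2 <= e ^+ 2 * v i.
    rewrite -(RintegralZl _ measurableT (iX2 i)).
    apply: (le_Rintegral measurableT (it2 i) (integrableZR _ (iX2 i))).
    by move=> x _; rewrite expr2 ler_pM.
  have := sqr_ge0 (\int[Q i]_x t i x); lra.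
pose Z y := \sum_i Y i (row i y).
have iYr i : P.-integrable setT (EFin \o (fun y => Y i (row i y))) by exact: (integrable_row hPQ (iY i)).
have iZ : P.-integrable setT (EFin \o Z) by exact: integrable_sumR.
have iZ2 : P.-integrable setT (EFin \o (fun y => Z y ^+ 2)).
  by under eq_fun do rewrite expr2; exact: integrable_sum_mul_sum.
have EZ2 : \int[P]_y (Z y ^+ 2) <= e ^+ 2 * s.
  under eq_Rintegral do rewrite expr2.
  rewrite Rintegral_sum_mul_sum// /s mulr_sumr; apply: ler_sum => i _.
  by under eq_Rintegral do rewrite -expr2.
have EZ : \int[P]_y `|Z y| <= e * (s + 1) / 2.
  (* From the second to the first absolute moment by [2 * e * |Z| <= Z ^+ 2 + e ^+ 2]; the weight
     [e] matches the size of [Z], whose second moment is at most [e ^+ 2 * s]. *)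
  apply: (@le_trans _ _ (\int[P]_y ((2 * e)^-1 * Z y ^+ 2 + e / 2))).
    apply: (le_Rintegral measurableT (integrable_norm iZ)
      (integrableDR (integrableZR _ iZ2) (integrable_cstR _ _))).
    move=> y _; rewrite -(real_normK (num_real (Z y))).
    rewrite (_ : _ + _ = (`|Z y| ^+ 2 + e ^+ 2) / (2 * e)); last first.
      by field; rewrite gt_eqF.
    rewrite ler_pdivlMr ?mulr_gt0//.
    have := sqr_ge0 (`|Z y| - e).
    rewrite (_ : (`|Z y| - e) ^+ 2 = `|Z y| ^+ 2 + e ^+ 2 - `|Z y| * (2 * e)); last by ring.
    by rewrite subr_ge0.
  rewrite (RintegralD measurableT (integrableZR _ iZ2) (integrable_cstR _ _)).
  rewrite (RintegralZl _ measurableT iZ2) Rintegral_cstT.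
  have : (2 * e)^-1 * \int[P]_x Z x ^+ 2 <= e * s / 2.
    rewrite ler_pdivrMl ?mulr_gt0//; apply: (le_trans EZ2).
    by rewrite le_eqVlt; apply/orP; left; apply/eqP; field.
  lra.
pose W y := \sum_i tail2 (X i) e (row i y).
have iW i : P.-integrable setT (EFin \o (fun y => tail2 (X i) e (row i y))).
  exact: (integrable_row hPQ (integrable_tail2 (mX i) (iX2 i) e)).
have iWs : P.-integrable setT (EFin \o W) by exact: integrable_sumR.
have EW : \int[P]_y W y = L e.
  rewrite /W Rintegral_sum//; apply: eq_bigr => i _.
  exact: (Rintegral_row hPQ (integrable_tail2 (mX i) (iX2 i) e)).
have decomp y : \sum_i X i (row i y) ^+ 2 - s = Z y + (W y - L e).
  rewrite /Z /W /s /L -!sumrB -!big_split/=; apply: eq_bigr => i _.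
  rewrite /Y (RintegralB measurableT (iX2 i)); last exact: integrable_tail2.
  by rewrite /t /v; ring.
apply: (@le_trans _ _ (\int[P]_y (`|Z y| + (W y + L e)))).
  apply: le_Rintegral => //.
  - apply: integrable_norm; under eq_fun do rewrite decomp.
    by apply: integrableDR => //; apply: integrableBR => //; exact: integrable_cstR.
  - apply: integrableDR; first exact: integrable_norm.
    by apply: integrableDR => //; exact: integrable_cstR.
  - move=> y _; rewrite decomp (le_trans (ler_normD _ _))// lerD2l.
    rewrite (le_trans (ler_normB _ _))// !ger0_norm//.
      exact: sumr_ge0.
    by apply: sumr_ge0 => i _; exact: tail2_ge0.
have iWL := integrableDR iWs (integrable_cstR P (L e)).
rewrite (RintegralD measurableT (integrable_norm iZ) iWL).
rewrite (RintegralD measurableT iWs (integrable_cstR _ _)).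
rewrite EW Rintegral_cstT; lra.
Qed.

Lemma integrable_sum_sqr :
  P.-integrable setT (EFin \o (fun y => \sum_i X i (row i y) ^+ 2 - s)).
Proof.
apply: integrableBR; last exact: integrable_cstR.
by apply: integrable_sumR => i; exact: (integrable_row hPQ (f := fun x => X i x ^+ 2)).
Qed.

End triangular_array.

(** * Characteristic functions of row sums *)

Section clt.
Variables (R : realType) (l n : nat) (P : probability 'M[R]_(n, l) R)
  (Q : 'I_n -> probability 'rV[R]_l R).
Hypothesis hPQ : is_product_law P Q.
Variables (X : 'I_n -> 'rV[R]_l -> R).
Hypotheses (mX : forall i, measurable_fun setT (X i)).

Let S (s : seq 'I_n) (y : 'M[R]_(n, l)) := \sum_(i <- s) X i (row i y).

Let mS s : measurable_fun setT (S s).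
Proof. by apply: measurable_sum => i; apply: measurableT_comp => //; exact: measurable_row. Qed.

Let mcos d (T : measurableType d) (f : T -> R) : measurable_fun setT f ->
  measurable_fun setT (fun x => cos (f x)).
Proof. by move=> mf; apply: measurableT_comp mf; exact: (continuous_measurable_fun (@continuous_cos R)). Qed.

Let msin d (T : measurableType d) (f : T -> R) : measurable_fun setT f ->
  measurable_fun setT (fun x => sin (f x)).
Proof. by move=> mf; apply: measurableT_comp mf; exact: (continuous_measurable_fun (@continuous_sin R)). Qed.

Definition nice_family (f : 'I_n -> 'rV[R]_l -> R) :=
  (forall i, measurable_fun setT (f i)) /\ (forall i x, `|f i x| <= 1).

(** A test factor in the rows outside [s]. Keeping it arbitrary is what makes the induction in
    [factor] work: a row that joins [s] is taken out of the test factor. *)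
Let H (s : seq 'I_n) (f : 'I_n -> 'rV[R]_l -> R) (y : 'M[R]_(n, l)) :=
  \prod_(i < n | i \notin s) f i (row i y).

Let mH s f : nice_family f -> measurable_fun setT (H s f).
Proof.
move=> [mf _]; rewrite /H; under eq_fun do rewrite -big_filter.
by apply: measurable_prod => i _; apply: measurableT_comp => //; exact: measurable_row.
Qed.

Let H1 s f y : nice_family f -> `|H s f y| <= 1.
Proof. by move=> [_ f1]; exact: normr_prod_le1. Qed.

(* The pair [(A, B)] is the expectation of [(cos, sin)] of the partial sum. *)
Let factor s : uniq s -> exists A B, forall f, nice_family f ->
  \int[P]_y (cos (S s y) * H s f y) = A * \prod_(i < n | i \notin s) \int[Q i]_x f i x /\
  \int[P]_y (sin (S s y) * H s f y) = B * \prod_(i < n | i \notin s) \int[Q i]_x f i x.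
Proof.
elim: s => [_|j s ih /= /andP[js us]].
  exists 1, 0 => f nf; split.
    under eq_Rintegral do rewrite /S big_nil cos0 mul1r.
    by rewrite mul1r (Rintegral_prod_rows hPQ nf.1 nf.2).
  under eq_Rintegral do rewrite /S big_nil sin0 mul0r.
  by rewrite mul0r Rintegral_cstT.
have [A [B AB]] := ih us.
pose a := \int[Q j]_x cos (X j x); pose b := \int[Q j]_x sin (X j x).
exists (A * a - B * b), (B * a + A * b) => f nf.
pose upd (h : 'rV[R]_l -> R) i := if i == j then h else f i.
have nupd (h : 'rV[R]_l -> R) : measurable_fun setT h -> (forall x, `|h x| <= 1) -> nice_family (upd h).
  by move=> mh h1; split => [i|i x]; rewrite /upd; case: ifP => // _; [exact: nf.1|exact: nf.2].
have nc : nice_family (upd (fun x => cos (X j x))).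
  by apply: nupd; [exact: mcos|move=> x; exact: cos_max].
have ns : nice_family (upd (fun x => sin (X j x))).
  by apply: nupd; [exact: msin|move=> x; exact: sin_max].
have HE h y : H s (upd h) y = h (row j y) * H (j :: s) f y.
  rewrite /H (bigD1 j)//= {1}/upd eqxx; congr *%R.
  apply: eq_big => [i|i /andP[_ /negPf ni]]; last by rewrite /upd ni.
  by rewrite inE negb_or andbC.
have QE h : \prod_(i < n | i \notin s) \int[Q i]_x upd h i x =
    (\int[Q j]_x h x) * \prod_(i < n | i \notin j :: s) \int[Q i]_x f i x.
  rewrite (bigD1 j)//= {1}/upd eqxx; congr *%R.
  apply: eq_big => [i|i /andP[_ /negPf ni]]; last by rewrite /upd ni.
  by rewrite inE negb_or andbC.
have [c1 c2] := AB _ nc; have [s1 s2] := AB _ ns.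
rewrite QE -/a in c1 c2; rewrite QE -/b in s1 s2.
have bi (F : R -> R) h : nice_family h -> (forall g : 'M[R]_(n, l) -> R, measurable_fun setT g -> measurable_fun setT (fun y => F (g y))) ->
    (forall z, `|F z| <= 1) -> P.-integrable setT (EFin \o (fun y => F (S s y) * H s h y)).
  move=> nh mF F1; apply: (@bounded_integrable _ _ _ P _ 1).
    by apply: measurable_funM; [exact: mF|exact: mH].
  by move=> y; rewrite normrM mulr_ile1// H1.
have mc (g : 'M[R]_(n, l) -> R) := @mcos _ _ g; have ms (g : 'M[R]_(n, l) -> R) := @msin _ _ g.
have icc := bi cos _ nc mc (@cos_max R); have ics := bi cos _ ns mc (@cos_max R).
have isc := bi sin _ nc ms (@sin_max R); have iss := bi sin _ ns ms (@sin_max R).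
split.
  transitivity (\int[P]_y (cos (S s y) * H s (upd (fun x => cos (X j x))) y -
      sin (S s y) * H s (upd (fun x => sin (X j x))) y)).
    apply: eq_Rintegral => y _; rewrite !HE /S big_cons cosD; ring.
  by rewrite (RintegralB measurableT icc iss) c1 s2; ring.
transitivity (\int[P]_y (sin (S s y) * H s (upd (fun x => cos (X j x))) y +
    cos (S s y) * H s (upd (fun x => sin (X j x))) y)).
  apply: eq_Rintegral => y _; rewrite !HE /S big_cons sinD; ring.
by rewrite (RintegralD measurableT isc ics) c2 s1; ring.
Qed.

Let one_nice : nice_family (fun _ _ => 1).
Proof. by split=> [i|i x]; rewrite ?normr1. Qed.

Let H_one s y : H s (fun _ _ => 1) y = 1. Proof. exact: big1. Qed.

(** By the addition formula it is the pair [(cos, sin)] that behaves multiplicatively over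
    independent summands; [factor] provides the splitting off of row [j]. *)
Let char_cons j s : uniq (j :: s) ->
  \int[P]_y cos (S (j :: s) y) =
  (\int[P]_y cos (S s y)) * (\int[Q j]_x cos (X j x)) -
  (\int[P]_y sin (S s y)) * (\int[Q j]_x sin (X j x)).
Proof.
move=> /= /andP[js us]; have [A [B AB]] := factor us.
have Q1 s' : \prod_(i < n | i \notin s') \int[Q i]_x (1 : R) = 1.
  by rewrite big1// => i _; rewrite Rintegral_cstT.
have Efact (F : R -> R) : \int[P]_y (F (S s y) * H s (fun _ _ => 1) y) = \int[P]_y F (S s y).
  by under eq_Rintegral do rewrite H_one mulr1.
have [] := AB _ one_nice; rewrite !Efact !Q1 !mulr1 => -> ->.
pose upd (h : 'rV[R]_l -> R) i := if i == j then h else fun=> 1.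
have HE h y : H s (upd h) y = h (row j y).
  rewrite /H (bigD1 j)//= {1}/upd eqxx big1 ?mulr1// => i /andP[_ /negPf ni].
  by rewrite /upd ni.
have QE h : \prod_(i < n | i \notin s) \int[Q i]_x upd h i x = \int[Q j]_x h x.
  rewrite (bigD1 j)//= {1}/upd eqxx big1 ?mulr1// => i /andP[_ /negPf ni].
  by rewrite /upd ni Rintegral_cstT.
have nupd (h : 'rV[R]_l -> R) : measurable_fun setT h -> (forall x, `|h x| <= 1) -> nice_family (upd h).
  by move=> mh h1; split => [i|i x]; rewrite /upd; case: ifP => // _; rewrite normr1.
have mXr : measurable_fun setT (fun y : 'M[R]_(n, l) => X j (row j y)).
  by apply: measurableT_comp => //; exact: measurable_row.
have nc := nupd _ (mcos (mX j)) (fun x => cos_max (X j x)).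
have ns := nupd _ (msin (mX j)) (fun x => sin_max (X j x)).
have [c1 _] := AB _ nc; have [_ s2] := AB _ ns.
rewrite !QE in c1 s2; rewrite -c1 -s2.
rewrite -RintegralB//; last 2 first.
- apply: (@bounded_integrable _ _ _ P _ 1) => [|y]; rewrite ?HE.
    by apply: measurable_funM; [exact: mcos|exact: mH].
  by rewrite normrM mulr_ile1// cos_max.
- apply: (@bounded_integrable _ _ _ P _ 1) => [|y]; rewrite ?HE.
    by apply: measurable_funM; [exact: msin|exact: mH].
  by rewrite normrM mulr_ile1// sin_max.
by apply: eq_Rintegral => y _; rewrite !HE /S big_cons cosD; ring.
Qed.

Hypotheses (iX2 : forall i, (Q i).-integrable setT (EFin \o (fun x => X i x ^+ 2))).
Hypothesis EX0 : forall i, \int[Q i]_x X i x = 0.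
Let v i := \int[Q i]_x (X i x ^+ 2).
Let L e := \sum_i \int[Q i]_x tail2 (X i) e x.

(** The rows are exchanged one at a time for the factors [expR (- (v j / 2))]. All factors have
    modulus at most 1, so the errors of the rows add up; the coefficient 2 collects one error from
    the cosine and one from the sine of the row. *)
Lemma clt_bound e : 0 < e <= 1 ->
  `|\int[P]_y cos (\sum_i X i (row i y)) - expR (- ((\sum_i v i) / 2))| <=
  2 * (e * (\sum_i v i) + L e) + (e ^+ 2 + L e) * \sum_i v i.
Proof.
move=> e01; have /andP[e0 e1] := e01.
have v0 i : 0 <= v i by apply: Rintegral_ge0 => x _; exact: sqr_ge0.
have t0 i : 0 <= \int[Q i]_x tail2 (X i) e x.
  by apply: Rintegral_ge0 => x _; exact: tail2_ge0.
pose D i := 2 * (e * v i + \int[Q i]_x tail2 (X i) e x) + (e ^+ 2 + L e) * v i.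
suff H0 s : uniq s -> `|\int[P]_y cos (S s y) - expR (- ((\sum_(i <- s) v i) / 2))| <= \sum_(i <- s) D i.
  have := H0 (index_enum 'I_n) (index_enum_uniq _).
  by rewrite /S /D big_split/= -!mulr_sumr big_split/= -mulr_sumr.
elim: s => [_|j s ih us].
  rewrite !big_nil mul0r oppr0 expR0.
  under eq_Rintegral do rewrite /S big_nil cos0.
  by rewrite Rintegral_cstT subrr normr0.
have us' : uniq s by case/andP: us.
rewrite char_cons// !big_cons.
have := ih us'; set E := \int[P]_y cos (S s y); set F := \int[P]_y sin (S s y).
set V := \sum_(i <- s) v i; set a := \int[Q j]_x cos (X j x); set b := \int[Q j]_x sin (X j x).
move=> {}ih.
have ha := char_cos_le (mX j) (iX2 j) e01; have hb := char_sin_le (mX j) (iX2 j) (EX0 j) e01.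
rewrite -/(v j) -/a in ha; rewrite -/(v j) -/b in hb.
have E1 : `|E| <= 1 by apply: Rintegral_bound => [|y]; [exact: mcos|exact: cos_max].
have F1 : `|F| <= 1 by apply: Rintegral_bound => [|y]; [exact: msin|exact: sin_max].
have V0 : 0 <= V by exact: sumr_ge0.
have vE : expR (- ((v j + V) / 2)) = expR (- (v j / 2)) * expR (- (V / 2)).
  by rewrite -expRD; congr expR; lra.
rewrite vE.
have -> : E * a - F * b - expR (- (v j / 2)) * expR (- (V / 2)) =
  E * (a - expR (- (v j / 2))) + expR (- (v j / 2)) * (E - expR (- (V / 2))) - F * b by ring.
have tL : (e ^+ 2 + \int[Q j]_x tail2 (X j) e x) * v j <= (e ^+ 2 + L e) * v j.
  rewrite ler_wpM2r// lerD2l /L (bigD1 j)//= lerDl; exact: sumr_ge0.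
rewrite (le_trans (ler_normB _ _))//.
have h1 : `|E * (a - expR (- (v j / 2)))| <= `|a - expR (- (v j / 2))|.
  by rewrite normrM ler_piMl.
have h2 : `|expR (- (v j / 2)) * (E - expR (- (V / 2)))| <= `|E - expR (- (V / 2))|.
  by rewrite normrM ler_piMl// ger0_norm ?expR_ge0// expRN_le1// divr_ge0.
have h3 : `|F * b| <= `|b| by rewrite normrM ler_piMl.
have h4 := ler_normD (E * (a - expR (- (v j / 2)))) (expR (- (v j / 2)) * (E - expR (- (V / 2)))).
rewrite /D; lra.
Qed.
End clt.

(** * Cosine approximation of the indicator of a cube *)

Section step_polynomial.
Variable R : realType.
Implicit Types u w : R.

Lemma bernoulli_le w K : -1 <= w -> 1 + w *+ K <= (1 + w) ^+ K.
Proof.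
move=> w1; elim: K => [|K ih]; first by rewrite mulr0n addr0 expr0.
rewrite exprSr (le_trans (y := (1 + w *+ K) * (1 + w)))//; last first.
  by rewrite ler_wpM2r// -lerBlDl sub0r.
rewrite mulrDl mul1r mulrDr mulr1 mulrS.
have : 0 <= (w *+ K) * w by rewrite mulrnAl mulrn_wge0// -expr2 sqr_ge0.
lra.
Qed.

(** The shape [(1 - u ^+ n) ^+ K] is known from the proof of the Stone-Weierstrass theorem by
    Bernoulli's inequality. With [w = u ^+ n], Bernoulli gives [1 - K * w] as a lower bound, useful
    below [u0]; above [u1] one has [(1 - w) ^+ K <= 1 / (1 + w) ^+ K <= 1 / (K * w)]. Taking [K]
    close to [1 / (e * u1 ^+ n)] serves both. *)
Lemma step_poly (u0 u1 e : R) : 0 <= u0 -> u0 < u1 -> u1 <= 1 -> 0 < e ->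
  exists n K, forall u, 0 <= u <= 1 ->
    [/\ 0 <= (1 - u ^+ n) ^+ K <= 1,
        u <= u0 -> 1 - e <= (1 - u ^+ n) ^+ K &
        u1 <= u -> (1 - u ^+ n) ^+ K <= e].
Proof.
move=> u00 u01 u11 e0; have u1_gt0 : 0 < u1 by exact: le_lt_trans u01.
(* As [K <= a + 1] with [a = 1 / (e * u1 ^+ n)] and [u1 <= 1], the loss [K * u0 ^+ n] is at most
   [(u0 / u1) ^+ n * (e^-1 + 1)]. *)
have [n hn] : exists n, (u0 / u1) ^+ n * (e^-1 + 1) < e.
  have r1 : `|u0 / u1| < 1.
    by rewrite ger0_norm ?divr_ge0 ?(ltW u1_gt0)// ltr_pdivrMr// mul1r.
  have c0 : 0 < e / (e^-1 + 1) by rewrite divr_gt0// addr_gt0// invr_gt0.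
  have /cvgrPdist_lt/(_ _ c0)[n _ /(_ n (leqnn n))] := cvg_expr r1.
  rewrite /= sub0r normrN => h; exists n.
  rewrite -ltr_pdivlMr; last by rewrite addr_gt0// invr_gt0.
  exact: le_lt_trans (ler_norm _) h.
pose a := (e * u1 ^+ n)^-1; have a0 : 0 < a by rewrite invr_gt0 mulr_gt0// exprn_gt0.
pose K := (Num.truncn a).+1.
have /andP[Ka aK] : a <= K%:R <= a + 1.
  have /andP[h1 h2] := truncn_itv (ltW a0).
  by rewrite (ltW h2) /K -natr1 lerD2r.
exists n, K => u /andP[uge0 ule1].
have w0 : 0 <= u ^+ n by rewrite exprn_ge0.
have w1 : u ^+ n <= 1 by rewrite exprn_ile1.
have q0 : 0 <= 1 - u ^+ n by rewrite subr_ge0.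
split.
- by rewrite exprn_ge0//= exprn_ile1// gerBl.
- move=> uu0; have := @bernoulli_le (- u ^+ n) K; rewrite lerN2 => /(_ w1).
  apply: le_trans; rewrite mulNrn lerB// -mulr_natr.
  have un : u ^+ n <= u0 ^+ n by rewrite lerXn2r ?nnegrE.
  apply: (le_trans (y := u0 ^+ n * (a + 1))).
    by rewrite ler_pM.
  apply: le_trans (ltW hn); rewrite !mulrDr !mulr1.
  have -> : u0 ^+ n * a = (u0 / u1) ^+ n / e.
    rewrite /a expr_div_n; field; rewrite ?expf_neq0 ?gt_eqF//.
  rewrite lerD2l expr_div_n ler_pdivlMr ?exprn_gt0// ler_piMr ?exprn_ge0//.
  by rewrite exprn_ile1// ltW.
- move=> u1u; have un : u1 ^+ n <= u ^+ n by rewrite lerXn2r ?nnegrE// ltW.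
  have wgt0 : 0 < u ^+ n by rewrite (lt_le_trans _ un)// exprn_gt0.
  have h1 : (1 - u ^+ n) ^+ K * (1 + u ^+ n) ^+ K <= 1.
    rewrite -exprMn -subr_sqr expr1n exprn_ile1// ?gerBl ?sqr_ge0//.
    by rewrite subr_ge0 exprn_ile1.
  have h2 : u ^+ n *+ K <= (1 + u ^+ n) ^+ K.
    apply: le_trans (@bernoulli_le _ K _); first by rewrite lerDr.
    by rewrite (le_trans _ w0)// lerN10.
  have h3 : e^-1 <= u ^+ n *+ K.
    rewrite -mulr_natl (le_trans (y := a * u1 ^+ n))//.
      by rewrite /a invfM mulfVK// expf_neq0// gt_eqF.
    by rewrite ler_pM ?(ltW a0)// exprn_ge0// ltW.
  have h4 : (1 - u ^+ n) ^+ K * e^-1 <= 1.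
    apply: le_trans h1; rewrite ler_wpM2l ?exprn_ge0//.
    exact: le_trans h2.
  by rewrite ler_pdivrMr// mul1r in h4.
Qed.
End step_polynomial.

Section trigonometric.
Variables (R : realType) (k : nat).
Implicit Types (s : seq (R * 'cV[R]_k)) (x t : 'cV[R]_k) (f g : 'cV[R]_k -> R).

Definition dotv t x : R := (t^T *m x) 0 0.

Definition trig s x : R := \sum_(p <- s) p.1 * cos (dotv p.2 x).

Definition is_trig f := exists s, f =1 trig s.

Lemma dotvDl t1 t2 x : dotv (t1 + t2) x = dotv t1 x + dotv t2 x.
Proof. by rewrite /dotv linearD/= mulmxDl mxE. Qed.

Lemma dotvBl t1 t2 x : dotv (t1 - t2) x = dotv t1 x - dotv t2 x.
Proof. by rewrite /dotv linearB/= mulmxBl !mxE. Qed.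

Lemma dotv0l x : dotv 0 x = 0.
Proof. by rewrite /dotv trmx0 mul0mx mxE. Qed.

Lemma is_trig_cst a : is_trig (fun=> a).
Proof. by exists [:: (a, 0)] => x; rewrite /trig big_seq1/= dotv0l cos0 mulr1. Qed.

Lemma is_trig_cos t : is_trig (fun x => cos (dotv t x)).
Proof. by exists [:: (1, t)] => x; rewrite /trig big_seq1/= mul1r. Qed.

Lemma is_trigD f g : is_trig f -> is_trig g -> is_trig (fun x => f x + g x).
Proof.
by move=> [s fs] [s' gs']; exists (s ++ s') => x; rewrite /trig big_cat/= fs gs'.
Qed.

Lemma is_trigZ a f : is_trig f -> is_trig (fun x => a * f x).
Proof.
move=> [s fs]; exists [seq (a * p.1, p.2) | p <- s] => x.
by rewrite fs /trig big_map mulr_sumr; apply: eq_bigr => p _; rewrite mulrA.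
Qed.

Lemma is_trig_sum (I : Type) (r : seq I) (F : I -> 'cV[R]_k -> R) :
  (forall i, is_trig (F i)) -> is_trig (fun x => \sum_(i <- r) F i x).
Proof.
move=> Fi; elim: r => [|i r ih].
  by have [s h] := is_trig_cst 0; exists s => x; rewrite big_nil -h.
by have [s h] := is_trigD (Fi i) ih; exists s => x; rewrite big_cons -h.
Qed.

(** Product-to-sum formula. Closure under products makes a polynomial in cosines a linear
    combination of cosines of linear forms, whose integral is determined by the characteristic
    function. *)
Lemma is_trigM f g : is_trig f -> is_trig g -> is_trig (fun x => f x * g x).
Proof.
move=> [s fs] [s' gs'].
have [r h] : is_trig (fun x => \sum_(p <- s) \sum_(q <- s') (p.1 * q.1 / 2) *
    (cos (dotv (p.2 + q.2) x) + cos (dotv (p.2 - q.2) x))).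
  apply: is_trig_sum => p; apply: is_trig_sum => q; apply: is_trigZ.
  by apply: is_trigD; exact: is_trig_cos.
exists r => x; rewrite -h fs gs' /trig mulr_suml; apply: eq_bigr => p _.
rewrite mulr_sumr; apply: eq_bigr => q _.
by rewrite dotvDl dotvBl cosD cosB; lra.
Qed.

Lemma is_trigX f m : is_trig f -> is_trig (fun x => f x ^+ m).
Proof.
move=> ft; elim: m => [|m ih]; first exact: is_trig_cst.
by have [s h] := is_trigM ft ih; exists s => x; rewrite exprS -h.
Qed.

Lemma is_trig_prod (I : Type) (r : seq I) (F : I -> 'cV[R]_k -> R) :
  (forall i, is_trig (F i)) -> is_trig (fun x => \prod_(i <- r) F i x).
Proof.
move=> Fi; elim: r => [|i r ih].
  by have [s h] := is_trig_cst 1; exists s => x; rewrite big_nil -h.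
by have [s h] := is_trigM (Fi i) ih; exists s => x; rewrite big_cons -h.
Qed.

Lemma prod_ge_1B (I : Type) (r : seq I) (F : I -> R) (e : R) : 0 <= e ->
  (forall i, 1 - e <= F i) -> (forall i, 0 <= F i <= 1) ->
  1 - (size r)%:R * e <= \prod_(i <- r) F i.
Proof.
move=> e0 Fe F01; elim: r => [|i r ih]; first by rewrite big_nil mul0r subr0.
rewrite big_cons /= -natr1 mulrDl mul1r.
have p01 : 0 <= \prod_(j <- r) F j <= 1.
  elim/big_ind : _ => [|x y /andP[x0 x1] /andP[y0 y1]|j _]; last exact: F01.
    by rewrite ler01 lexx.
  by rewrite mulr_ge0// mulr_ile1.
have /andP[p0 p1] := p01; have /andP[f0 f1] := F01 i; have fe := Fe i.
have : 0 <= (1 - F i) * (1 - \prod_(j <- r) F j) by rewrite mulr_ge0// subr_ge0.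
lra.
Qed.

(** [U z = (1 - cos (pi * z / B)) / 2] increases on [[0, B]], and [step_poly] turns it into a step
    between [U t] and [U (t + h)]; the product over the coordinates yields the cube. Beyond [B] the
    cosines repeat, and only the bounds 0 and 1 survive. *)
Lemma trig_sandwich (t h e B : R) : 0 <= t -> 0 < h -> 0 < e -> t + h <= B ->
  exists s, forall x, [/\ 0 <= trig s x <= 1,
    `|x| <= t -> 1 - e <= trig s x &
    t + h < `|x| <= B -> trig s x <= e].
Proof.
move=> t0 h0 e0 tB; have B0 : 0 < B by rewrite (lt_le_trans _ tB)// ltr_wpDl.
pose m := pi / B; have m0 : 0 < m by rewrite divr_gt0// pi_gt0.
have pm z : 0 <= z <= B -> m * z \in `[0, pi].
  move=> /andP[z0 zB]; rewrite in_itv/= mulr_ge0 ?(ltW m0)//= /m mulrAC.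
  by rewrite ler_pdivrMr// ler_wpM2l// pi_ge0.
pose U (z : R) := (1 - cos (m * z)) / 2.
have Ule z w : 0 <= z <= B -> 0 <= w <= B -> (U z <= U w) = (z <= w).
  move=> zB wB; rewrite /U ler_pM2r ?invr_gt0// lerD2l lerN2.
  rewrite leNgt ltr_cos ?pm// -leNgt ler_pM2l//.
have U01 z : 0 <= U z <= 1.
  rewrite /U; have := cos_le1 (m * z); have := cos_geN1 (m * z) => ? ?.
  by rewrite divr_ge0 ?subr_ge0//= ler_pdivrMr// mul1r; lra.
have UN z : U `|z| = U z.
  by rewrite /U -(ger0_norm (ltW m0)) -normrM cos_norm ger0_norm ?(ltW m0).
have tB' : 0 <= t <= B by rewrite t0 (le_trans _ tB)// lerDl ltW.
have thB' : 0 <= t + h <= B by rewrite tB addr_ge0// ltW.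
have Ut0 : U t < U (t + h) by rewrite ltNge Ule// -ltNge ltrDl.
(* The product of [k] factors loses at most [k * (e / k.+1) <= e]; the successor covers [k = 0] as
   well. *)
have d0 : 0 < e / k.+1%:R by rewrite divr_gt0.
have /andP[U0 _] := U01 t; have /andP[_ U1] := U01 (t + h).
have [n [K pK]] := step_poly U0 Ut0 U1 d0.
pose F (i : 'I_k) x := (1 - U (x i 0) ^+ n) ^+ K.
have Ft i : is_trig (F i).
  apply: is_trigX.
  have [s hs] : is_trig (fun x => 1 + -1 * (2^-1 + (- 2^-1) * cos (dotv (m *: delta_mx i 0) x)) ^+ n).
    apply: is_trigD; first exact: is_trig_cst.
    apply: is_trigZ; apply: is_trigX; apply: is_trigD; first exact: is_trig_cst.
    by apply: is_trigZ; exact: is_trig_cos.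
  exists s => x; rewrite -hs mulN1r; congr (1 - _ ^+ _); rewrite /U /dotv.
  rewrite linearZ/= -scalemxAl mxE trmx_delta -rowE mxE; lra.
have [s hs] := is_trig_prod (index_enum 'I_k) Ft.
have F01 i x : 0 <= F i x <= 1 by have [] := pK _ (U01 (x i 0)).
have P01 (p : pred 'I_k) x : 0 <= \prod_(i | p i) F i x <= 1.
  elim/big_ind : _ => [|y z /andP[y0 y1] /andP[z0 z1]|j _]; last exact: F01.
    by rewrite ler01 lexx.
  by rewrite mulr_ge0// mulr_ile1.
have dk : k%:R * (e / k.+1%:R) <= e.
  rewrite mulrCA ler_piMr ?(ltW e0)// ler_pdivrMr// mul1r ler_nat//.
have dk1 : e / k.+1%:R <= e by rewrite ler_piMr ?(ltW e0)// invf_le1// ler1n.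
exists s => x; rewrite -hs; split; first exact: P01.
- move=> /(mx_norm_leP _ t0) xt.
  apply: (@le_trans _ _ (1 - (size (index_enum 'I_k))%:R * (e / k.+1%:R))).
    by rewrite lerB// -[index_enum _]enumT size_enum_ord.
  apply: prod_ge_1B => [|i|i]; [exact: ltW| |exact: F01].
  have [_ + _] := pK _ (U01 (x i 0)); apply.
  by rewrite -UN Ule// normr_ge0 (le_trans (xt i 0))//; case/andP: tB'.
- move=> /andP[xth xB].
  have [i xi] : exists i, t + h < `|x i 0|.
    apply: contrapT => /forallNP h'; move: xth; rewrite ltNge => /negP; apply.
    apply/mx_norm_leP; first by case/andP: thB'.
    by move=> i j; rewrite (ord1 j) leNgt; apply/negP; exact: h'.
  have xiB : `|x i 0| <= B by move/(mx_norm_leP _ (ltW B0)): xB; exact.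
  rewrite (bigD1 i)//=; apply: le_trans dk1.
  have [_ _ hi] := pK _ (U01 (x i 0)).
  apply: (@le_trans _ _ (F i x)).
    have /andP[_ p1] := P01 [pred j | j != i] x.
    by rewrite ler_piMr//; case/andP: (F01 i x).
  by apply: hi; rewrite -[leRHS]UN Ule ?normr_ge0// ltW.
Qed.

End trigonometric.

(** * Normal integrals *)

Section density.
Context d (T : measurableType d) (R : realType).
Variables (lam mu : {measure set T -> \bar R}) (p : T -> R).
Hypotheses (mp : measurable_fun setT p) (p0 : forall x, 0 <= p x).
Hypothesis muE : forall A, measurable A -> mu A = (\int[lam]_(x in A) (p x)%:E)%E.
Local Open Scope ereal_scope.

Let density_indic E : measurable E ->
  \int[mu]_x (\1_E x)%:E = \int[lam]_x ((\1_E x)%:E * (p x)%:E).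
Proof.
move=> mE; rewrite integral_indic// setIT muE//.
rewrite [LHS]integral_mkcond/=; apply: eq_integral => x _.
rewrite patchE indicE; case: ifP => _; first by rewrite mul1e.
by rewrite mul0e.
Qed.

Import HBNNSimple.

Let density_nnsfun (h : {nnsfun T >-> R}) :
  \int[mu]_x (h x)%:E = \int[lam]_x ((h x)%:E * (p x)%:E).
Proof.
under [LHS]eq_integral do rewrite fimfunE -fsumEFin//.
rewrite [LHS]ge0_integral_fsum//; last 2 first.
  - by move=> r; exact/measurable_EFinP/measurableT_comp.
  - by move=> n x _; rewrite EFinM nnfun_muleindic_ge0.
under [RHS]eq_integral.
  move=> x xD; rewrite fimfunE -fsumEFin// ge0_mule_fsuml; last first.
    by move=> r; rewrite EFinM nnfun_muleindic_ge0.
  over.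
rewrite [RHS]ge0_integral_fsum//; last 2 first.
  - move=> r; apply/measurable_EFinP; apply: measurable_funM => //.
    exact: measurable_funM.
  - by move=> n x _; rewrite EFinM mule_ge0// ?nnfun_muleindic_ge0// lee_fin.
apply: eq_fsbigr => r _.
rewrite integralZl_indic_nnsfun//= density_indic//.
have [r0|r0] := leP 0%R r.
  rewrite -ge0_integralZl//.
  - by apply: eq_integral => x _; rewrite EFinM muleA.
  - apply/measurable_EFinP; exact: measurable_funM.
  - by move=> x _; rewrite mule_ge0 ?lee_fin.
rewrite preimage_nnfun0//.
by rewrite !integral0_eq ?mule0// => x _; rewrite indic0 ?mulr0 mul0e.
Qed.

Lemma ge0_integral_density (f : T -> \bar R) : measurable_fun setT f ->
  (forall x, 0 <= f x) -> \int[mu]_x f x = \int[lam]_x (f x * (p x)%:E).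
Proof.
move=> mf f0; pose f_ := nnsfun_approx measurableT mf.
transitivity (limn (fun n => \int[mu]_x (f_ n x)%:E)).
  rewrite -monotone_convergence//=.
  - by apply: eq_integral => x _; apply/esym/cvg_lim => //=; exact: cvg_nnsfun_approx.
  - by move=> n; exact/measurable_EFinP.
  - by move=> n x _; rewrite lee_fin.
  - by move=> x _ a b ab; rewrite lee_fin//; exact/lefP/nd_nnsfun_approx.
rewrite (_ : (fun n => _) = fun n => \int[lam]_x ((f_ n x)%:E * (p x)%:E)); last first.
  by apply/funext => n; rewrite density_nnsfun.
rewrite -monotone_convergence//=.
- apply: eq_integral => x _; apply: cvg_lim => //=.
  by apply: cvgeZr => //; exact: cvg_nnsfun_approx.
- by move=> n; apply/measurable_EFinP/measurable_funM.
- by move=> n x _; rewrite mule_ge0// lee_fin.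
- move=> x _ a b ab; rewrite lee_pmul ?lee_fin//; exact/lefP/nd_nnsfun_approx.
Qed.
End density.

Section affine.
Variable R : realType.
Notation lam := (@lebesgue_measure R).

Let aff (c b : R) (x : measurableTypeR R) : measurableTypeR R := c * (x : R) + b.

Let maff c b : measurable_fun setT (aff c b).
Proof. by apply: measurable_funD => //; exact: measurable_funM. Qed.

Let affmu c b : {measure set (measurableTypeR R) -> \bar R} :=
  measure_function_pushforward__canonical__measure_function_Measure lam (maff c b).

Let aff_law (c b : R) (c0 : 0 < c) A : measurable A ->
  lam A = mscale (NngNum (ltW c0)) (affmu c b) A.
Proof.
move=> mA; apply: lebesgue_measure_unique => //= _ [[x y]] _ <-.
rewrite /mscale/= /pushforward.
have -> : aff c b @^-1` `]x, y] = `](x - b) / c, (y - b) / c]%classic.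
  apply/seteqP; split => z /=; rewrite !in_itv/= /aff ltr_pdivrMr// ler_pdivlMr//.
    by rewrite ltrBlDr lerBrDr (mulrC z).
  by rewrite ltrBlDr lerBrDr (mulrC z).
rewrite !lebesgue_measure_itv/= !lte_fin ltr_pM2r ?invr_gt0// ltrD2r.
case: ifP => _; last by rewrite mule0.
by rewrite -!EFinD -EFinM -mulrBl opprB addrA subrK mulrC divfK// gt_eqF.
Qed.

Lemma ge0_integral_affine (c b : R) (F : R -> \bar R) : 0 < c -> measurable_fun setT F ->
  (forall x, 0 <= F x)%E ->
  (\int[lam]_x F x = c%:E * \int[lam]_x F (c * x + b)%R)%E.
Proof.
move=> c0 mF F0.
have e1 : (\int[affmu c b]_x F x = \int[lam]_x F (c * x + b)%R)%E.
  by rewrite ge0_integral_pushforward//; exact: maff.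
rewrite -e1 -(@ge0_integral_mscale _ _ _ (affmu c b) setT measurableT (NngNum (ltW c0)))//.
by apply: eq_measure_integral => A mA _; exact: (aff_law b c0 mA).
Qed.

Let mneg : measurable_fun setT (-%R : measurableTypeR R -> measurableTypeR R).
Proof. exact: oppr_measurable. Qed.

Let negmu : {measure set (measurableTypeR R) -> \bar R} :=
  measure_function_pushforward__canonical__measure_function_Measure lam mneg.

Lemma ge0_integral_opp (F : R -> \bar R) : measurable_fun setT F ->
  (forall x, 0 <= F x)%E ->
  (\int[lam]_x F x = \int[lam]_x F (- x)%R)%E.
Proof.
move=> mF F0.
have e1 : (\int[negmu]_x F x = \int[lam]_x F (- x)%R)%E by rewrite ge0_integral_pushforward.
rewrite -e1; apply: eq_measure_integral => A mA _; exact/esym/lebesgue_measureN.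
Qed.
End affine.

Section normal_integrals.
Variable R : realType.
Notation lam := (@lebesgue_measure R).
Implicit Types (F : R -> \bar R).

Lemma ge0_integral_normal m s F : measurable_fun setT F -> (forall x, 0 <= F x)%E ->
  (\int[normal_prob m s]_x F x = \int[lam]_x (F x * (normal_pdf m s x)%:E))%E.
Proof.
move=> mF F0; apply: ge0_integral_density => //.
- exact: measurable_normal_pdf.
- exact: normal_pdf_ge0.
Qed.

Lemma normal_peakE (s : R) : 0 < s -> normal_peak s = (s * Num.sqrt (pi *+ 2))^-1.
Proof.
move=> s0; rewrite /normal_peak -mulrnAr sqrtrM ?sqr_ge0//.
by rewrite sqrtr_sqr gtr0_norm.
Qed.

Lemma normal_pdf_gt0E (m s x : R) : 0 < s ->
  normal_pdf m s x = (s * Num.sqrt (pi *+ 2))^-1 * expR (- (x - m) ^+ 2 / (s ^+ 2 * 2)).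
Proof.
by move=> s0; rewrite normal_pdfE ?gt_eqF// normal_peakE// /normal_fun mulr_natr.
Qed.

Let q0 : 0 < Num.sqrt (pi *+ 2 : R).
Proof. by rewrite sqrtr_gt0 mulrn_wgt0// pi_gt0. Qed.

Let maff (c u : R) : measurable_fun setT (fun x : R => c * x + u).
Proof. by apply: measurable_funD => //; exact: measurable_funM. Qed.

Let mpdfE m s : measurable_fun setT (fun x : R => (normal_pdf m s x)%:E).
Proof. by apply/measurable_EFinP; exact: measurable_normal_pdf. Qed.

Let pdfE0 m s (x : R) : setT x -> (0 <= (normal_pdf m s x)%:E)%E.
Proof. by rewrite lee_fin normal_pdf_ge0. Qed.

Let mFp F m s : measurable_fun setT F ->
  measurable_fun setT (fun x => F x * (normal_pdf m s x)%:E)%E.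
Proof. by move=> mF; exact: emeasurable_funM. Qed.

Let Fp0 F m s x : (forall x, 0 <= F x)%E -> (0 <= F x * (normal_pdf m s x)%:E)%E.
Proof. by move=> F0; rewrite mule_ge0// lee_fin normal_pdf_ge0. Qed.

Lemma integral_normal_affine (u c s : R) F : 0 < c -> 0 < s ->
  measurable_fun setT F -> (forall x, 0 <= F x)%E ->
  (\int[normal_prob 0 s]_z F (c * z + u)%R = \int[normal_prob u (c * s)]_x F x)%E.
Proof.
move=> c0 s0 mF F0; have mFc := measurableT_comp mF (maff c u).
rewrite (ge0_integral_normal _ _ mFc (fun x => F0 _)) (ge0_integral_normal _ _ mF F0).
rewrite (@ge0_integral_affine _ c u _ c0 (mFp _ _ mF) (fun x => Fp0 _ _ _ F0)).
rewrite -ge0_integralZl//; last 3 first.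
- exact: measurableT_comp (mFp _ _ mF) (maff c u).
- by move=> x _; exact: Fp0.
- by rewrite lee_fin ltW.
apply: eq_integral => z _; rewrite muleCA -EFinM; congr (_ * _%:E)%E.
rewrite !normal_pdf_gt0E ?mulr_gt0// subr0 addrK mulrA; congr (_ * expR _).
  by field; rewrite !gt_eqF.
by field; rewrite !gt_eqF.
Qed.

Lemma integral_normal_opp (s : R) F : 0 < s ->
  measurable_fun setT F -> (forall x, 0 <= F x)%E ->
  (\int[normal_prob 0 s]_z F (- z)%R = \int[normal_prob 0 s]_x F x)%E.
Proof.
move=> s0 mF F0; have mFo := measurableT_comp mF (@oppr_measurable R setT).
rewrite (ge0_integral_normal _ _ mFo (fun x => F0 _)) (ge0_integral_normal _ _ mF F0).
rewrite [RHS](ge0_integral_opp (mFp _ _ mF) (fun x => Fp0 _ _ _ F0)).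
by apply: eq_integral => x _; rewrite !normal_pdf_gt0E// !subr0 sqrrN.
Qed.

(* Completing the square in the product of the two densities. *)
Let pdf_conv (a b u w : R) : 0 < a -> 0 < b ->
  let r := Num.sqrt (a ^+ 2 + b ^+ 2) in
  normal_pdf u b w * normal_pdf 0 a u =
  normal_pdf 0 r w * normal_pdf (a ^+ 2 * w / (a ^+ 2 + b ^+ 2)) (a * b / r) u.
Proof.
move=> a0 b0 r.
have ab0 : 0 < a ^+ 2 + b ^+ 2 by rewrite addr_gt0 ?exprn_gt0.
have r0 : 0 < r by rewrite sqrtr_gt0.
have r2 : r ^+ 2 = a ^+ 2 + b ^+ 2 by rewrite sqr_sqrtr ?ltW.
rewrite !normal_pdf_gt0E ?divr_gt0 ?mulr_gt0// mulrACA -expRD.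
rewrite [RHS]mulrACA -expRD; congr (_ * expR _).
  by field; rewrite !gt_eqF.
rewrite expr_div_n r2; field.
by rewrite !gt_eqF.
Qed.

Let mpdf2 b : 0 < b -> measurable_fun setT (fun z : R * R => normal_pdf z.1 b z.2).
Proof.
move=> b0; under eq_fun do rewrite normal_pdf_gt0E//.
have m1 : measurable_fun setT (fun z : R * R => (z.2 - z.1) ^+ 2).
  apply: measurable_funX; apply: measurable_funB.
    exact: measurable_snd.
  exact: measurable_fst.
have m2 : measurable_fun setT (fun z : R * R => - (z.2 - z.1) ^+ 2).
  by rewrite (_ : (fun z => _) = (fun z : R * R => -1 * (z.2 - z.1) ^+ 2));
    [exact: measurable_funM|apply/funext => z; rewrite mulN1r].
have m3 : measurable_fun setT (fun z : R * R => - (z.2 - z.1) ^+ 2 / (b ^+ 2 * 2)).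
  exact: measurable_funM.
apply: measurable_funM; first exact: measurable_cst.
exact: measurableT_comp (@measurable_expR R) m3.
Qed.

(** After Tonelli, [pdf_conv] shows the integrand as a function of [u] to be a constant times a
    normal density, which integrates to 1. *)
Lemma integral_normal_conv (a b : R) F : 0 < a -> 0 < b ->
  measurable_fun setT F -> (forall x, 0 <= F x)%E ->
  (\int[normal_prob 0 a]_u \int[normal_prob u b]_w F w =
   \int[normal_prob 0 (Num.sqrt (a ^+ 2 + b ^+ 2))]_w F w)%E.
Proof.
move=> a0 b0 mF F0.
pose G1 (z : R * R) : \bar R := (F z.2 * (normal_pdf z.1 b z.2)%:E)%E.
have mG1 : measurable_fun setT G1.
  apply: emeasurable_funM; first exact: measurableT_comp.
  by apply/measurable_EFinP; exact: mpdf2.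
have G10 z : (0 <= G1 z)%E by rewrite mule_ge0// lee_fin normal_pdf_ge0.
pose G (z : R * R) : \bar R := (G1 z * (normal_pdf 0 a z.1)%:E)%E.
have mG : measurable_fun setT G.
  apply: emeasurable_funM => //; apply/measurable_EFinP.
  by apply: measurableT_comp => //; exact: measurable_normal_pdf.
have G0 z : (0 <= G z)%E by rewrite mule_ge0// lee_fin normal_pdf_ge0.
have mI : measurable_fun setT (fun u => \int[lam]_w G1 (u, w))%E.
  exact: (@measurable_fun_fubini_tonelli_F _ _ _ _ _ lam G1 mG1 G10).
have I0 u : (0 <= \int[lam]_w G1 (u, w))%E by apply: integral_ge0 => w _; exact: G10.
transitivity (\int[normal_prob 0 a]_u \int[lam]_w G1 (u, w))%E.
  by apply: eq_integral => u _; rewrite (ge0_integral_normal _ _ mF F0).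
rewrite (ge0_integral_normal _ _ mI I0) (ge0_integral_normal _ _ mF F0).
transitivity (\int[lam]_u \int[lam]_w G (u, w))%E.
  apply: eq_integral => u _; rewrite -ge0_integralZr// ?lee_fin ?normal_pdf_ge0//.
  exact: measurableT_comp.
rewrite [LHS](@fubini_tonelli _ _ _ _ _ lam lam G mG G0).
apply: eq_integral => w _; rewrite /fubini_G/=.
transitivity (\int[lam]_u (F w * (normal_pdf 0 (Num.sqrt (a ^+ 2 + b ^+ 2)) w)%:E *
    (normal_pdf (a ^+ 2 * w / (a ^+ 2 + b ^+ 2)) (a * b / Num.sqrt (a ^+ 2 + b ^+ 2)) u)%:E))%E.
  by apply: eq_integral => u _; rewrite /G /G1/= -!muleA -!EFinM pdf_conv.
have k0 := Fp0 0 (Num.sqrt (a ^+ 2 + b ^+ 2)) w F0.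
have := ge0_integralZl lam measurableT (mpdfE _ _) (pdfE0 (a ^+ 2 * w / (a ^+ 2 + b ^+ 2)) (a * b / Num.sqrt (a ^+ 2 + b ^+ 2))) k0.
by rewrite integral_normal_pdf mule1.
Qed.

(** Completing the square moves the mean of the density to [t * s ^+ 2]. *)
Lemma normal_exp_moment (s t : R) : 0 < s ->
  (\int[normal_prob 0 s]_x (expR (t * x))%:E = (expR (t ^+ 2 * s ^+ 2 / 2))%:E)%E.
Proof.
move=> s0; rewrite ge0_integral_normal//; last first.
  apply/measurable_EFinP; apply: measurableT_comp => //; exact: measurable_funM.
transitivity (\int[lam]_x ((expR (t ^+ 2 * s ^+ 2 / 2))%:E * (normal_pdf (t * s ^+ 2) s x)%:E))%E.
  apply: eq_integral => x _; rewrite -!EFinM; congr EFin.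
  rewrite !normal_pdf_gt0E// mulrCA -expRD [RHS]mulrCA -expRD; congr (_ * expR _).
  by field; rewrite gt_eqF.
have k0 : (0 <= (expR (t ^+ 2 * s ^+ 2 / 2))%:E)%E by rewrite lee_fin expR_ge0.
have := ge0_integralZl lam measurableT (mpdfE _ _) (pdfE0 (t * s ^+ 2) s) k0.
by rewrite integral_normal_pdf mule1.
Qed.

Lemma normal_prob_itv_le (m s x y : R) : 0 < s -> x <= y ->
  (normal_prob m s `[x, y] <= (normal_peak s * (y - x))%:E)%E.
Proof.
move=> s0 xy; rewrite /normal_prob.
apply: (@le_trans _ _ (\int[lam]_(z in `[x, y]) (normal_peak s)%:E)%E).
  apply: ge0_le_integral => //.
  - by move=> z _; rewrite lee_fin normal_pdf_ge0.
  - by apply/measurable_EFinP; apply: measurable_funTS; exact: measurable_normal_pdf.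
  - by move=> z _; rewrite lee_fin normal_pdf_ub// gt_eqF.
rewrite integral_cst//= lebesgue_measure_itv/= lte_fin.
case: ltP => xy'; first by rewrite -EFinD -EFinM.
by rewrite mule0 lee_fin mulr_ge0 ?subr_ge0// normal_peak_ge0.
Qed.

End normal_integrals.

(** * Bounds on the hyperbolic cosine and the second moment of the normal law *)

Section cosh.
Variable R : realType.
Implicit Types x y z : R.

Definition cosh x : R := (expR x + expR (- x)) / 2.
Definition sinh x : R := (expR x - expR (- x)) / 2.

Lemma cosh_ge1 x : 1 <= cosh x.
Proof.
rewrite /cosh expRN; have e0 := expR_gt0 x.
rewrite ler_pdivlMr// mul1r -subr_ge0.
rewrite (_ : _ - _ = (expR x - 1) ^+ 2 / expR x); first by rewrite divr_ge0 ?sqr_ge0// ltW.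
by field; rewrite gt_eqF.
Qed.

Lemma cosh_ge0 x : 0 <= cosh x. Proof. exact: le_trans (cosh_ge1 x). Qed.

Lemma sinh_eq_cosh_mul x : 0 <= x -> exists2 c, 0 <= c <= x & sinh x = cosh c * x.
Proof.
move=> x0.
have dexpN z : is_derive z 1 (fun y => expR (- y)) (- expR (- z)).
  have -> : - expR (- z) = expR (- z) * (-1) by rewrite mulrN1.
  exact: is_derive1_comp.
have ds z : z \in `]0, x[ -> is_derive z 1 sinh (cosh z).
  move=> _; rewrite /sinh /cosh.
  have := is_deriveM (is_deriveB (is_derive_expR z) (dexpN z)) (is_derive_cst (2^-1 : R) z 1).
  move=> h; apply: (is_derive_eq h).
  by rewrite /= scaler0 add0r /GRing.scale/= opprK mulrC.
have cs : {within `[0, x], continuous sinh}.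
  apply: continuous_subspaceT => z; rewrite /sinh.
  apply: cvgM; last exact: cvg_cst.
  apply: cvgB; first exact: continuous_expR.
  apply: (@continuous_comp _ _ _ (@GRing.opp R) expR); first exact: opp_continuous.
  exact: continuous_expR.
have [c cx] := MVT_segment x0 ds cs.
have -> : sinh 0 = 0 by rewrite /sinh oppr0 subrr mul0r.
rewrite !subr0 => ->; by exists c => //; move: cx; rewrite in_itv.
Qed.

Lemma coshN x : cosh (- x) = cosh x.
Proof. by rewrite /cosh opprK addrC. Qed.

Lemma sinhN x : sinh (- x) = - sinh x.
Proof. by rewrite /sinh opprK; lra. Qed.

Lemma cosh_half x : cosh x = 1 + 2 * sinh (x / 2) ^+ 2.
Proof.
rewrite /cosh /sinh !expRN {1 2}(splitr x) expRD.
by have e0 := expR_gt0 (x / 2); field; rewrite gt_eqF.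
Qed.

Lemma cosh_half2 x : cosh x = 2 * cosh (x / 2) ^+ 2 - 1.
Proof.
rewrite /cosh !expRN {1 2}(splitr x) expRD.
by have e0 := expR_gt0 (x / 2); field; rewrite gt_eqF.
Qed.

Lemma ler_cosh x y : 0 <= x <= y -> cosh x <= cosh y.
Proof.
move=> /andP[x0 xy]; rewrite /cosh ler_pM2r// !expRN -subr_ge0.
have ex := expR_gt0 x; have ey := expR_gt0 y.
have e1 : 1 <= expR x by rewrite -expR0 ler_expR.
have exy : expR x <= expR y by rewrite ler_expR.
rewrite (_ : _ - _ = (expR y - expR x) * (1 - (expR x * expR y)^-1)); last first.
  by field; rewrite !gt_eqF.
rewrite mulr_ge0 ?subr_ge0// invf_le1 ?mulr_gt0//.
by rewrite mulr_ege1// (le_trans e1).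
Qed.

Lemma sqr_sinh_bounds x : x ^+ 2 <= sinh x ^+ 2 <= x ^+ 2 * cosh x ^+ 2.
Proof.
wlog x0 : x / 0 <= x => [h|].
  have [/h//|x0] := leP 0 x; have := h (- x); rewrite oppr_ge0 ltW// => /(_ isT).
  by rewrite sinhN coshN !sqrrN.
have [c cx ->] := sinh_eq_cosh_mul x0; have c1 := cosh_ge1 c.
rewrite exprMn [_ * x ^+ 2]mulrC ler_peMr ?sqr_ge0 ?exprn_ege1//=.
rewrite ler_wpM2l ?sqr_ge0// lerXn2r ?nnegrE ?cosh_ge0//.
exact: ler_cosh.
Qed.

Lemma cosh_ge x : 1 + x ^+ 2 / 2 <= cosh x.
Proof.
rewrite cosh_half; have /andP[h _] := sqr_sinh_bounds (x / 2).
rewrite expr_div_n in h; lra.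
Qed.

(** Dominates the fourth power by a function whose normal integral is known, which gives
    integrability of [x ^+ 4]. *)
Lemma cosh_ge4 x : x ^+ 4 <= 32 * cosh x.
Proof.
rewrite cosh_half2; have := cosh_ge (x / 2); set c := cosh _ => h.
have h2 : (1 + (x / 2) ^+ 2 / 2) ^+ 2 <= c ^+ 2.
  by rewrite lerXn2r ?nnegrE ?(le_trans _ h)// addr_ge0 ?divr_ge0 ?sqr_ge0.
have : (1 + (x / 2) ^+ 2 / 2) ^+ 2 = 1 + x ^+ 2 / 4 + x ^+ 4 / 64 by field.
have := sqr_ge0 x; lra.
Qed.

Lemma cosh_le x : cosh x <= 1 + x ^+ 2 / 2 + x ^+ 4 / 8 * cosh x.
Proof.
(* From [cosh y - 1 = 2 * sinh (y / 2) ^+ 2]. Applying the bound a second time, to the [cosh x - 1]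
   that it contains, produces the fourth-order remainder. *)
have step y : cosh y - 1 <= y ^+ 2 / 4 * (1 + cosh y).
  rewrite {1}cosh_half (cosh_half2 y).
  have /andP[_ h] := sqr_sinh_bounds (y / 2); rewrite (expr_div_n y) in h.
  rewrite (_ : y ^+ 2 / 4 * _ = 2 * (y ^+ 2 / 2 ^+ 2 * cosh (y / 2) ^+ 2)); last by field.
  have -> : 1 + 2 * sinh (y / 2) ^+ 2 - 1 = 2 * sinh (y / 2) ^+ 2 by ring.
  by rewrite ler_pM2l.
have h1 := step x; have x2 := sqr_ge0 x; have c1 := cosh_ge1 x.
have h2 : x ^+ 2 / 4 * (cosh x - 1) <= x ^+ 2 / 4 * (x ^+ 2 / 4 * (1 + cosh x)).
  by rewrite ler_wpM2l// divr_ge0.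
have x4 : x ^+ 4 = x ^+ 2 * x ^+ 2 by rewrite -exprD.
have h3 : 0 <= x ^+ 4 * (cosh x - 1).
  by rewrite mulr_ge0 ?subr_ge0// x4 mulr_ge0.
have : x ^+ 2 / 4 * (1 + cosh x) = x ^+ 2 / 2 + x ^+ 2 / 4 * (cosh x - 1) by field.
have : x ^+ 2 / 4 * (x ^+ 2 / 4 * (1 + cosh x)) = x ^+ 4 / 16 * (1 + cosh x) by rewrite x4; field.
rewrite mulrBr mulr1 in h3; lra.
Qed.

End cosh.

Section normal_moments.
Variable R : realType.
Notation N := (normal_prob 0 1 : probability (measurableTypeR R) R).

Let mexp (t : R) : measurable_fun setT (fun x : R => expR (t * x)).
Proof.
have mm : measurable_fun setT (fun x : R => t * x) by apply: measurable_funM; [exact: measurable_cst|exact: measurable_id].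
exact: measurableT_comp (@measurable_expR R) mm.
Qed.

Let iexp (t : R) : N.-integrable setT (EFin \o (fun x => expR (t * x))).
Proof.
apply/integrableP; split; first by apply/measurable_EFinP; exact: mexp.
under eq_integral do rewrite /= ger0_norm ?expR_ge0//.
by rewrite normal_exp_moment// ltry.
Qed.

Let coshE (t : R) : (fun x => cosh (t * x)) = fun x => 2^-1 * (expR (t * x) + expR (- t * x)).
Proof. by apply/funext => x; rewrite /cosh mulNr mulrC. Qed.

Let mcosh (t : R) : measurable_fun setT (fun x : R => cosh (t * x)).
Proof. by rewrite coshE; apply: measurable_funM => //; exact: measurable_funD. Qed.

Let icosh (t : R) : N.-integrable setT (EFin \o (fun x => cosh (t * x))).
Proof. by rewrite coshE; apply: integrableZR; apply: integrableDR; exact: iexp. Qed.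

Let Ecosh (t : R) : \int[N]_x cosh (t * x) = expR (t ^+ 2 / 2).
Proof.
rewrite coshE (RintegralZl _ measurableT (integrableDR (iexp t) (iexp (- t)))).
rewrite (RintegralD measurableT (iexp t) (iexp (- t))).
by rewrite /Rintegral !normal_exp_moment//= sqrrN expr1n mulr1; lra.
Qed.

Lemma normal_integrable_exp4 : N.-integrable setT (EFin \o (fun x => x ^+ 4)).
Proof.
apply: (@le_integrable _ _ _ N _ measurableT _ _ _ _ (integrableZR 32 (icosh 1))).
  by apply/measurable_EFinP; exact: measurable_funX.
move=> x _ /=; rewrite lee_fin mul1r ger0_norm; last by rewrite exprn_even_ge0.
by rewrite ger0_norm ?cosh_ge4// mulr_ge0// cosh_ge0.
Qed.

Lemma normal_integrable_exp2 : N.-integrable setT (EFin \o (fun x => x ^+ 2)).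
Proof.
apply: integrable_of_sqr; first exact: measurable_funX.
under eq_fun do rewrite -exprM; exact: normal_integrable_exp4.
Qed.

Let bnd (x : R) : R := 16 * (1 + cosh (2 * x)).

Let ibnd : N.-integrable setT (EFin \o bnd).
Proof. by apply: integrableZR; apply: integrableDR => //; exact: integrable_cstR. Qed.

Let bndP (t x : R) : 0 <= t <= 1 -> x ^+ 4 * cosh (t * x) <= bnd x.
Proof.
move=> /andP[t0 t1].
have cn y : cosh `|y| = cosh y :> R by case: (ger0P y) => // _; rewrite coshN.
have h1 : cosh (t * x) <= cosh x.
  rewrite -[leLHS]cn -[leRHS]cn; apply: ler_cosh.
  by rewrite normr_ge0 normrM ger0_norm// ler_piMl.
have c1 := cosh_ge1 x; have x4 := cosh_ge4 x.
have x40 : 0 <= x ^+ 4 by rewrite exprn_even_ge0.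
have := @cosh_half2 _ (2 * x); rewrite (_ : 2 * x / 2 = x); last by field.
rewrite /bnd => ->.
apply: (@le_trans _ _ (32 * cosh x * cosh x)).
  by rewrite ler_pM// cosh_ge0.
lra.
Qed.

(** The integral of [cosh (t * x)] is [expR (t ^+ 2 / 2)]. Comparing both to second order in small
    [t] identifies the coefficient [m / 2]; the remainder is dominated by the integrable [bnd],
    uniformly in [t <= 1]. *)
Lemma normal_second_moment : \int[N]_x (x ^+ 2) = 1.
Proof.
set m := \int[N]_x x ^+ 2; pose K := \int[N]_x bnd x.
have m0 : 0 <= m by apply: Rintegral_ge0 => x _; exact: sqr_ge0.
have K0 : 0 <= K.
  by apply: Rintegral_ge0 => x _; rewrite mulr_ge0// addr_ge0// cosh_ge0.
have i1 := integrable_cstR N 1.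
have lo t : 0 < t <= 1 -> 1 + t ^+ 2 / 2 * m <= expR (t ^+ 2 / 2).
  move=> t01; rewrite -Ecosh -[X in X + _](Rintegral_cstT N).
  have i2 := integrableZR (t ^+ 2 / 2) normal_integrable_exp2.
  rewrite -(RintegralZl _ measurableT normal_integrable_exp2).
  rewrite -(RintegralD measurableT i1 i2).
  apply: (le_Rintegral measurableT (integrableDR i1 i2) (icosh t)) => x _.
  by apply: le_trans (cosh_ge _); rewrite exprMn; lra.
have hi t : 0 < t <= 1 -> expR (t ^+ 2 / 2) <= 1 + t ^+ 2 / 2 * m + t ^+ 4 / 8 * K.
  move=> /andP[t0 t1]; rewrite -Ecosh -[X in X + _ + _](Rintegral_cstT N).
  have i2 := integrableZR (t ^+ 2 / 2) normal_integrable_exp2.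
  have i4 := integrableZR (t ^+ 4 / 8) ibnd.
  rewrite -(RintegralZl _ measurableT normal_integrable_exp2).
  rewrite -(RintegralZl _ measurableT ibnd).
  rewrite -(RintegralD measurableT i1 i2).
  rewrite -(RintegralD measurableT (integrableDR i1 i2) i4).
  apply: (le_Rintegral measurableT (icosh t) (integrableDR (integrableDR i1 i2) i4)) => x _.
  apply: le_trans (cosh_le _) _; rewrite !exprMn.
  have h : x ^+ 4 * cosh (t * x) <= bnd x by apply: bndP; rewrite (ltW t0).
  have : t ^+ 4 / 8 * (x ^+ 4 * cosh (t * x)) <= t ^+ 4 / 8 * bnd x.
    by rewrite ler_wpM2l// divr_ge0// exprn_ge0// ltW.
  lra.
have small (e : R) : 0 < e -> exists t, [/\ 0 < t <= 1, t ^+ 2 <= e & t ^+ 4 = t ^+ 2 * t ^+ 2].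
  move=> e0; exists (Num.min 1 e); rewrite -exprD; split => //.
    by rewrite lt_min ltr01 e0 ge_min lexx.
  have [e1|e1] := leP 1 e; first by rewrite expr1n.
  by rewrite expr2 ler_piMl// ltW.
apply/eqP; rewrite eq_le; apply/andP; split; apply/ler_addgt0Pr => e e0.
  (* Here [t ^+ 2 <= 1] gives [w <= 1 / 2], where [expR w <= 1 + w + w * t ^+ 2]; dividing the lower
     expansion by [w] leaves [m <= 1 + t ^+ 2]. *)
  have [t [t01 te _]] := small (Num.min 1 e) ltac:(by rewrite lt_min ltr01 e0).
  have t2 : 0 < t ^+ 2 by rewrite exprn_gt0//; case/andP: t01.
  have := lo _ t01; set w := t ^+ 2 / 2.
  have w0 : 0 < w by rewrite divr_gt0.
  move: te; rewrite le_min => /andP[te1 te].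
  have hw : expR w <= 1 + w + w * t ^+ 2.
    have h1 := expR_ge1Dx (- w).
    have h2 : expR w * expR (- w) = 1 by rewrite expRN divff// gt_eqF// expR_gt0.
    have w12 : w <= 2^-1 by rewrite /w; lra.
    have h3 : expR w * (1 - w) <= 1 by rewrite -[leRHS]h2 ler_wpM2l ?expR_ge0.
    have h4 : 1 <= (1 + w + w * t ^+ 2) * (1 - w).
      have -> : t ^+ 2 = 2 * w by rewrite /w; field.
      have : 0 <= w ^+ 2 * (1 - 2 * w) by rewrite mulr_ge0 ?sqr_ge0//; lra.
      rewrite !expr2; lra.
    have w1 : 0 < 1 - w by lra.
    by rewrite -(ler_pM2r w1) (le_trans h3).
  move=> h; have : w * m <= w * (1 + t ^+ 2) by lra.
  rewrite ler_pM2l//; lra.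
(* The upper expansion, divided by [t ^+ 2 / 2], reads [1 <= m + t ^+ 2 * (K / 4)]; this fixes how
   small [t ^+ 2] has to be. *)
have e8 : 0 < e / (K / 4 + 1) by rewrite divr_gt0// ltr_wpDl// divr_ge0.
have [t [t01 te t4]] := small _ e8.
have t2 : 0 < t ^+ 2 by rewrite exprn_gt0//; case/andP: t01.
have h1 := hi _ t01; have h2 := expR_ge1Dx (t ^+ 2 / 2).
rewrite t4 in h1.
have : t ^+ 2 * 1 <= t ^+ 2 * (m + t ^+ 2 * (K / 4)) by lra.
rewrite ler_pM2l// => h3; apply: (le_trans h3); rewrite lerD2l.
apply: (@le_trans _ _ (e / (K / 4 + 1) * (K / 4))); first by rewrite ler_wpM2r// divr_ge0.
rewrite mulrAC ler_pdivrMr; last by rewrite ltr_wpDl// divr_ge0.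
by rewrite ler_wpM2l ?(ltW e0)// lerDl.
Qed.

End normal_moments.

(** * Characteristic function of the standard normal law *)

Section normal_character.
Variable R : realType.
Notation N := (normal_prob 0 1 : probability (measurableTypeR R) R).

Lemma EFin_Rintegral d (T : measurableType d) (P : {measure set T -> \bar R}) (f : T -> R) :
  P.-integrable setT (EFin \o f) -> (\int[P]_x (f x)%:E)%E = (\int[P]_x f x)%:E.
Proof. by move=> fi; rewrite /Rintegral fineK//; exact: integrable_fin_num. Qed.

Let mcos d (T : measurableType d) (f : T -> R) : measurable_fun setT f ->
  measurable_fun setT (fun x => cos (f x)).
Proof. by move=> mf; apply: measurableT_comp mf; exact: (continuous_measurable_fun (@continuous_cos R)). Qed.

Let msin d (T : measurableType d) (f : T -> R) : measurable_fun setT f ->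
  measurable_fun setT (fun x => sin (f x)).
Proof. by move=> mf; apply: measurableT_comp mf; exact: (continuous_measurable_fun (@continuous_sin R)). Qed.

Let mlin (a : R) : measurable_fun setT (fun x : R => a * x).
Proof. by apply: measurable_funM; [exact: measurable_cst|exact: measurable_id]. Qed.

Let icos d (T : measurableType d) (P : probability T R) (f : T -> R) :
  measurable_fun setT f -> P.-integrable setT (EFin \o (fun x => cos (f x))).
Proof.
by move=> mf; apply: (@bounded_integrable _ _ _ P _ 1) => [|x]; [exact: mcos|exact: cos_max].
Qed.

Let isin d (T : measurableType d) (P : probability T R) (f : T -> R) :
  measurable_fun setT f -> P.-integrable setT (EFin \o (fun x => sin (f x))).
Proof.
by move=> mf; apply: (@bounded_integrable _ _ _ P _ 1) => [|x]; [exact: msin|exact: sin_max].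
Qed.

Let EFin1D_inj (a b : R) : (1 + a)%:E = (1 + b)%:E -> a = b.
Proof. by move=> [h]; apply: (@addrI _ 1). Qed.

Let psi (s : R) := \int[N]_x cos (s * x).

(** Symmetry of the law. The transformation rules for normal integrals are stated for nonnegative
    integrands, hence the shift to [1 + sin] here and to [1 + cos] below. *)
Let sin_int0 (s : R) : \int[N]_x sin (s * x) = 0.
Proof.
have i1 := integrable_cstR N 1.
have is1 := isin N (mlin s).
have E1 (f : R -> R) : N.-integrable setT (EFin \o f) ->
    (\int[N]_x (1 + f x)%:E)%E = (1 + \int[N]_x f x)%:E.
  move=> fi; rewrite (EFin_Rintegral (integrableDR i1 fi)) (RintegralD measurableT i1 fi).
  by rewrite Rintegral_cstT.
have isN : N.-integrable setT (EFin \o (fun x => - sin (s * x))).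
  by under eq_fun do rewrite -mulN1r; exact: integrableZR.
have := @integral_normal_opp R 1 (fun x => (1 + sin (s * x))%:E) ltr01.
have mF : measurable_fun setT (fun x : R => (1 + sin (s * x))%:E).
  by apply/measurable_EFinP; apply: measurable_funD => //; exact: msin.
have F0 (x : R) : (0 <= (1 + sin (s * x))%:E)%E.
  by rewrite lee_fin -lerBlDl sub0r sin_geN1.
move=> /(_ mF F0).
under [X in X = _ -> _]eq_integral do rewrite mulrN sinN.
rewrite (E1 _ isN) (E1 _ is1) => /EFin1D_inj.
under [X in X = _ -> _]eq_Rintegral do rewrite -mulN1r.
rewrite (RintegralZl _ measurableT is1) mulN1r => /eqP.
by rewrite eq_sym -addr_eq0 -mulr2n mulrn_eq0 => /eqP.
Qed.

Let cos_shift (u b : R) : 0 < b ->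
  (\int[normal_prob u b]_w (1 + cos w)%:E = (1 + cos u * psi b)%:E)%E.
Proof.
move=> b0.
have mF : measurable_fun setT (fun x : R => (1 + cos x)%:E).
  by apply/measurable_EFinP; apply: measurable_funD => //; exact: mcos.
have F0 (x : R) : (0 <= (1 + cos x)%:E)%E.
  by rewrite lee_fin -lerBlDl sub0r cos_geN1.
have := @integral_normal_affine R u b 1 _ b0 ltr01 mF F0.
rewrite mulr1 => <-.
have i1 := integrable_cstR N 1.
have ic := integrableZR (cos u) (icos N (mlin b)).
have iS := integrableZR (sin u) (isin N (mlin b)).
transitivity (\int[N]_z (1 + (cos u * cos (b * z) - sin u * sin (b * z)))%:E)%E.
  by apply: eq_integral => z _; rewrite cosD; congr (_%:E); ring.
rewrite (EFin_Rintegral (integrableDR i1 (integrableBR ic iS))).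
rewrite (RintegralD measurableT i1 (integrableBR ic iS)) Rintegral_cstT.
rewrite (RintegralB measurableT ic iS) (RintegralZl _ measurableT (icos N (mlin b))).
by rewrite (RintegralZl _ measurableT (isin N (mlin b))) sin_int0 mulr0 subr0.
Qed.

Let psi_conv (a b : R) : 0 < a -> 0 < b -> psi (Num.sqrt (a ^+ 2 + b ^+ 2)) = psi a * psi b.
Proof.
move=> a0 b0.
have r0 : 0 < Num.sqrt (a ^+ 2 + b ^+ 2) by rewrite sqrtr_gt0 addr_gt0// exprn_gt0.
have mF : measurable_fun setT (fun x : R => (1 + cos x)%:E).
  by apply/measurable_EFinP; apply: measurable_funD => //; exact: mcos.
have F0 (x : R) : (0 <= (1 + cos x)%:E)%E.
  by rewrite lee_fin -lerBlDl sub0r cos_geN1.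
have := integral_normal_conv a0 b0 mF F0.
rewrite cos_shift// cos0 mul1r.
under [X in X = _ -> _]eq_integral do rewrite cos_shift//.
have := cos_shift 0 a0; rewrite cos0 mul1r.
pose Na : probability (measurableTypeR R) R := normal_prob 0 a.
have i1 := integrable_cstR Na 1.
have ic : Na.-integrable setT (EFin \o (fun x => cos x)) := icos Na (@measurable_id _ _ setT).
rewrite (EFin_Rintegral (P := Na) (integrableDR i1 ic)) (RintegralD measurableT i1 ic) Rintegral_cstT.
move=> /EFin1D_inj ea.
have icp : Na.-integrable setT (EFin \o (fun x => cos x * psi b)).
  by under eq_fun do rewrite mulrC; exact: integrableZR.
rewrite (EFin_Rintegral (P := Na) (integrableDR i1 icp)) (RintegralD measurableT i1 icp) Rintegral_cstT.
move=> /EFin1D_inj; rewrite (RintegralZr _ measurableT ic) ea => ->. by [].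
Qed.

Let psi_pow (a : R) n : 0 < a -> psi (Num.sqrt n.+1%:R * a) = psi a ^+ n.+1.
Proof.
move=> a0; elim: n => [|n ih]; first by rewrite sqrtr1 mul1r expr1.
rewrite exprSr -ih -psi_conv ?mulr_gt0 ?sqrtr_gt0//; congr psi.
rewrite exprMn sqr_sqrtr// -[X in _ + X]mul1r -mulrDl natr1 sqrtrM//.
by rewrite sqrtr_sqr gtr0_norm.
Qed.

Lemma dist_exp_le (x y : R) n : `|x| <= 1 -> `|y| <= 1 ->
  `|x ^+ n - y ^+ n| <= n%:R * `|x - y|.
Proof.
move=> x1 y1; elim: n => [|n ih]; first by rewrite !expr0 subrr normr0 mul0r.
rewrite !exprS (_ : _ - _ = x * (x ^+ n - y ^+ n) + (x - y) * y ^+ n); last by ring.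
rewrite (le_trans (ler_normD _ _))// !normrM -natr1 mulrDl mul1r lerD//.
  by rewrite (le_trans _ ih)// ler_piMl.
by rewrite ler_piMr// normrX exprn_ile1.
Qed.

(** The value 1 of the second moment makes the two functions agree up to order [a ^+ 2]; the fourth
    moment bounds the remainder. *)
Let psi_small : exists C : R, 0 <= C /\ forall a : R, `|psi a - expR (- (a ^+ 2 / 2))| <= C * a ^+ 4.
Proof.
pose m4 := \int[N]_x (x ^+ 4).
have m40 : 0 <= m4 by apply: Rintegral_ge0 => x _; rewrite exprn_even_ge0.
exists (m4 / 8 + 4^-1); split; first by rewrite addr_ge0// divr_ge0.
move=> a; have a4 : 0 <= a ^+ 4 by rewrite exprn_even_ge0.
have i1 := integrable_cstR N 1; have ic := icos N (mlin a).
have i2 := integrableZR (a ^+ 2 / 2) (normal_integrable_exp2 R).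
have i4 := integrableZR (a ^+ 4 / 8) (normal_integrable_exp4 R).
have idf := integrableDR (integrableBR ic i1) i2.
have e1 : \int[N]_x (cos (a * x) - 1 + a ^+ 2 / 2 * x ^+ 2) = psi a - 1 + a ^+ 2 / 2.
  rewrite (RintegralD measurableT (integrableBR ic i1) i2) (RintegralB measurableT ic i1).
  rewrite Rintegral_cstT (RintegralZl _ measurableT (normal_integrable_exp2 R)).
  by rewrite normal_second_moment mulr1.
have h1 : `|psi a - 1 + a ^+ 2 / 2| <= a ^+ 4 / 8 * m4.
  rewrite -e1 (le_trans (le_normr_Rintegral _ idf))//.
  rewrite -(RintegralZl _ measurableT (normal_integrable_exp4 R)).
  apply: (le_Rintegral measurableT (integrable_norm idf) i4) => x _.
  have := cos_ge (a * x); have := cos_le (a * x); rewrite !exprMn => c1 c2.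
  by rewrite /= ger0_norm; lra.
have h2 : `|expR (- (a ^+ 2 / 2)) - 1 + a ^+ 2 / 2| <= a ^+ 4 / 4.
  apply: le_trans (expRN_taylor_le _) _; first by rewrite divr_ge0 ?sqr_ge0.
  by rewrite expr_div_n -exprM; lra.
rewrite (_ : _ - _ = (psi a - 1 + a ^+ 2 / 2) - (expR (- (a ^+ 2 / 2)) - 1 + a ^+ 2 / 2)); last by ring.
rewrite (le_trans (ler_normB _ _))//; lra.
Qed.

(** A central limit argument applied to the normal law itself. With [a = s / sqrt n.+1], stability
    under convolution gives [psi s = psi a ^+ n.+1], and the Gaussian function has the same
    property. Each factor is off by at most [C * a ^+ 4], so the powers differ by at most
    [C * s ^+ 4 / n.+1], for every [n]. *)
Lemma normal_character (s : R) : \int[N]_x cos (s * x) = expR (- (s ^+ 2 / 2)).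
Proof.
wlog s0 : s / 0 < s => [h|].
  have [/h//|s0|<-] := ltgtP 0 s; last first.
    rewrite expr0n/= mul0r oppr0 expR0.
    by under eq_Rintegral do rewrite mul0r cos0; rewrite Rintegral_cstT.
  have := h (- s); rewrite oppr_gt0 s0 sqrrN => /(_ isT) <-.
  by apply: eq_Rintegral => x _; rewrite mulNr cosN.
rewrite -/(psi s); have [C [C0 hC]] := psi_small.
apply/eqP; rewrite -subr_eq0 -normr_le0 leNgt; apply/negP => D0.
set D := `|_| in D0.
have K0 : 0 < C * s ^+ 4 + 1 by rewrite ltr_wpDl// mulr_ge0// exprn_ge0// ltW.
have [n] := exists_natSinv_lt (divr_gt0 D0 K0).
rewrite ltr_pdivlMr// ltNge => /negP; apply.
pose a := s / Num.sqrt n.+1%:R.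
have q0 : 0 < Num.sqrt n.+1%:R :> R by rewrite sqrtr_gt0.
have sE : s = Num.sqrt n.+1%:R * a by rewrite /a mulrC divfK// gt_eqF.
have a0 : 0 < a by rewrite divr_gt0.
have a2 : a ^+ 2 = s ^+ 2 / n.+1%:R by rewrite expr_div_n sqr_sqrtr.
have eE : expR (- (s ^+ 2 / 2)) = expR (- (a ^+ 2 / 2)) ^+ n.+1.
  rewrite -expRM_natl; congr expR; rewrite a2; field.
  by rewrite nat1r pnatr_eq0.
rewrite /D {1}sE psi_pow// eE.
apply: le_trans (dist_exp_le _ _ _) _.
- by apply: Rintegral_bound => [|x]; [exact: mcos|exact: cos_max].
- by rewrite ger0_norm ?expR_ge0// expRN_le1// divr_ge0// sqr_ge0.
apply: (@le_trans _ _ (n.+1%:R * (C * a ^+ 4))); first by rewrite ler_wpM2l.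
have -> : a ^+ 4 = s ^+ 4 / n.+1%:R ^+ 2.
  by rewrite (exprM a 2 2) a2 expr_div_n -exprM.
rewrite (_ : n.+1%:R * _ = n.+1%:R^-1 * (C * s ^+ 4)); last first.
  by field; rewrite nat1r pnatr_eq0.
by rewrite ler_wpM2l ?invr_ge0// lerDl.
Qed.
End normal_character.

(** * Centred normal laws as images of the standard normal law *)

Section normal0_law.
Variable R : realType.
Notation N := (normal_prob 0 1 : probability (measurableTypeR R) R).

Let mlin (a : R) : measurable_fun setT (fun x : R => a * x).
Proof. by apply: measurable_funM; [exact: measurable_cst|exact: measurable_id]. Qed.

Let maff (c u : R) : measurable_fun setT (fun x : R => c * x + u).
Proof. by apply: measurable_funD; [exact: mlin|exact: measurable_cst]. Qed.

Lemma integral_normal_scale (s : R) (F : R -> \bar R) : 0 < s ->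
  measurable_fun setT F -> (forall x, 0 <= F x)%E ->
  (\int[N]_z F (s * z)%R = \int[normal_prob 0 s]_x F x)%E.
Proof.
move=> s0 mF F0; have := integral_normal_affine 0 s0 ltr01 mF F0; rewrite mulr1 => <-.
by apply: eq_integral => z _; rewrite addr0.
Qed.

Lemma integral_normal_scale_norm (s : R) (F : R -> \bar R) :
  measurable_fun setT F -> (forall x, 0 <= F x)%E ->
  (\int[N]_z F (s * z)%R = \int[N]_z F (`|s| * z)%R)%E.
Proof.
move=> mF F0; have [//|s0] := ger0P s.
have mFs : measurable_fun setT (fun z : R => F (s * z)) by exact: measurableT_comp mF (mlin s).
rewrite -(integral_normal_opp ltr01 mFs (fun x => F0 _)).
by apply: eq_integral => z _; rewrite mulrN mulNr.
Qed.

Lemma measurable_integral_normal_affine (c : R) (F : R -> \bar R) : measurable_fun setT F -> (forall x, 0 <= F x)%E ->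
  measurable_fun setT (fun u => \int[N]_z F (c * z + u)%R)%E.
Proof.
move=> mF F0; pose G (p : R * measurableTypeR R) : \bar R := F (c * p.2 + p.1).
have mG : measurable_fun setT G.
  apply: (measurableT_comp mF); apply: measurable_funD; last exact: measurable_fst.
  exact: measurableT_comp (mlin c) measurable_snd.
exact: (@measurable_fun_fubini_tonelli_F _ _ _ _ _ N G mG (fun x => F0 _)).
Qed.

(** Convolution of two independent scaled normals, reduced by symmetry to nonnegative scales. The
    cases [c = 0] and [s = 0] are separate because [integral_normal_conv] requires positive standard
    deviations. *)
Lemma integral_normal_sum (s c : R) (F : R -> \bar R) :
  measurable_fun setT F -> (forall x, 0 <= F x)%E ->
  (\int[N]_w \int[N]_z F (c * z + s * w)%R =
   \int[N]_w F (Num.sqrt (s ^+ 2 + c ^+ 2) * w)%R)%E.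
Proof.
move=> mF F0.
have ms u : measurable_fun setT (fun x : R => x + u).
  by apply: measurable_funD; [exact: measurable_id|exact: measurable_cst].
have tr u : (\int[N]_z F (c * z + u)%R = \int[N]_z F (`|c| * z + u)%R)%E.
  exact: (integral_normal_scale_norm c (measurableT_comp mF (ms u)) (fun x => F0 _)).
transitivity (\int[N]_w \int[N]_z F (`|c| * z + `|s| * w)%R)%E.
  transitivity (\int[N]_w \int[N]_z F (`|c| * z + s * w)%R)%E.
    by apply: eq_integral => w _; exact: tr.
  have := integral_normal_scale_norm s (measurable_integral_normal_affine `|c| mF F0) => -> // u.
  by apply: integral_ge0.
have [->|c0] := eqVneq c 0.
  rewrite expr0n/= addr0 sqrtr_sqr; apply: eq_integral => w _.
  under eq_integral do rewrite normr0 mul0r add0r.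
  by rewrite integral_cst//= (_ : normal_prob _ _ _ = 1%E) ?mule1//; exact: (probability_setT N).
have c1 : 0 < `|c| by rewrite normr_gt0.
have [->|s0] := eqVneq s 0.
  rewrite expr0n/= add0r sqrtr_sqr.
  under eq_integral => w _ do (under eq_integral do rewrite normr0 mul0r addr0).
  by rewrite integral_cst//= (_ : normal_prob _ _ _ = 1%E) ?mule1//; exact: (probability_setT N).
have s1 : 0 < `|s| by rewrite normr_gt0.
have r0 : 0 < Num.sqrt (s ^+ 2 + c ^+ 2).
  by rewrite sqrtr_gt0 addr_gt0// exprn_even_gt0//= orbT.
rewrite (integral_normal_scale r0 mF F0).
rewrite (integral_normal_scale s1 (measurable_integral_normal_affine `|c| mF F0)); last by move=> u; exact: integral_ge0.
rewrite -(real_normK (num_real s)) -(real_normK (num_real c)).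
transitivity (\int[normal_prob 0 `|s|]_u \int[normal_prob u `|c|]_w F w)%E.
  apply: eq_integral => u _.
  by have := integral_normal_affine u c1 ltr01 mF F0; rewrite mulr1.
exact: integral_normal_conv.
Qed.

(** A description valid for [v = 0] too, so that later changes of variables need no case
    distinction. *)
Lemma normal0E (v : R) (B : set R) : 0 <= v -> measurable B ->
  normal0 v B = N ((fun w => Num.sqrt v * w) @^-1` B).
Proof.
move=> v0 mB; rewrite /normal0; have [->|v1] := eqVneq v 0.
  rewrite sqrtr0 diracE; have [B0|B0] := boolP (0 \in B).
    rewrite (_ : _ @^-1` _ = setT); first by rewrite (probability_setT N).
    by apply/seteqP; split => w //= _; rewrite mul0r; exact/set_mem.
  rewrite (_ : _ @^-1` _ = set0) ?measure0//.
  by apply/seteqP; split => w //=; rewrite mul0r => /mem_set; rewrite (negPf B0).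
have s0 : 0 < Num.sqrt v by rewrite sqrtr_gt0 lt_neqAle eq_sym v1.
have mB1 : measurable_fun setT (fun x : R => (\1_B x : R)%:E).
  by apply/measurable_EFinP; exact: measurable_indic.
have i0 x : (0 <= (\1_B x : R)%:E)%E by rewrite lee_fin.
have e := integral_normal_scale s0 mB1 i0.
pose pre : set R := (fun w => Num.sqrt v * w) @^-1` B.
have mpre : measurable pre by rewrite -[X in measurable X]setTI; exact: mlin.
have e1 : (\int[normal_prob 0 (Num.sqrt v)]_x (\1_B x)%:E = normal_prob 0 (Num.sqrt v) B)%E.
  by have := integral_indic (normal_prob 0 (Num.sqrt v)) measurableT mB; rewrite setIT.
have e2 : (\int[N]_z (\1_B (Num.sqrt v * z))%:E = N pre)%E.
  have := integral_indic N measurableT mpre; rewrite setIT => <-.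
  by apply: eq_integral => z _; rewrite !indicE.
by rewrite -e1 -e e2.
Qed.

Context d (T : measurableType d) (P : probability T R) (Y : T -> R).
Hypothesis mY : measurable_fun setT Y.
Variable v : R.
Hypothesis v0 : 0 <= v.
Hypothesis Ylaw : forall B, measurable B -> P (Y @^-1` B) = normal0 v B.

Let Ym : {mfun T >-> R} := HB.pack Y (isMeasurableFun.Build _ _ _ _ _ mY).

Let mlin' (a : R) : measurable_fun setT (fun x : measurableTypeR R => a * (x : R)).
Proof. exact: mlin. Qed.

Let Sm : {mfun (measurableTypeR R) >-> R} :=
  HB.pack (fun x : measurableTypeR R => Num.sqrt v * (x : R)) (isMeasurableFun.Build _ _ _ _ _ (mlin' (Num.sqrt v))).

Lemma ge0_integral_normal0_law (F : R -> \bar R) : measurable_fun setT F -> (forall x, 0 <= F x)%E ->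
  (\int[P]_x F (Y x) = \int[N]_z F (Num.sqrt v * z)%R)%E.
Proof.
move=> mF F0.
rewrite -[LHS](@ge0_integral_distribution _ _ _ _ _ P Ym)//.
rewrite -[RHS](@ge0_integral_distribution _ _ _ _ _ N Sm)//.
apply: eq_measure_integral => B mB _.
by rewrite /= /distribution/= /pushforward/= Ylaw// normal0E.
Qed.

End normal0_law.

(** * Gaussian vectors *)

Section normal0_law_facts.
Variable R : realType.
Notation N := (normal_prob 0 1 : probability (measurableTypeR R) R).
Context d (T : measurableType d) (P : probability T R) (Y : T -> R).
Hypothesis mY : measurable_fun setT Y.
Variable v : R.
Hypothesis v0 : 0 <= v.
Hypothesis Ylaw : forall B, measurable B -> P (Y @^-1` B) = normal0 v B.

Lemma normal0_law_cos : \int[P]_x cos (Y x) = expR (- (v / 2)).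
Proof.
have mcos : measurable_fun setT (@cos R) := continuous_measurable_fun (@continuous_cos R).
have mF : measurable_fun setT (fun x : R => (1 + cos x)%:E).
  by apply/measurable_EFinP; apply: measurable_funD.
have F0 (x : R) : (0 <= (1 + cos x)%:E)%E by rewrite lee_fin -lerBlDl sub0r cos_geN1.
have ic1 : P.-integrable setT (EFin \o (fun x => cos (Y x))).
  by apply: (@bounded_integrable _ _ _ P _ 1) => [|x]; [exact: measurableT_comp|exact: cos_max].
have mlin : measurable_fun setT (fun x : R => Num.sqrt v * x).
  by apply: measurable_funM; [exact: measurable_cst|exact: measurable_id].
have ic2 : N.-integrable setT (EFin \o (fun x => cos (Num.sqrt v * x))).
  by apply: (@bounded_integrable _ _ _ N _ 1) => [|x];
    [exact: measurableT_comp mcos mlin|exact: cos_max].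
have := ge0_integral_normal0_law mY v0 Ylaw mF F0.
rewrite (EFin_Rintegral (integrableDR (integrable_cstR P 1) ic1)).
rewrite (RintegralD measurableT (integrable_cstR P 1) ic1) Rintegral_cstT.
have -> : (\int[N]_z (1 + cos (Num.sqrt v * z))%:E = (1 + expR (- (v / 2)))%:E)%E.
  rewrite (EFin_Rintegral (integrableDR (integrable_cstR N 1) ic2)).
  rewrite (RintegralD measurableT (integrable_cstR N 1) ic2) Rintegral_cstT.
  by rewrite normal_character sqr_sqrtr.
by move=> [h]; apply: (@addrI _ 1).
Qed.

Lemma normal0_law_tail (M : R) : 0 < M ->
  (P [set x | (M <= `|Y x|)%R] <= (v / M ^+ 2)%:E)%E.
Proof.
move=> M0.
have mF : measurable_fun setT (fun x : R => (x ^+ 2)%:E).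
  by apply/measurable_EFinP; exact: measurable_funX.
have F0 (x : R) : (0 <= (x ^+ 2)%:E)%E by rewrite lee_fin sqr_ge0.
have e : (\int[P]_x (Y x ^+ 2)%:E = v%:E)%E.
  rewrite (ge0_integral_normal0_law mY v0 Ylaw mF F0).
  transitivity (\int[N]_z (v * z ^+ 2)%:E)%E.
    by apply: eq_integral => z _; rewrite exprMn sqr_sqrtr.
  rewrite (EFin_Rintegral (integrableZR v (normal_integrable_exp2 R))).
  by rewrite (RintegralZl _ measurableT (normal_integrable_exp2 R)) normal_second_moment mulr1.
have iY2 : P.-integrable setT (EFin \o (fun x => Y x ^+ 2)).
  apply/integrableP; split; first by apply/measurable_EFinP; exact: measurable_funX.
  by under eq_integral do rewrite /= ger0_norm ?sqr_ge0//; rewrite e ltry.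
have M2 : 0 < M ^+ 2 by rewrite exprn_gt0.
have := markov_ineq M2 iY2.
have -> : [set x | M ^+ 2 <= `|Y x ^+ 2|] = [set x | M <= `|Y x|].
  apply/seteqP; split => x /=; rewrite normrX.
    by rewrite ler_sqr ?nnegrE// ltW.
  by rewrite ler_sqr ?nnegrE// ltW.
move=> /le_trans; apply; rewrite lee_fin mulrC.
have -> : \int[P]_x `|Y x ^+ 2| = v by rewrite (_ : v = fine v%:E)// -e;
  apply: eq_Rintegral => x _; rewrite ger0_norm ?sqr_ge0.
by [].
Qed.
End normal0_law_facts.

(** The standard normal density is at most [1 / sqrt (2 pi) <= 1]. *)
Lemma normal0_law_itv (R : realType) d (T : measurableType d) (P : probability T R) (Y : T -> R)
    (a b : R) : (forall B, measurable B -> P (Y @^-1` B) = normal0 1 B) -> a <= b ->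
  (P [set x | (a <= Y x <= b)%R] <= (b - a)%:E)%E.
Proof.
move=> Ylaw ab.
have := Ylaw `[a, b]%classic (measurable_itv _).
have -> : Y @^-1` `[a, b]%classic = [set x | a <= Y x <= b].
  by apply/seteqP; split => x /=; rewrite in_itv.
move=> ->; rewrite /normal0 oner_eq0 sqrtr1.
apply: le_trans (normal_prob_itv_le 0 ltr01 ab) _.
have p2 : 1 <= pi *+ 2 :> R by rewrite mulr2n; have := pi_ge2 R; lra.
have p0 : 0 < pi *+ 2 :> R by exact: lt_le_trans p2.
rewrite lee_fin normal_peakE// mul1r ler_piMl ?subr_ge0// invf_le1 ?sqrtr_gt0//.
by rewrite -[leLHS]sqrtr1 ler_wsqrtr.
Qed.

(** * Nonnegative definite matrices *)

Section psd.
Variables (R : realType) (k : nat).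
Implicit Types (A B : 'M[R]_k) (x y z v : 'cV[R]_k).

Definition bform A x y : R := (x^T *m A *m y) 0 0.

Lemma bformDl A x y z : bform A (x + y) z = bform A x z + bform A y z.
Proof. by rewrite /bform linearD/= !mulmxDl mxE. Qed.

Lemma bformDr A x y z : bform A x (y + z) = bform A x y + bform A x z.
Proof. by rewrite /bform mulmxDr mxE. Qed.

Lemma bformZl A (a : R) x y : bform A (a *: x) y = a * bform A x y.
Proof. by rewrite /bform linearZ/= -!scalemxAl mxE. Qed.

Lemma bformZr A (a : R) x y : bform A x (a *: y) = a * bform A x y.
Proof. by rewrite /bform -scalemxAr mxE. Qed.

Lemma bformC A x y : A^T = A -> bform A x y = bform A y x.
Proof.
by move=> As; rewrite /bform -[in LHS](trmxK (x^T *m A *m y)) mxE !trmx_mul trmxK As mulmxA.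
Qed.

Lemma bform_addmx A B x y : bform (A + B) x y = bform A x y + bform B x y.
Proof. by rewrite /bform mulmxDr mulmxDl mxE. Qed.

Lemma dotvC x y : dotv x y = dotv y x.
Proof. by rewrite /dotv -[in LHS](trmxK (x^T *m y)) mxE trmx_mul trmxK. Qed.

Lemma dotvZl (a : R) x y : dotv (a *: x) y = a * dotv x y.
Proof. by rewrite /dotv linearZ/= -scalemxAl mxE. Qed.

Lemma bform_outer v x y : bform (v *m v^T) x y = dotv v x * dotv v y.
Proof.
rewrite /bform /dotv mulmxA -mulmxA mxE big_ord1; congr (_ * _).
by rewrite -[in LHS](trmxK (x^T *m v)) mxE trmx_mul trmxK.
Qed.

Lemma bform_delta A i j : bform A (delta_mx i 0) (delta_mx j 0) = A i j.
Proof. by rewrite /bform trmx_delta -rowE -colE !mxE. Qed.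

Lemma psdmxP A x : psdmx A -> 0 <= bform A x x.
Proof. by move=> [_]; apply. Qed.

Lemma psdmx_diag_ge0 A i : psdmx A -> 0 <= A i i.
Proof. by move=> /(psdmxP (delta_mx i 0)); rewrite bform_delta. Qed.

Lemma psdmx_ker A x : psdmx A -> bform A x x = 0 -> A *m x = 0.
Proof.
move=> Ap Ax0; have [As _] := Ap.
have b0 z : bform A z x = 0.
  set b := bform A z x; pose c := bform A z z.
  have c0 : 0 <= c by exact: psdmxP.
  have c1 : 0 < c + 1 by rewrite ltr_wpDl.
  (* The form on the line [x + s *: z] is smallest at [- b / c]; [c + 1] replaces [c] to allow
     [c = 0], and the value is still negative unless [b = 0]. *)
  pose s := - b / (c + 1).
  have := psdmxP (x + s *: z) Ap.
  rewrite bformDl !bformDr !bformZl !bformZr Ax0 add0r (bformC x z As) -/b -/c.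
  have -> : s * b + (s * b + s * (s * c)) = - (b ^+ 2 * ((c + 2) / (c + 1) ^+ 2)).
    by rewrite /s; field; rewrite gt_eqF.
  rewrite oppr_ge0 pmulr_lle0; last by rewrite divr_gt0 ?exprn_gt0// ltr_wpDl.
  by move=> h; apply/eqP; rewrite -sqrf_eq0 eq_le h sqr_ge0.
apply/matrixP => i j; rewrite (ord1 j) [in RHS]mxE.
by have := b0 (delta_mx i 0); rewrite /bform trmx_delta -mulmxA -rowE mxE.
Qed.

Lemma psdmx_diag0 A i j : psdmx A -> A j j = 0 -> A i j = 0.
Proof.
move=> Ap Aj; have := psdmx_ker Ap (_ : bform A (delta_mx j 0) (delta_mx j 0) = 0).
rewrite bform_delta => /(_ Aj) /matrixP /(_ i 0).
by rewrite -colE !mxE.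
Qed.

Lemma bform_scalemx (a : R) A x y : bform (a *: A) x y = a * bform A x y.
Proof. by rewrite /bform -scalemxAr -scalemxAl mxE. Qed.

Lemma psdmx0 : psdmx (0 : 'M[R]_k).
Proof. by split=> [|x]; rewrite ?trmx0// mulmx0 mul0mx mxE. Qed.

Lemma psdmxD A B : psdmx A -> psdmx B -> psdmx (A + B).
Proof.
move=> Ap Bp; split; first by rewrite linearD/= Ap.1 Bp.1.
by move=> x; rewrite -/(bform _ x x) bform_addmx addr_ge0//; exact: psdmxP.
Qed.

Lemma psdmx_outer v : psdmx (v *m v^T).
Proof.
split; first by rewrite trmx_mul trmxK.
by move=> x; rewrite -/(bform _ x x) bform_outer -expr2 sqr_ge0.
Qed.

(** Schur complement. At [x] the reduced form takes the value of the form of [A] at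
    [x - (b / a) e_j], the point of that line where it is smallest; hence it is nonnegative. *)
Lemma psdmx_schur A j : psdmx A -> 0 < A j j ->
  let v : 'cV[R]_k := (Num.sqrt (A j j))^-1 *: (A *m delta_mx j 0) in
  psdmx (A - v *m v^T) /\ forall i, (v *m v^T) i i = (A j j)^-1 * A i j ^+ 2.
Proof.
move=> Ap a0 v; have [As _] := Ap.
have vv : v *m v^T = (A j j)^-1 *: ((A *m (delta_mx j 0 : 'cV[R]_k)) *m (A *m (delta_mx j 0 : 'cV[R]_k))^T).
  rewrite /v linearZ/= -scalemxAr -scalemxAl scalerA -invfM -expr2 sqr_sqrtr ?ltW//.
split; last first.
  by move=> i; rewrite vv mxE mxE big_ord1 -colE [_^T _ _]mxE mxE expr2.
split; first by rewrite linearB/= trmx_mul trmxK As.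
move=> x; rewrite -/(bform _ x x) bform_addmx -scaleN1r bform_scalemx vv bform_scalemx bform_outer.
have -> : dotv (A *m delta_mx j 0) x = bform A (delta_mx j 0) x.
  by rewrite /dotv /bform trmx_mul As.
set b := bform A (delta_mx j 0) x; set a := A j j in a0 *.
have := psdmxP (x + (- (b / a)) *: delta_mx j 0) Ap.
rewrite bformDl !bformDr !bformZl !bformZr bform_delta (bformC x _ As) -/b -/a.
move=> h; apply: le_trans h _; rewrite le_eqVlt; apply/orP; left; apply/eqP.
by field; rewrite gt_eqF.
Qed.

(** A nonnegative definite matrix is a sum of outer products, as in Cholesky elimination. The Schur
    step annihilates the diagonal entry [j] and keeps zero diagonal entries zero, so the number of
    nonzero ones decreases; when none is left, the matrix is 0. *)
Lemma psdmx_ind (Pr : 'M[R]_k -> Prop) : Pr 0 ->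
  (forall A v, psdmx A -> Pr A -> Pr (A + v *m v^T)) -> forall A, psdmx A -> Pr A.
Proof.
move=> Pr0 Prv A; have [m] := ubnP #|[pred i | A i i != 0]|.
elim: m A => // m ih A; rewrite ltnS => Am Ap.
have [/existsP[j Aj]|/existsPn A0] := boolP [exists j, A j j != 0]; last first.
  have -> : A = 0; last exact: Pr0.
  apply/matrixP => i j; rewrite [RHS]mxE; apply: psdmx_diag0 => //.
  by apply/eqP; have := A0 j; rewrite negbK.
have a0 : 0 < A j j by rewrite lt_neqAle eq_sym Aj psdmx_diag_ge0.
have [Bp vE] := psdmx_schur Ap a0; set v := _ *: _ in Bp vE.
rewrite -(subrK (v *m v^T) A); apply: Prv => //; apply: ih => //.
apply: leq_trans Am; apply: proper_card; apply/properP; split.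
  apply/fintype.subsetP => i; rewrite !inE; apply: contra => /eqP Ai.
  have Aij : A i j = 0 by rewrite -[in LHS]Ap.1 mxE (psdmx_diag0 j Ap Ai).
  by rewrite mxE [X in _ + X]mxE vE Ai Aij expr0n/= mulr0 subrr.
exists j; rewrite !inE// mxE [X in _ + X]mxE vE negbK; apply/eqP.
by field; rewrite gt_eqF.
Qed.

End psd.

(** * Existence of Gaussian vectors with a given covariance matrix *)

Section gaussian_existence.
Variables (R : realType) (k : nat).
Notation N := (normal_prob 0 1 : probability (measurableTypeR R) R).

Lemma measurable_dotv (t : 'cV[R]_k) : measurable_fun setT (dotv t).
Proof.
rewrite /dotv; under eq_fun do rewrite mxE.
by apply: measurable_sum => i; apply: measurable_funM => //; exact: measurable_coord.
Qed.

Let add_mul (v : 'cV[R]_k) (p : ('cV[R]_k * measurableTypeR R)%type) : 'cV[R]_k := p.1 + (p.2 : R) *: v.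

Let madd_mul v : measurable_fun setT (add_mul v).
Proof.
apply: measurable_mx => i j; rewrite /add_mul; under eq_fun do rewrite !mxE.
apply: measurable_funD.
  exact: measurableT_comp (measurable_coord i j) measurable_fst.
by apply: measurable_funM; [exact: measurable_snd|exact: measurable_cst].
Qed.

(** If [Z] has law [mu] and [xi] is an independent standard normal, [Z + xi v] has covariance
    [A + v v']; its projection on [t] is a sum of two independent centred normals, handled by
    [integral_normal_sum]. *)
Let gaussian_step A (v : 'cV[R]_k) : psdmx A ->
  (exists mu : probability 'cV[R]_k R, is_gaussian A mu) ->
  exists mu : probability 'cV[R]_k R, is_gaussian (A + v *m v^T) mu.
Proof.
move=> Ap [mu [_ muA]].
pose f : {mfun ('cV[R]_k * measurableTypeR R)%type >-> 'cV[R]_k} :=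
  HB.pack (add_mul v) (isMeasurableFun.Build _ _ _ _ _ (madd_mul v)).
pose PP : probability ('cV[R]_k * measurableTypeR R)%type R := (mu \x N)%E.
exists (distribution PP f); split; first by apply: psdmxD => //; exact: psdmx_outer.
move=> t B mB.
rewrite -/(bform _ t t) bform_addmx bform_outer -expr2.
have At0 : 0 <= bform A t t by exact: psdmxP.
have mB1 : measurable_fun setT (fun x : R => (\1_B x : R)%:E).
  by apply/measurable_EFinP; exact: measurable_indic.
have i0 x : (0 <= (\1_B x : R)%:E)%E by rewrite lee_fin.
pose S : set ('cV[R]_k * measurableTypeR R)%type := f @^-1` ((dotv t) @^-1` B).
have mS : measurable S.
  have mSf : measurable_fun setT (dotv t \o f).
    by apply: measurableT_comp; [exact: measurable_dotv|exact: madd_mul].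
  by rewrite -[X in measurable X]setTI; exact: mSf.
have mS1 : measurable_fun setT (fun p : ('cV[R]_k * measurableTypeR R)%type => (\1_S p : R)%:E).
  by apply/measurable_EFinP; exact: measurable_indic.
have j0 p : (0 <= (\1_S p : R)%:E)%E by rewrite lee_fin.
transitivity (PP S); first by [].
have := integral_indic PP measurableT mS; rewrite setIT => <-.
rewrite (@fubini_tonelli1 _ _ _ _ _ mu N _ mS1 j0) /fubini_F.
pose c := dotv v t.
transitivity (\int[mu]_x \int[N]_z (\1_B (c * z + dotv t x))%:E)%E.
  apply: eq_integral => x _; apply: eq_integral => z _.
  rewrite !indicE; congr (nat_of_bool _)%:R%:E.
  have <- : dotv t (f (x, z)) = c * z + dotv t x.
    rewrite /c -[f (x, z)]/(x + (z : R) *: v) dotvC dotvDl dotvZl (dotvC x t).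
    by rewrite addrC mulrC.
  by apply/idP/idP; rewrite !inE.
have law C : measurable C -> mu (dotv t @^-1` C) = normal0 (bform A t t) C by exact: muA.
have := integral_normal_sum (Num.sqrt (bform A t t)) c mB1 i0.
have H0 u : (0 <= \int[N]_z (\1_B (c * z + u) : R)%:E)%E by apply: integral_ge0.
have := ge0_integral_normal0_law (measurable_dotv t) At0 law
  (measurable_integral_normal_affine c mB1 i0) H0.
move=> -> ->; rewrite sqr_sqrtr// normal0E//; last by rewrite addr_ge0 ?sqr_ge0.
have mpre : measurable ((fun w : measurableTypeR R => Num.sqrt (bform A t t + c ^+ 2) * w) @^-1` B).
  rewrite -[X in measurable X]setTI.
  apply: (measurable_funM _ _ measurableT mB) => //.
have := integral_indic N measurableT mpre; rewrite setIT => <-.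
by apply: eq_integral => z _; rewrite !indicE.
Qed.

Lemma gaussian_exists (A : 'M[R]_k) : psdmx A -> exists mu : probability 'cV[R]_k R, is_gaussian A mu.
Proof.
move: A; apply: psdmx_ind; last by move=> A v; exact: gaussian_step.
exists (\d_(0 : 'cV[R]_k)); split; first exact: psdmx0.
move=> t B mB; rewrite /normal0 mulmx0 mul0mx mxE eqxx !diracE.
congr (nat_of_bool _)%:R%:E; apply/idP/idP; rewrite !inE/=.
  by rewrite mulmx0 mxE.
by rewrite mulmx0 mxE.
Qed.

Lemma gaussianP (A : 'M[R]_k) : psdmx A -> is_gaussian A (gaussian A).
Proof. by move=> /gaussian_exists[mu muA]; rewrite /gaussian; case: xgetP => // /(_ mu). Qed.

End gaussian_existence.

(** * Correlation matrices and the operator norm *)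

Section pseudo_inverse.
Variable R : realType.

Lemma mpinv_unique m n (A : 'M[R]_(m, n)) (B C : 'M[R]_(n, m)) :
  is_mpinv A B -> is_mpinv A C -> B = C.
Proof.
move=> [ABA BAB ABs BAs] [ACA CAC ACs CAs].
have AB_AC : A *m B = A *m C.
  by rewrite -{1}ACA -mulmxA -ABs -ACs -trmx_mul !mulmxA ABA.
have BA_CA : B *m A = C *m A.
  have -> : B *m A = (B *m A) *m (C *m A) by rewrite -{1}ACA !mulmxA.
  have e : (C *m A) *m (B *m A) = C *m A by rewrite -mulmxA [A *m _]mulmxA ABA.
  by rewrite -BAs -CAs -trmx_mul e.
by rewrite -BAB BA_CA -mulmxA AB_AC mulmxA CAC.
Qed.

Variable k : nat.
Implicit Types (A B : 'M[R]_k) (d : 'rV[R]_k).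

Lemma mpinv_diag d : mpinv (diag_mx d) = diag_mx (\row_i (d 0 i)^-1).
Proof.
have H : is_mpinv (diag_mx d) (diag_mx (\row_i (d 0 i)^-1)).
  have c (a : R) : a * a^-1 * a = a.
    by have [->|a0] := eqVneq a 0; [rewrite mulr0|rewrite mulfV// mul1r].
  have c' (a : R) : a^-1 * a * a^-1 = a^-1.
    by have [->|a0] := eqVneq a 0; [rewrite invr0 mulr0|rewrite mulVf// mul1r].
  split; rewrite !mulmx_diag ?tr_diag_mx//; congr diag_mx; apply/rowP => i; rewrite !mxE;
    [exact: c|exact: c'].
rewrite /mpinv; case: xgetP => [B _ /= HB|/(_ _ H)//].
exact: mpinv_unique H.
Qed.

(** [sqrtmx] is defined by choice, so uniqueness of the root matters. A root [B] commutes with the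
    diagonal matrix, hence [B i j = 0] unless the diagonal entries [i] and [j] agree, hence [B]
    commutes with [C]. Then [(B + C) (B - C) = 0], and nonnegativity of both forms on the range of
    [B - C] forces [B = C]. *)
Lemma sqrtmx_diag d : (forall i, 0 <= d 0 i) ->
  sqrtmx (diag_mx d) = diag_mx (\row_i Num.sqrt (d 0 i)).
Proof.
move=> d0; set C := diag_mx (\row_i _).
have CC : C *m C = diag_mx d.
  rewrite /C mulmx_diag; congr diag_mx; apply/rowP => i.
  by rewrite !mxE -expr2 sqr_sqrtr.
have Cp : psdmx C.
  split; first by rewrite tr_diag_mx.
  move=> x; rewrite mul_mx_diag mxE; apply: sumr_ge0 => i _.
  by rewrite !mxE mulrAC -expr2 mulr_ge0 ?sqr_ge0 ?sqrtr_ge0.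
have uniq_sqrt B : psdmx B -> B *m B = diag_mx d -> B = C.
  move=> Bp BB.
  have BC : B *m C = C *m B.
    apply/matrixP => i j; rewrite /C mul_mx_diag mul_diag_mx !mxE mulrC.
    have : (B *m diag_mx d) i j = (diag_mx d *m B) i j by rewrite -BB mulmxA.
    rewrite mul_mx_diag mul_diag_mx !mxE => e.
    have [->|Bij] := eqVneq (B i j) 0; first by rewrite !mulr0.
    by rewrite [LHS]mulrC in e; rewrite (mulIf Bij e).
  apply/eqP; rewrite -subr_eq0; apply/eqP; set D := B - C.
  have Ds : D^T = D by rewrite linearB/= Bp.1 Cp.1.
  have D0 : (B + C) *m D = 0.
    by rewrite /D mulmxBr !mulmxDl BB CC BC [X in _ - X]addrC subrr.
  apply/matrixP => i j; rewrite [RHS]mxE.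
  pose x : 'cV[R]_k := delta_mx j 0; pose y := D *m x.
  have y0 : bform (B + C) y y = 0.
    by rewrite /bform -[_ *m y]mulmxA /y [(B + C) *m (_ *m _)]mulmxA D0 mul0mx mulmx0 mxE.
  move: y0; rewrite bform_addmx => /eqP.
  rewrite paddr_eq0; [|exact: psdmxP|exact: psdmxP] => /andP[/eqP By /eqP Cy].
  have {}By := psdmx_ker Bp By; have {}Cy := psdmx_ker Cp Cy.
  have Dy : D *m y = 0 by rewrite /D mulmxBl By Cy subrr.
  have yy : dotv y y = 0.
    by rewrite /dotv {1}/y trmx_mul Ds -mulmxA Dy mulmx0 mxE.
  have : y i 0 = 0.
    apply/eqP; rewrite -sqrf_eq0; move/eqP: yy; rewrite /dotv mxE psumr_eq0.
      by move=> /allP/(_ i (mem_index_enum _)); rewrite mxE -expr2.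
    by move=> l _; rewrite mxE -expr2 sqr_ge0.
  by rewrite /y /x -colE mxE.
rewrite /sqrtmx; case: xgetP => [B _ /= [Bp BB]|/(_ C)]; first exact: uniq_sqrt.
by move=> h; exfalso; apply: h.
Qed.

Lemma mpinv_diagpart A : mpinv (diagpart A) = diag_mx (\row_i (A i i)^-1).
Proof. by rewrite /diagpart mpinv_diag; congr diag_mx; apply/rowP => i; rewrite !mxE. Qed.

Lemma invmx_diagpart A : (forall i, A i i != 0) ->
  invmx (diagpart A) = diag_mx (\row_i (A i i)^-1).
Proof.
move=> A0.
have h : diagpart A *m diag_mx (\row_i (A i i)^-1) = 1%:M.
  rewrite /diagpart mulmx_diag -diag_const_mx; congr diag_mx; apply/rowP => i.
  by rewrite !mxE mulfV.
have [Au _] := mulmx1_unit h.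
by rewrite -[LHS]mulmx1 -h mulmxA mulVmx// mul1mx.
Qed.

(** The convention [0^-1 = 0] reproduces the Moore-Penrose inverse of a diagonal matrix, so the
    formula also covers vanishing variances. *)
Lemma corrmxE A i j : (forall l, 0 <= A l l) ->
  corrmx A i j = (Num.sqrt (A i i))^-1 * A i j * (Num.sqrt (A j j))^-1.
Proof.
move=> A0; rewrite /corrmx mpinv_diagpart sqrtmx_diag; last first.
  by move=> l; rewrite mxE invr_ge0.
by rewrite mul_mx_diag mul_diag_mx !mxE !sqrtrV// -sqrtrV.
Qed.

Lemma psdmx_corrmx A : psdmx A -> psdmx (corrmx A).
Proof.
move=> Ap; have A0 l := psdmx_diag_ge0 l Ap.
rewrite /corrmx mpinv_diagpart sqrtmx_diag; last by move=> l; rewrite mxE invr_ge0.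
set D := diag_mx _; have Ds : D^T = D by rewrite tr_diag_mx.
split; first by rewrite !trmx_mul Ds Ap.1 mulmxA.
move=> x; have := psdmxP (D *m x) Ap.
by rewrite /bform trmx_mul Ds !mulmxA.
Qed.

Lemma corrmx_diag_eq1 A i : (forall l, 0 <= A l l) -> 0 < A i i -> corrmx A i i = 1.
Proof.
move=> A0 Ai; rewrite corrmxE// -[X in _ * X * _](sqr_sqrtr (A0 i)).
have s0 : 0 < Num.sqrt (A i i) by rewrite sqrtr_gt0.
by field; rewrite gt_eqF.
Qed.

Lemma corrmx_diag_le1 A i : (forall l, 0 <= A l l) -> corrmx A i i <= 1.
Proof.
move=> A0; have := A0 i; rewrite le_eqVlt => /predU1P[Ai|Ai]; last by rewrite corrmx_diag_eq1.
by rewrite corrmxE// -Ai mulr0 mul0r.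
Qed.

Lemma psdmx_entry_le A i j : psdmx A -> `|A i j| <= (A i i + A j j) / 2.
Proof.
move=> Ap; have [As _] := Ap.
have := psdmxP (delta_mx i 0 + delta_mx j 0) Ap.
have := psdmxP (delta_mx i 0 + (-1) *: delta_mx j 0) Ap.
rewrite !(bformDl, bformDr, bformZl, bformZr) !bform_delta.
have -> : A j i = A i j by rewrite -[in LHS]As mxE.
by rewrite ler_norml => ? ?; apply/andP; split; lra.
Qed.

End pseudo_inverse.

(** * The operator norm *)

Section operator_norm.
Variables (R : realType) (m n : nat).
Implicit Types (A : 'M[R]_(m, n)) (x : 'cV[R]_n).

Lemma euclid_norm_coord k (x : 'cV[R]_k) i : `|x i 0| <= euclid_norm x.
Proof.
rewrite -sqrtr_sqr ler_wsqrtr// (bigD1 i)//= lerDl.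
by apply: sumr_ge0 => j _; exact: sqr_ge0.
Qed.

Lemma euclid_norm_le_sum k (x : 'cV[R]_k) : euclid_norm x <= \sum_i `|x i 0|.
Proof.
rewrite -[leRHS]ger0_norm ?sumr_ge0// -sqrtr_sqr ler_wsqrtr//.
rewrite expr2 mulr_suml; apply: ler_sum => i _.
rewrite -(real_normK (num_real (x i 0))) expr2 ler_wpM2l//.
by rewrite (bigD1 i)//= lerDl sumr_ge0.
Qed.

Let opset A := [set euclid_norm (A *m x) | x in [set x : 'cV[R]_n | euclid_norm x <= 1]].

Let opset_ub A x : euclid_norm x <= 1 -> euclid_norm (A *m x) <= \sum_i \sum_j `|A i j|.
Proof.
move=> x1; apply: le_trans (euclid_norm_le_sum _) _; apply: ler_sum => i _.
rewrite mxE; apply: le_trans (ler_norm_sum _ _ _) _; apply: ler_sum => j _.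
by rewrite normrM ler_piMr// (le_trans (euclid_norm_coord _ _)).
Qed.

Let opset_has_sup A : has_sup (opset A).
Proof.
split.
  exists (euclid_norm (A *m 0)), 0 => //=.
  apply: le_trans (euclid_norm_le_sum _) _.
  by rewrite big1// => i _; rewrite mxE normr0.
by exists (\sum_i \sum_j `|A i j|) => _ [x x1 <-]; exact: opset_ub.
Qed.

Lemma opnorm_ub A x : euclid_norm x <= 1 -> euclid_norm (A *m x) <= opnorm A.
Proof. by move=> x1; apply: ub_le_sup; [case: (opset_has_sup A)|exists x]. Qed.

Lemma opnorm_le_sum A : opnorm A <= \sum_i \sum_j `|A i j|.
Proof.
apply: ge_sup; first by case: (opset_has_sup A).
by move=> _ [x x1 <-]; exact: opset_ub.
Qed.

(** Together with [opnorm_le_sum] it makes convergence in operator norm equivalent to convergence of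
    all entries. *)
Lemma opnorm_ge_entry A i j : `|A i j| <= opnorm A.
Proof.
have -> : A i j = (A *m delta_mx j 0 : 'cV[R]_m) i 0 by rewrite -colE mxE.
apply: le_trans (euclid_norm_coord _ _) _; apply: opnorm_ub.
rewrite /euclid_norm (bigD1 j)//= big1 ?addr0; first by rewrite mxE !eqxx expr1n sqrtr1.
by move=> l /negPf lj; rewrite mxE lj expr0n.
Qed.

Lemma continuous_sumR (T : topologicalType) (I : Type) (s : seq I) (f : I -> T -> R) :
  (forall i, continuous (f i)) -> continuous (fun z => \sum_(i <- s) f i z).
Proof.
move=> cf z; elim: s => [|i s ih].
  by under eq_fun do rewrite big_nil; exact: cvg_cst.
under eq_fun do rewrite big_cons; rewrite ?big_cons.
by apply: cvgD; [exact: cf|exact: ih].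
Qed.

(** A supremum of continuous functions is lower semicontinuous: its superlevel sets are open. *)
Lemma measurable_opnorm : measurable_fun setT (@opnorm R m n).
Proof.
have cE x : continuous (fun A : 'M[R]_(m, n) => euclid_norm (A *m x)).
  have c1 i : continuous (fun A : 'M[R]_(m, n) => (A *m x) i 0).
    rewrite (_ : (fun A => _) = fun A : 'M[R]_(m, n) => \sum_j A i j * x j 0); last first.
      by apply/funext => A; rewrite mxE.
    apply: continuous_sumR => j A.
    have h : {for A, continuous (fun B : 'M[R]_(m, n) => B i j)} by exact: coord_continuous.
    exact: (cvgM h (cvg_cst (x j 0))).
  have c2 : continuous (fun A : 'M[R]_(m, n) => \sum_i (A *m x) i 0 ^+ 2).
    apply: continuous_sumR => i A.
    apply: (@continuous_comp _ _ _ (fun A : 'M[R]_(m, n) => (A *m x) i 0) (fun z => z ^+ 2)).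
      exact: c1.
    exact: exprn_continuous.
  move=> A; apply: (@continuous_comp _ _ _ (fun A : 'M[R]_(m, n) => \sum_i (A *m x) i 0 ^+ 2) Num.sqrt).
    exact: c2.
  exact: sqrt_continuous.
apply: (measurability _ (RGenOInfty.measurableE R)).
move=> _ [_ [r ->] <-]; rewrite setTI; apply: open_measurable_mx.
have -> : @opnorm R m n @^-1` `]r, +oo[ =
    \bigcup_(x in [set x : 'cV[R]_n | euclid_norm x <= 1])
      ((fun A : 'M[R]_(m, n) => euclid_norm (A *m x)) @^-1` `]r, +oo[).
  apply/seteqP; split => A /=.
    rewrite in_itv/= andbT => rA.
    have [_ [x x1 <-] h] := sup_gt (opset_has_sup A).1 rA.
    by exists x => //=; rewrite in_itv/= h.
  move=> [x x1 /=]; rewrite !in_itv/= !andbT => /lt_le_trans; apply.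
  exact: opnorm_ub.
apply: bigcup_open => x _; apply: open_comp => [A _|]; [exact: cE|exact: interval_open].
Qed.

End operator_norm.

(** * The distribution of the maximum norm *)

Section real_probability.
Context d (T : measurableType d) (R : realType) (P : probability T R).
Implicit Types A B : set T.

Lemma probability_fineK A : measurable A -> (fine (P A))%:E = P A.
Proof. by move=> mA; rewrite fineK// fin_num_measure. Qed.

Lemma le_fine_probability A B : measurable A -> measurable B -> A `<=` B ->
  fine (P A) <= fine (P B).
Proof.
by move=> mA mB AB; rewrite -lee_fin !probability_fineK// le_measure ?inE.
Qed.

Lemma fine_probabilityU A B : measurable A -> measurable B ->
  fine (P (A `|` B)) <= fine (P A) + fine (P B).
Proof.
move=> mA mB; rewrite -lee_fin EFinD !probability_fineK//; last exact: measurableU.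
exact: measureU2.
Qed.

Lemma fine_probability_bigU (I : Type) (s : seq I) (A : I -> set T) :
  (forall i, measurable (A i)) ->
  fine (P (\big[setU/set0]_(i <- s) A i)) <= \sum_(i <- s) fine (P (A i)).
Proof.
move=> mA; elim: s => [|i s ih]; first by rewrite !big_nil measure0.
rewrite !big_cons; apply: le_trans (fine_probabilityU _ _) _ => //.
  exact: bigsetU_measurable.
by rewrite lerD2l.
Qed.
End real_probability.

Section sandwich.
Variables (R : realType) (k : nat).

Lemma measurable_mx_norm m n : measurable_fun setT (fun z : 'M[R]_(m, n) => `|z|).
Proof. by apply: continuous_measurable_mxR => z; exact: norm_continuous. Qed.

(** Chebyshev's bound for coordinates of variance at most 1, the property common to the standardized
    sums and the Gaussian vectors on which the sandwich rests. *)
Definition unit_tails d (T : measurableType d) (P : probability T R) (W : T -> 'cV[R]_k) :=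
  forall j (M : R), 0 < M -> (P [set x | (M <= `|W x j 0|)%R] <= (M ^- 2)%:E)%E.

Lemma measurable_norm_le d (T : measurableType d) (W : T -> 'cV[R]_k) (t : R) :
  measurable_fun setT W -> measurable [set x | `|W x| <= t].
Proof.
move=> mW; rewrite -[X in measurable X]setTI; apply: measurable_fun_le => //.
exact: measurableT_comp (@measurable_mx_norm k 1) mW.
Qed.

Lemma measurable_norm_gt d (T : measurableType d) (W : T -> 'cV[R]_k) (t : R) :
  measurable_fun setT W -> measurable [set x | t < `|W x|].
Proof.
move=> mW; rewrite (_ : [set x | _] = ~` [set x | `|W x| <= t]).
  by apply: measurableC; exact: measurable_norm_le.
by apply/seteqP; split => x /=; rewrite ltNge => /negP.
Qed.

Lemma measurable_trig (s : seq (R * 'cV[R]_k)) : measurable_fun setT (trig s).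
Proof.
rewrite /trig; apply: measurable_sum => p; apply: measurable_funM => //.
exact: measurableT_comp (continuous_measurable_fun (@continuous_cos R)) (measurable_dotv p.2).
Qed.

Lemma unit_tails_norm d (T : measurableType d) (P : probability T R) (W : T -> 'cV[R]_k) (B : R) :
  measurable_fun setT W -> unit_tails P W -> 0 < B ->
  fine (P [set x | B < `|W x|]) <= k%:R / B ^+ 2.
Proof.
move=> mW tW B0.
have mA := measurable_norm_gt B mW.
have mB j : measurable [set x | B <= `|W x j 0|].
  rewrite -[X in measurable X]setTI; apply: measurable_fun_le => //.
  apply: measurableT_comp => //; exact: measurableT_comp (measurable_coord j 0) mW.
have sub : [set x | B < `|W x|] `<=` \big[setU/set0]_(j < k) [set x | B <= `|W x j 0|].
  move=> x /= Bx.
  have [j Bj] : exists j, B <= `|W x j 0|.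
    apply: contrapT => /forallNP h; move: Bx; rewrite ltNge => /negP; apply.
    apply/mx_norm_leP; first exact: ltW.
    by move=> i j; rewrite (ord1 j) leNgt; apply/negP => /ltW; exact: h.
  by rewrite -bigcup_seq; exists j => //=; rewrite mem_index_enum.
apply: le_trans (le_fine_probability P mA _ sub) _; first exact: bigsetU_measurable.
apply: le_trans (fine_probability_bigU P _ mB) _.
rewrite mulr_natl -[in leRHS](card_ord k) -sumr_const; apply: ler_sum => j _.
by rewrite -lee_fin probability_fineK//; exact: tW.
Qed.

(** The order of the quantifiers is the point: one trigonometric sum [s] serves all laws with unit
    tails. It can thus be compared between a standardized sum and a Gaussian vector, and between
    Gaussian vectors with different covariances. *)
Lemma sandwich_law (t h e : R) : 0 <= t -> 0 < h -> 0 < e ->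
  exists s, forall d (T : measurableType d) (P : probability T R) (W : T -> 'cV[R]_k),
    measurable_fun setT W -> unit_tails P W ->
    fine (P [set x | `|W x| <= t]) - e <= \int[P]_x trig s (W x) <=
    fine (P [set x | `|W x| <= t + h]) + e.
Proof.
(* [B] is so large that [k / B ^+ 2 <= e / 2], which by [unit_tails_norm] bounds the mass outside
   the ball where [trig s] is controlled. *)
move=> t0 h0 e0; pose B := t + h + 1 + 2 * k%:R / e.
have ke0 : 0 <= 2 * k%:R / e by rewrite divr_ge0 ?mulr_ge0// ltW.
have th0 : 0 < t + h by rewrite ltr_wpDl.
have B1 : 1 <= B by rewrite /B; lra.
have B0 : 0 < B by exact: lt_le_trans B1.
have kB : k%:R / B ^+ 2 <= e / 2.
  rewrite ler_pdivrMr ?exprn_gt0//.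
  apply: (@le_trans _ _ (e / 2 * B)); last by rewrite ler_wpM2l ?divr_ge0 ?(ltW e0)// expr2 ler_peMl// ltW.
  rewrite /B [X in _ <= X](_ : _ = k%:R + e / 2 * (t + h + 1)); last first.
    by field; rewrite gt_eqF.
  by rewrite lerDl mulr_ge0 ?divr_ge0 ?(ltW e0)//; lra.
have [|s hs] := trig_sandwich k t0 h0 (divr_gt0 e0 (ltr0n R 2)) (_ : t + h <= B).
  by rewrite /B; lra.
exists s => d T P W mW tW.
have mI (u : R) := measurable_norm_le u mW.
have mT : measurable_fun setT (fun x => trig s (W x)) := measurableT_comp (measurable_trig s) mW.
have iT : P.-integrable setT (EFin \o (fun x => trig s (W x))).
  apply: (@bounded_integrable _ _ _ P _ 1) => // x.
  by have [/andP[a b] _ _] := hs (W x); rewrite ger0_norm.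
have iI (A : set T) : measurable A -> P.-integrable setT (EFin \o (\1_A : T -> R)).
  move=> mA; apply: (@bounded_integrable _ _ _ P _ 1) => // x.
  by rewrite indicE; case: (_ \in _); rewrite ?normr1 ?normr0.
have mA := measurable_norm_gt B mW.
have ic := integrable_cstR P (e / 2).
apply/andP; split.
  apply: (@le_trans _ _ (\int[P]_x (\1_[set x | `|W x| <= t] x - e / 2))).
    rewrite (RintegralB measurableT (iI _ (mI t)) ic) Rintegral_cstT Rintegral_indic//; lra.
  apply: (le_Rintegral measurableT (integrableBR (iI _ (mI t)) ic) iT) => x _.
  have [/andP[a b] c _] := hs (W x); rewrite indicE.
  have [q|q] := boolP (`|W x| <= t); first by rewrite mem_set//; exact: c.
  by rewrite memNset; [rewrite sub0r (le_trans _ a)// oppr_le0 divr_ge0// ltW|exact/negP].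
apply: (@le_trans _ _ (\int[P]_x (\1_[set x | `|W x| <= t + h] x + \1_[set x | B < `|W x|] x + e / 2))).
  have i2 := integrableDR (iI _ (mI (t + h))) (iI _ mA).
  apply: (le_Rintegral measurableT iT (integrableDR i2 ic)) => x _.
  have [/andP[a b] _ c] := hs (W x); rewrite !indicE.
  have e2 : 0 <= e / 2 by rewrite divr_ge0// ltW.
  have [q|q] := boolP (`|W x| <= t + h).
    by rewrite mem_set//; apply: (le_trans b); rewrite -addrA lerDl addr_ge0.
  rewrite memNset; last exact/negP.
  rewrite -ltNge in q; rewrite add0r; have [q'|q'] := boolP (B < `|W x|).
    by rewrite mem_set//; apply: (le_trans b); rewrite lerDl.
  rewrite memNset; last exact/negP.
  by rewrite add0r; apply: c; rewrite q leNgt.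
have i2 := integrableDR (iI _ (mI (t + h))) (iI _ mA).
rewrite (RintegralD measurableT i2 ic) (RintegralD measurableT (iI _ (mI (t + h))) (iI _ mA)).
rewrite Rintegral_cstT !Rintegral_indic//.
have := unit_tails_norm mW tW B0; lra.
Qed.
End sandwich.

Section gaussian_maxnorm.
Variables (R : realType) (k : nat).
Implicit Types (G : 'M[R]_k) (s : seq (R * 'cV[R]_k)).

Definition maxcdf G (t : R) : R := fine (gaussian G [set z | `|z| <= t]).

(** An inequality on the diagonal, because the correlation matrix of an estimate with a vanishing
    variance has a zero there. *)
Definition corrlike G := psdmx G /\ forall i, G i i <= 1.

(** The integral of [trig s] under N(0, G), as an explicit continuous function of the entries of
    [G]. *)
Definition gtrig s G : R := \sum_(p <- s) p.1 * expR (- (bform G p.2 p.2 / 2)).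

Lemma measurable_maxnorm_le (t : R) : measurable [set z : 'cV[R]_k | `|z| <= t].
Proof. exact: (@measurable_norm_le R k _ _ id). Qed.

Lemma gaussian_dotv_law G (t : 'cV[R]_k) B : psdmx G -> measurable B ->
  gaussian G (dotv t @^-1` B) = normal0 (bform G t t) B.
Proof. by move=> Gp mB; have [_] := gaussianP Gp; exact. Qed.

Lemma gaussian_trig s G : psdmx G -> \int[gaussian G]_z trig s z = gtrig s G.
Proof.
move=> Gp; have ic (t : 'cV[R]_k) : (gaussian G).-integrable setT (EFin \o (fun z => cos (dotv t z))).
  apply: (@bounded_integrable _ _ _ _ _ 1) => [|x]; last exact: cos_max.
  exact: measurableT_comp (continuous_measurable_fun (@continuous_cos R)) (measurable_dotv t).
rewrite /trig Rintegral_sum; last by move=> p; exact: integrableZR.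
apply: eq_bigr => p _; rewrite (RintegralZl _ measurableT (ic p.2)); congr (_ * _).
apply: (normal0_law_cos (measurable_dotv p.2) (psdmxP p.2 Gp)) => B mB.
exact: gaussian_dotv_law.
Qed.

Lemma dotv_delta (j : 'I_k) (z : 'cV[R]_k) : dotv (delta_mx j 0) z = z j 0.
Proof. by rewrite /dotv trmx_delta -rowE mxE. Qed.

Lemma gaussian_unit_tails G : corrlike G -> unit_tails (gaussian G) id.
Proof.
move=> [Gp G1] j M M0.
have := normal0_law_tail (measurable_dotv (delta_mx j 0)) (psdmxP (delta_mx j 0) Gp)
  (fun B mB => gaussian_dotv_law (delta_mx j 0) Gp mB) M0.
rewrite bform_delta (_ : [set x | _] = [set x : 'cV[R]_k | M <= `|x j 0|]); last first.
  by apply/seteqP; split => x /=; rewrite dotv_delta.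
move=> /le_trans; apply; rewrite lee_fin ler_piMl//.
by rewrite invr_ge0 exprn_ge0// ltW.
Qed.

Lemma maxcdf_le G t u : t <= u -> maxcdf G t <= maxcdf G u.
Proof.
move=> tu; apply: le_fine_probability; try exact: measurable_maxnorm_le.
by move=> z /= zt; exact: le_trans tu.
Qed.

Lemma maxcdf_lt0 G t : t < 0 -> maxcdf G t = 0.
Proof.
move=> t0; rewrite /maxcdf (_ : [set z | _] = set0) ?measure0//.
by apply/seteqP; split => z //=; rewrite leNgt (lt_le_trans t0).
Qed.

Lemma maxcdf_ge G B : corrlike G -> 0 < B -> 1 - k%:R / B ^+ 2 <= maxcdf G B.
Proof.
move=> Gc B0; have := unit_tails_norm (@measurable_id _ _ setT) (gaussian_unit_tails Gc) B0.
have -> : [set x : 'cV[R]_k | B < `|x|] = ~` [set z | `|z| <= B].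
  by apply/seteqP; split => x /=; rewrite ltNge => /negP.
rewrite probability_setC; last exact: measurable_maxnorm_le.
rewrite -(probability_fineK _ (measurable_maxnorm_le B)) -EFinB /= -/(maxcdf G B); lra.
Qed.

Lemma maxcdf_sandwich (t h e : R) : 0 <= t -> 0 < h -> 0 < e ->
  exists s, (forall G, corrlike G -> maxcdf G t - e <= gtrig s G <= maxcdf G (t + h) + e) /\
   (forall d (T : measurableType d) (P : probability T R) (W : T -> 'cV[R]_k),
    measurable_fun setT W -> unit_tails P W ->
    fine (P [set x | `|W x| <= t]) - e <= \int[P]_x trig s (W x) <=
    fine (P [set x | `|W x| <= t + h]) + e).
Proof.
move=> t0 h0 e0; have [s hs] := sandwich_law k t0 h0 e0; exists s; split => // G Gc.
rewrite -gaussian_trig; last exact: Gc.1.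
exact: hs (@measurable_id _ _ setT) (gaussian_unit_tails Gc).
Qed.

(** If [t < |z| <= u], some coordinate lies in [[t, u]] or in [[-u, -t]]: these are [2 * k] events,
    each of probability at most [u - t] because a coordinate of unit variance has density at most
    1. *)
Lemma maxcdf_lip G t u : psdmx G -> (forall i, G i i = 1) -> 0 <= t -> t <= u ->
  maxcdf G u <= maxcdf G t + 2 * k%:R * (u - t).
Proof.
move=> Gp G1 t0 tu; have u0 := le_trans t0 tu.
pose A (j : 'I_k) : set 'cV[R]_k := [set z | t <= z j 0 <= u].
pose B (j : 'I_k) : set 'cV[R]_k := [set z | - u <= z j 0 <= - t].
have mI a b (j : 'I_k) : measurable [set z : 'cV[R]_k | a <= z j 0 <= b].
  rewrite (_ : [set z | _] = (fun z : 'cV[R]_k => z j 0) @^-1` `[a, b]); last first.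
    by apply/seteqP; split => z /=; rewrite in_itv.
  by rewrite -[X in measurable X]setTI; apply: measurable_coord => //; exact: measurable_itv.
have law j C : measurable C -> gaussian G ((fun z : 'cV[R]_k => z j 0) @^-1` C) = normal0 1 C.
  move=> mC; rewrite -(G1 j) -(bform_delta G j j) -gaussian_dotv_law//.
  by congr (gaussian G _); apply/seteqP; split => z /=; rewrite dotv_delta.
have PA j : fine (gaussian G (A j)) <= u - t.
  by rewrite -lee_fin probability_fineK; [exact: (normal0_law_itv (law j) tu)|exact: mI].
have PB j : fine (gaussian G (B j)) <= u - t.
  have tu' : - u <= - t by rewrite lerN2.
  rewrite -lee_fin probability_fineK; last exact: mI.
  by apply: le_trans (normal0_law_itv (law j) tu') _; rewrite opprK addrC.
have mAU : measurable (\big[setU/set0]_(j < k) A j) by apply: bigsetU_measurable => j _; exact: mI.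
have mBU : measurable (\big[setU/set0]_(j < k) B j) by apply: bigsetU_measurable => j _; exact: mI.
have mt := measurable_maxnorm_le t; have mu := measurable_maxnorm_le u.
apply: (@le_trans _ _ (fine (gaussian G ([set z | `|z| <= t] `|`
    ((\big[setU/set0]_(j < k) A j) `|` (\big[setU/set0]_(j < k) B j)))))).
  apply: le_fine_probability => //; first by do 2 apply: measurableU => //.
  move=> z /= zu; have [zt|zt] := leP `|z| t; [by left|right].
  have [j zj] : exists j, t < `|z j 0|.
    apply: contrapT => /forallNP h; move: zt; rewrite ltNge => /negP; apply.
    by apply/mx_norm_leP => // i j; rewrite (ord1 j) leNgt; apply/negP; exact: h.
  have /(_ j 0) zju := (mx_norm_leP z u0).1 zu.
  have [zj0|zj0] := leP 0 (z j 0).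
    left; rewrite -bigcup_seq; exists j => //=; first by rewrite mem_index_enum.
    by move: zj zju; rewrite ger0_norm// /A/= => /ltW -> ->.
  right; rewrite -bigcup_seq; exists j => //=; first by rewrite mem_index_enum.
  by move: zj zju; rewrite ltr0_norm// /B/= => /ltW h1 h2; rewrite lerNl h2 lerNr h1.
apply: le_trans (fine_probabilityU _ _ _) _ => //; first exact: measurableU.
rewrite lerD2l; apply: le_trans (fine_probabilityU _ _ _) _ => //.
rewrite (_ : 2 * _ * _ = \sum_(j < k) (u - t) + \sum_(j < k) (u - t)); last first.
  by rewrite !sumr_const card_ord -mulr_natl; ring.
apply: lerD.
  by apply: le_trans (fine_probability_bigU _ _ (mI t u)) _; apply: ler_sum => j _; exact: PA.
by apply: le_trans (fine_probability_bigU _ _ (mI (- u) (- t))) _; apply: ler_sum => j _; exact: PB.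
Qed.

(** [expR (- x)] is 1-Lipschitz for [x >= 0], and a quadratic form is linear in its matrix. The
    radius [r] depends on [s] and [e] only, hence is uniform over the matrices. *)
Lemma gtrig_close s (e : R) : 0 < e -> exists2 r : R, 0 < r &
  forall G G' : 'M[R]_k, psdmx G -> psdmx G' -> (forall i j, `|G i j - G' i j| <= r) ->
    `|gtrig s G - gtrig s G'| <= e.
Proof.
move=> e0; pose K (t : 'cV[R]_k) := \sum_i \sum_j `|t i 0| * `|t j 0|.
have K0 t : 0 <= K t by do 2 apply: sumr_ge0 => ? _; rewrite mulr_ge0.
pose L := \sum_(p <- s) `|p.1| * K p.2.
have L0 : 0 <= L by apply: sumr_ge0 => p _; rewrite mulr_ge0.
have L1 : 0 < L + 1 by rewrite ltr_wpDl.
exists (e / (L + 1)); first by rewrite divr_gt0.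
move=> G G' Gp G'p close; rewrite /gtrig -sumrB.
apply: le_trans (ler_norm_sum _ _ _) _.
apply: (@le_trans _ _ (\sum_(p <- s) `|p.1| * K p.2 * (e / (L + 1)))).
  apply: ler_sum => p _; rewrite -mulrBr normrM -mulrA ler_wpM2l//.
  apply: le_trans (expRN_lip _ _) _; rewrite ?divr_ge0 ?psdmxP//.
  rewrite -mulrBl normrM [X in _ * X]ger0_norm ?invr_ge0//.
  have bd : `|bform G p.2 p.2 - bform G' p.2 p.2| <= K p.2 * (e / (L + 1)).
    rewrite -[bform G' _ _]mul1r -mulNr -bform_scalemx -bform_addmx.
    rewrite /bform mxE /K mulr_suml; apply: le_trans (ler_norm_sum _ _ _) _.
    rewrite [leRHS](_ : _ = \sum_j (\sum_i `|p.2 i 0| * `|p.2 j 0|) * (e / (L + 1))); last first.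
      by rewrite -!mulr_suml exchange_big.
    apply: ler_sum => j _; rewrite normrM mxE.
    rewrite (_ : (\sum_i _) * _ = (\sum_i `|p.2 i 0| * (e / (L + 1))) * `|p.2 j 0|); last first.
      by rewrite -!mulr_suml mulrAC.
    rewrite ler_wpM2r//; apply: le_trans (ler_norm_sum _ _ _) _; apply: ler_sum => i _.
    rewrite normrM !mxE mulN1r ler_wpM2l//; exact: close.
  apply: le_trans bd; rewrite ler_piMr//.
  by rewrite invf_le1// ler1n.
rewrite -mulr_suml -/L mulrCA ler_piMr ?(ltW e0)//.
by rewrite ler_pdivrMr// mul1r lerDl.
Qed.

(** Lower half of the sandwich at [G], [gtrig_close], upper half at [G']: three errors of
    [e / 3]. *)
Lemma maxcdf_close (t h e : R) : 0 <= t -> 0 < h -> 0 < e -> exists2 r : R, 0 < r &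
  forall G G' : 'M[R]_k, corrlike G -> corrlike G' -> (forall i j, `|G i j - G' i j| <= r) ->
    maxcdf G t <= maxcdf G' (t + h) + e.
Proof.
move=> t0 h0 e0; have e3 : 0 < e / 3 by rewrite divr_gt0.
have [s [hs _]] := maxcdf_sandwich t0 h0 e3.
have [r r0 hr] := gtrig_close s e3; exists r => // G G' Gc G'c close.
have /andP[h1 _] := hs _ Gc; have /andP[_ h2] := hs _ G'c.
have := hr _ _ Gc.1 G'c.1 close; rewrite ler_norml => /andP[_ h3]; lra.
Qed.

Lemma maxcdf_right_cont G (t p : R) : (forall n, p <= maxcdf G (t + n.+1%:R^-1)) -> p <= maxcdf G t.
Proof.
move=> hp; pose A n : set 'cV[R]_k := [set z | `|z| <= t + n.+1%:R^-1].
have AE : \bigcap_n A n = [set z | `|z| <= t].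
  apply/seteqP; split => z /=; last first.
    by move=> zt n _; rewrite /A /= (le_trans zt)// lerDl invr_ge0.
  move=> Az; apply/ler_addgt0Pr => e /exists_natSinv_lt[n ne].
  by apply: le_trans (Az n Logic.I) _; rewrite lerD2l ltW.
have mA n : measurable (A n) by exact: measurable_maxnorm_le.
have mI : measurable (\bigcap_n A n) by rewrite AE; exact: measurable_maxnorm_le.
have A0 : (gaussian G (A 0%N) < +oo)%E.
  by rewrite (le_lt_trans (probability_le1 _ (mA 0%N)))// ltry.
have nA : nonincreasing_seq A.
  apply/nonincreasing_seqP => n; apply/subsetPset => z; rewrite /A /= => zn.
  by rewrite (le_trans zn)// lerD2l lef_pV2 ?posrE// ler_nat.
have cv := @nonincreasing_cvg_mu _ _ _ (gaussian G) A A0 mA mI nA.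
rewrite AE in cv.
rewrite -lee_fin /maxcdf probability_fineK; last exact: measurable_maxnorm_le.
rewrite -(cvg_lim _ cv)//.
apply: lime_ge; first by apply/cvg_ex; eexists; exact: cv.
apply: nearW => n; rewrite /= -(probability_fineK _ (mA n)) lee_fin; exact: hp.
Qed.

End gaussian_maxnorm.

(** * Quantiles of the maximum norm and their measurability *)

Section quantile.
Variables (R : realType) (k : nat).
Implicit Types (G : 'M[R]_k).

Lemma quantileE (p : R) G :
  gauss_maxnorm_quantile p G = inf [set t : R | p <= maxcdf G t].
Proof.
rewrite /gauss_maxnorm_quantile; congr inf; apply/seteqP; split => t /=;
  rewrite /maxcdf -lee_fin probability_fineK//; exact: measurable_maxnorm_le.
Qed.

Lemma quantile_has_inf (p : R) G : 0 < p < 1 -> corrlike G -> has_inf [set t : R | p <= maxcdf G t].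
Proof.
move=> /andP[p0 p1] Gc; split; last first.
  exists 0 => t /=; rewrite leNgt => pt; rewrite leNgt; apply: contra pt => t0.
  by rewrite maxcdf_lt0.
have q0 : 0 < 1 - p by rewrite subr_gt0.
pose B : R := k%:R / (1 - p) + 1.
have B1 : 1 <= B by rewrite lerDr divr_ge0// ltW.
have B0 : 0 < B by rewrite (lt_le_trans _ B1).
exists B; rewrite /=; apply: le_trans (maxcdf_ge Gc B0).
rewrite lerBrDr -lerBrDl; apply: (@le_trans _ _ (k%:R / B)).
  rewrite ler_wpM2l// lef_pV2 ?posrE ?exprn_gt0//.
  by rewrite expr2 ler_peMl// ltW.
rewrite ler_pdivrMr// /B mulrDr mulr1 mulrCA divff ?gt_eqF// mulr1 lerDl ltW//.
Qed.

Lemma quantile_ge0 (p : R) G : 0 < p < 1 -> corrlike G -> 0 <= gauss_maxnorm_quantile p G.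
Proof.
move=> p01 Gc; rewrite quantileE; apply: lb_le_inf; first by have [] := quantile_has_inf p01 Gc.
move=> t /=; rewrite leNgt => pt; rewrite leNgt; apply: contra pt => t0.
by rewrite maxcdf_lt0//; case/andP: p01.
Qed.

Lemma quantile_le (p t : R) G : 0 < p < 1 -> corrlike G -> p <= maxcdf G t ->
  gauss_maxnorm_quantile p G <= t.
Proof.
move=> p01 Gc pt; rewrite quantileE; apply: ge_inf => //.
by have [] := quantile_has_inf p01 Gc.
Qed.

Lemma quantile_ge (p t : R) G : 0 < p < 1 -> corrlike G -> maxcdf G t < p ->
  t <= gauss_maxnorm_quantile p G.
Proof.
move=> p01 Gc pt; rewrite quantileE; apply: lb_le_inf; first by have [] := quantile_has_inf p01 Gc.
move=> u /= pu; rewrite leNgt; apply/negP => ut.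
by have := lt_le_trans pt pu; rewrite ltNge (maxcdf_le _ (ltW ut)).
Qed.

Lemma measurable_bform d (T : measurableType d) (M : T -> 'M[R]_k) (x y : 'cV[R]_k) :
  (forall i j, measurable_fun setT (fun w => M w i j)) ->
  measurable_fun setT (fun w => bform (M w) x y).
Proof.
move=> mM; rewrite (_ : (fun w => _) = fun w => \sum_j (\sum_i x i 0 * M w i j) * y j 0).
  apply: measurable_sum => j; apply: measurable_funM => //.
  by apply: measurable_sum => i; exact: measurable_funM.
apply/funext => w; rewrite /bform mxE; apply: eq_bigr => j _; rewrite mxE; congr (_ * _).
by apply: eq_bigr => i _; rewrite mxE.
Qed.

Lemma measurable_gtrig d (T : measurableType d) (M : T -> 'M[R]_k) s :
  (forall i j, measurable_fun setT (fun w => M w i j)) ->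
  measurable_fun setT (fun w => gtrig s (M w)).
Proof.
move=> mM; apply: measurable_sum => p; apply: measurable_funM => //.
apply: measurableT_comp => //; apply: measurable_funN.
by apply: measurable_funM => //; exact: measurable_bform.
Qed.

(** [gaussian] is obtained by choice, so measurability in the covariance matrix cannot be read off
    its definition. The sandwich of width and error [n.+1^-1] replaces the distribution function by
    the measurable [gtrig], and right continuity recovers it in the limit. *)
Lemma measurable_maxcdf_ge d (T : measurableType d) (M : T -> 'M[R]_k) (p t : R) : 0 < p ->
  (forall i j, measurable_fun setT (fun w => M w i j)) -> (forall w, corrlike (M w)) ->
  measurable [set w | p <= maxcdf (M w) t].
Proof.
move=> p0 mM Mc; have [t0|t0] := ltP t 0.
  rewrite (_ : [set w | _] = set0) //; apply/seteqP; split => w //=.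
  by rewrite maxcdf_lt0// leNgt p0.
pose h n : R := n.+1%:R^-1; have h0 n : 0 < h n by rewrite invr_gt0.
pose s n := projT1 (cid (@maxcdf_sandwich R k _ _ _ t0 (h0 n) (h0 n))).
have hs n G : corrlike G -> maxcdf G t - h n <= gtrig (s n) G <= maxcdf G (t + h n) + h n.
  by move=> Gc; rewrite /s; case: cid => s' /= [H _]; exact: H.
rewrite (_ : [set w | _] = \bigcap_n [set w | p <= gtrig (s n) (M w) + h n]).
  apply: bigcapT_measurable => n; rewrite -[X in measurable X]setTI.
  apply: measurable_fun_le => //; apply: measurable_funD => //.
  exact: measurable_gtrig.
apply/seteqP; split => w /=.
  move=> pw n _ /=; have /andP[H _] := hs n _ (Mc w).
  by rewrite lerBlDr in H; apply: le_trans H.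
move=> H; apply: maxcdf_right_cont => m.
apply/ler_addgt0Pr => e e0.
have /exists_natSinv_lt[n ne] : 0 < e / 2 by rewrite divr_gt0.
pose N := maxn m n; have /= HN := H N Logic.I.
have /andP[_ H2] := hs N _ (Mc w).
have hm : h N <= h m by rewrite lef_pV2 ?posrE// ler_nat ltnS leq_maxl.
have hn : h N <= h n by rewrite lef_pV2 ?posrE// ler_nat ltnS leq_maxr.
have : maxcdf (M w) (t + h N) <= maxcdf (M w) (t + h m) by apply: maxcdf_le; rewrite lerD2l.
rewrite -/(h m); have : h n < e / 2 by [].
lra.
Qed.

Lemma measurable_quantile d (T : measurableType d) (M : T -> 'M[R]_k) (p : R) : 0 < p < 1 ->
  (forall i j, measurable_fun setT (fun w => M w i j)) -> (forall w, corrlike (M w)) ->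
  measurable_fun setT (fun w => gauss_maxnorm_quantile p (M w)).
Proof.
move=> p01 mM Mc; move=> mT; apply: (measurability _ (RGenInftyO.measurableE R)) => //.
move=> _ [_ [t ->] <-]; rewrite setTI (_ : _ @^-1` _ = \bigcup_(q in [set q : rat | ratr q < t])
   [set w | p <= maxcdf (M w) (ratr q)]).
  rewrite bigcup_mkcond; apply: bigcupT_measurable_rat => q; case: ifP => // _.
  by apply: measurable_maxcdf_ge => //; case/andP: p01.
apply/seteqP; split => w /=; rewrite in_itv/=.
  rewrite quantileE => /(inf_lt (quantile_has_inf p01 (Mc w)).1)[u /= pu ut].
  have [q] := rat_in_itvoo ut; rewrite in_itv/= => /andP[uq qt].
  by exists q => //=; apply: le_trans pu _; apply: maxcdf_le; exact: ltW.
by move=> [q /= qt pq]; apply: le_lt_trans qt; exact: quantile_le.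
Qed.

End quantile.

(** * Convergence in probability *)

Section asymptotically_sure.
Variables (R : realType) (l : nat) (P : forall n, probability 'M[R]_(n, l) R).
Implicit Types (F G : forall n, 'M[R]_(n, l) -> Prop) (X Y : forall n, 'M[R]_(n, l) -> R).

(* Outer probability is used, so that F need not be measurable. *)
Definition asure F := forall e : R, 0 < e -> \forall n \near \oo,
  exists B : set 'M[R]_(n, l), [/\ measurable B, forall y, ~ B y -> F n y & (P n B <= e%:E)%E].

Definition cvgp0 X := forall e : R, 0 < e -> asure (fun n y => `|X n y| < e).

Lemma asure_imp F G : asure F -> (\forall n \near \oo, forall y, F n y -> G n y) -> asure G.
Proof.
move=> hF FG e e0; near=> n.
have [B [mB BF Be]] : exists B : set 'M[R]_(n, l),
  [/\ measurable B, forall y, ~ B y -> F n y & (P n B <= e%:E)%E] by near: n; exact: hF.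
exists B; split => // y By; have : forall y, F n y -> G n y by near: n.
by apply; exact: BF.
Unshelve. all: by end_near. Qed.

Lemma asure_near F : (\forall n \near \oo, forall y, F n y) -> asure F.
Proof.
move=> hF e e0; near=> n; exists set0; split => //; last by rewrite measure0 lee_fin ltW.
by move=> y _; move: y; near: n.
Unshelve. all: by end_near. Qed.

Lemma asure_and F G : asure F -> asure G -> asure (fun n y => F n y /\ G n y).
Proof.
move=> hF hG e e0; have e2 : 0 < e / 2 by rewrite divr_gt0.
near=> n.
have [B [mB BF Be]] : exists B : set 'M[R]_(n, l),
  [/\ measurable B, forall y, ~ B y -> F n y & (P n B <= (e / 2)%:E)%E] by near: n; exact: hF.
have [C [mC CG Ce]] : exists B : set 'M[R]_(n, l),
  [/\ measurable B, forall y, ~ B y -> G n y & (P n B <= (e / 2)%:E)%E] by near: n; exact: hG.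
exists (B `|` C); split; first exact: measurableU.
- by move=> y /not_orP[yB yC]; split; [exact: BF|exact: CG].
- by apply: le_trans (measureU2 _ _ _) _ => //; rewrite [e]splitr EFinD leeD.
Unshelve. all: by end_near. Qed.

Lemma asure_forall (I : finType) (F : I -> forall n, 'M[R]_(n, l) -> Prop) :
  (forall i, asure (F i)) -> asure (fun n y => forall i, F i n y).
Proof.
move=> hF; have : asure (fun n y => forall i, i \in enum I -> F i n y).
  elim: (enum I) => [|i s ih]; first by apply: asure_near; apply: nearW.
  apply: (asure_imp (asure_and (hF i) ih)); apply: nearW => n y [Fi Fs] j.
  by rewrite inE => /orP[/eqP->//|/Fs].
move=> /asure_imp; apply; apply: nearW => n y H i; apply: H; exact: mem_enum.
Qed.

Lemma asureP F : (\forall n \near \oo, measurable [set y | ~ F n y]) ->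
  asure F <-> P n [set y | ~ F n y] @[n --> \oo] --> 0%E.
Proof.
move=> mF; split => [hF|cv].
  apply/fine_cvgP; split.
    near=> n; rewrite fin_num_measure//; near: n; exact: mF.
  apply/cvgr0Pnorm_le => e e0; near=> n.
  have [B [mB BF Be]] : exists B : set 'M[R]_(n, l),
    [/\ measurable B, forall y, ~ B y -> F n y & (P n B <= e%:E)%E] by near: n; exact: hF.
  have mn : measurable [set y | ~ F n y] by near: n; exact: mF.
  rewrite /= ger0_norm ?fine_ge0// -lee_fin probability_fineK//.
  apply: le_trans Be; apply: le_measure; rewrite ?inE// => y; apply: contra_notP; exact: BF.
move=> e e0; move/fine_cvgP : cv => [_ /cvgr0Pnorm_le/(_ _ e0) H].
near=> n; exists [set y | ~ F n y].
have mn : measurable [set y | ~ F n y] by near: n; exact: mF.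
split => //; first by move=> y /contrapT.
have : `|fine (P n [set y | ~ F n y])| <= e by near: n; exact: H.
by rewrite ger0_norm ?fine_ge0// -lee_fin probability_fineK.
Unshelve. all: by end_near. Qed.

(** One bound on [n] serves all measurable events incompatible with [F], so that the event may be
    chosen after [n]. *)
Lemma asure_fine F (e : R) : 0 < e -> asure F -> \forall n \near \oo,
  forall E : set 'M[R]_(n, l), measurable E -> (forall y, E y -> ~ F n y) -> fine (P n E) <= e.
Proof.
move=> e0 hF; near=> n => E mE EF.
have [B [mB BF Be]] : exists B : set 'M[R]_(n, l),
    [/\ measurable B, forall y, ~ B y -> F n y & (P n B <= e%:E)%E] by near: n; exact: hF.
rewrite -lee_fin probability_fineK//; apply: le_trans Be; apply: le_measure; rewrite ?inE//.
by move=> y Ey; apply: contrapT => /BF; exact: EF.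
Unshelve. all: by end_near. Qed.

Lemma cvgp0P X : (\forall n \near \oo, measurable_fun setT (X n)) ->
  cvgp0 X <-> forall e : R, 0 < e -> P n [set y | e <= `|X n y|] @[n --> \oo] --> 0%E.
Proof.
move=> mX.
have E n (e : R) : [set y | ~ (`|X n y| < e)] = [set y | e <= `|X n y|].
  by apply/seteqP; split => y /=; rewrite leNgt => /negP.
have mE (e : R) : \forall n \near \oo, measurable [set y | ~ (`|X n y| < e)].
  near=> n; rewrite E -[Y in measurable Y]setTI; apply: measurable_fun_le => //.
  by apply: measurableT_comp => //; near: n.
split => h e e0.
  have /asureP := h e e0; move=> /(_ (mE e)); under eq_fun do rewrite E; exact.
by apply/asureP => //; under eq_fun do rewrite E; exact: h.
Unshelve. all: by end_near. Qed.

Lemma cvgp0D X Y : cvgp0 X -> cvgp0 Y -> cvgp0 (fun n y => X n y + Y n y).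
Proof.
move=> hX hY e e0; have e2 : 0 < e / 2 by rewrite divr_gt0.
apply: (asure_imp (asure_and (hX _ e2) (hY _ e2))); apply: nearW => n y [h1 h2].
by rewrite [e]splitr (le_lt_trans (ler_normD _ _))// ltrD.
Qed.

Lemma cvgp0N X : cvgp0 X -> cvgp0 (fun n y => - X n y).
Proof.
by move=> hX e e0; apply: (asure_imp (hX e e0)); apply: nearW => n y; rewrite normrN.
Qed.

Lemma cvgp0_eq X Y : (\forall n \near \oo, X n =1 Y n) -> cvgp0 X -> cvgp0 Y.
Proof.
move=> XY hX e e0; apply: (asure_imp (hX e e0)); near=> n => y.
suff -> : X n y = Y n y by [].
by move: y; near: n.
Unshelve. all: by end_near. Qed.

Lemma cvgp0_le X Y : (\forall n \near \oo, forall y, `|Y n y| <= `|X n y|) -> cvgp0 X -> cvgp0 Y.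
Proof.
move=> XY hX e e0; apply: (asure_imp (hX e e0)); near=> n => y; apply: le_lt_trans.
by move: y; near: n.
Unshelve. all: by end_near. Qed.

Lemma cvgp0_sum (I : finType) (X : I -> forall n, 'M[R]_(n, l) -> R) :
  (forall i, cvgp0 (X i)) -> cvgp0 (fun n y => \sum_i X i n y).
Proof.
move=> hX; elim: (index_enum I) => [|i s ih].
  by move=> e e0; apply: asure_near; apply: nearW => n y; rewrite big_nil normr0.
apply: cvgp0_eq (cvgp0D (hX i) ih); apply: nearW => n y; by rewrite big_cons.
Qed.

End asymptotically_sure.

(** * Perturbation bounds for reciprocals and square roots *)

Section real_inverse.
Variable R : realType.

Lemma measurable_invr : measurable_fun setT (fun x : R => x^-1).
Proof.
rewrite -(setvU [set (0 : R)]); apply/measurable_funU; [exact: measurableC|exact: measurable_set1|].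
split; last exact: measurable_fun_set1.
apply: open_continuous_measurable_fun; first by apply: closed_openC; apply: accessible_closed_set1; exact: hausdorff_accessible.
move=> x; rewrite inE /= => x0; apply: inv_continuous; exact/eqP.
Qed.

Lemma measurable_sqrtr : measurable_fun setT (@Num.sqrt R).
Proof. by apply: continuous_measurable_fun; exact: sqrt_continuous. Qed.

Lemma sqrt_close (a : R) : 0 <= a -> `|Num.sqrt a - 1| <= `|a - 1|.
Proof.
move=> a0; rewrite -{2}(sqr_sqrtr a0) -[X in _ ^+ 2 - X](expr1n _ 2) subr_sqr normrM ler_peMr//.
by rewrite ger0_norm ?addr_ge0 ?sqrtr_ge0// lerDr sqrtr_ge0.
Qed.

Lemma sqrtV_close (a kappa : R) : kappa <= 1 / 4 -> `|a - 1| <= kappa ->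
  0 < (Num.sqrt a)^-1 <= 4 / 3 /\ `|(Num.sqrt a)^-1 - 1| <= 4 / 3 * kappa.
Proof.
move=> k4 ak; have a0 : 0 <= a by move: ak; rewrite ler_norml; lra.
have := le_trans (sqrt_close a0) ak; set s := Num.sqrt a => sk.
have s34 : 3 / 4 <= s by move: sk; rewrite ler_norml; lra.
have s0 : 0 < s by lra.
have sV : s^-1 <= 4 / 3 by rewrite -div1r ler_pdivrMr//; lra.
split; first by rewrite invr_gt0 s0.
have -> : s^-1 - 1 = s^-1 * (1 - s) by rewrite mulrBr mulr1 mulVf// gt_eqF.
have sV0 : 0 <= s^-1 by rewrite invr_ge0 ltW.
by rewrite normrM (ger0_norm sV0) distrC ler_pM.
Qed.

(** Reciprocal roots are at most 4/3 and off by at most [4 / 3 * kappa]; the three contributions sum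
    to [16/9 + 16/9 + 4/3 = 44/9 <= 5]. *)
Lemma corr_close (a b s c kappa : R) : kappa <= 1 / 4 -> `|c| <= 1 -> `|s - c| <= kappa ->
  `|a - 1| <= kappa -> `|b - 1| <= kappa ->
  `|(Num.sqrt a)^-1 * s * (Num.sqrt b)^-1 - c| <= 5 * kappa.
Proof.
move=> k4 c1 sc ak bk.
have [/andP[u0 u43] uk] := sqrtV_close k4 ak; have [/andP[v0 v43] vk] := sqrtV_close k4 bk.
set u := (Num.sqrt a)^-1 in u0 u43 uk *; set v := (Num.sqrt b)^-1 in v0 v43 vk *.
have -> : u * s * v - c = (s - c) * (u * v) + c * ((u - 1) * v + (v - 1)) by ring.
have k0 : 0 <= kappa by apply: le_trans sc.
have h1 : `|(s - c) * (u * v)| <= kappa * (4 / 3 * (4 / 3)).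
  rewrite normrM (ger0_norm (ltW (mulr_gt0 u0 v0))); apply: ler_pM => //.
    by rewrite ltW ?mulr_gt0.
  by apply: ler_pM => //; exact: ltW.
have h2 : `|(u - 1) * v| <= 4 / 3 * kappa * (4 / 3).
  by rewrite normrM (ger0_norm (ltW v0)); apply: ler_pM => //; exact: ltW.
have h3 : `|c * ((u - 1) * v + (v - 1))| <= 1 * (4 / 3 * kappa * (4 / 3) + 4 / 3 * kappa).
  by rewrite normrM; apply: ler_pM => //; apply: le_trans (ler_normD _ _) _; exact: lerD.
by apply: le_trans (ler_normD _ _) _; lra.
Qed.

Lemma ratio_close (r s kappa : R) : kappa <= 1 / 4 -> `|r - 1| <= kappa -> `|s - 1| <= kappa ->
  `|r / s - 1| <= 3 * kappa.
Proof.
move=> k4 rk sk; have s34 : 3 / 4 <= s by move: sk; rewrite ler_norml; lra.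
have s0 : 0 < s by lra.
have sV : s^-1 <= 4 / 3 by rewrite -div1r ler_pdivrMr//; lra.
have -> : r / s - 1 = ((r - 1) - (s - 1)) * s^-1 by field; rewrite gt_eqF.
have k0 : 0 <= kappa by apply: le_trans sk.
apply: (@le_trans _ _ ((kappa + kappa) * (4 / 3))); last by lra.
rewrite normrM ler_pM//; last by rewrite ger0_norm// invr_ge0 ltW.
by apply: le_trans (ler_normB _ _) _; exact: lerD.
Qed.

End real_inverse.

(** * Consistency expressed entry by entry *)

Section consistency.
Variables (R : realType) (l k : nat) (P : forall n, probability 'M[R]_(n, l) R).
Implicit Types (A S : forall n, 'M[R]_(n, l) -> 'M[R]_k).

Lemma measurable_corrmx d (T : measurableType d) (M : T -> 'M[R]_k) a b :
  (forall i j, measurable_fun setT (fun y => M y i j)) -> (forall y i, 0 <= M y i i) ->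
  measurable_fun setT (fun y => corrmx (M y) a b).
Proof.
move=> mM M0; under eq_fun do rewrite corrmxE//.
have mV i : measurable_fun setT (fun y => (Num.sqrt (M y i i))^-1).
  exact: measurableT_comp (@measurable_invr R) (measurableT_comp (@measurable_sqrtr R) (mM i i)).
by apply: measurable_funM => //; apply: measurable_funM.
Qed.

(** An abstract [inv] lets one proof serve [invmx] and [mpinv]. The conditions on [A] are asked for
    large [n], since (E) gives positive variances and measurable [g] for [n >= 1] only. *)
Lemma consistent_covP (inv : 'M[R]_k -> 'M[R]_k) A S :
  (\forall n \near \oo, forall i j, measurable_fun setT (fun y => A n y i j)) ->
  (\forall n \near \oo, forall y i, 0 <= A n y i i) ->
  (\forall n \near \oo, forall y, inv (diagpart (A n y)) = diag_mx (\row_i (A n y i i)^-1)) ->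
  (forall n i j, measurable_fun setT (fun y => S n y i j)) -> (forall n y i, 0 <= S n y i i) ->
  consistent_cov inv P A S <->
  (forall a b, cvgp0 P (fun n y => corrmx (S n y) a b - corrmx (A n y) a b)) /\
  (forall a, cvgp0 P (fun n y => (A n y a a)^-1 * S n y a a - 1)).
Proof.
move=> mA A0 Ainv mS S0.
pose C n y := corrmx (S n y) - corrmx (A n y).
pose D n y := inv (diagpart (A n y)) *m diagpart (S n y) - 1%:M.
have CE n y a b : C n y a b = corrmx (S n y) a b - corrmx (A n y) a b.
  by rewrite /C mxE; congr (_ + _); rewrite mxE.
have DE : \forall n \near \oo, forall y i j,
    D n y i j = ((A n y i i)^-1 * S n y i i - 1) *+ (i == j).
  near=> n => y i j; rewrite /D (_ : inv _ = diag_mx (\row_i (A n y i i)^-1)); last first.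
    by move: y; near: n.
  rewrite /diagpart mulmx_diag !mxE; by case: (i == j); rewrite ?subr0.
have mC : \forall n \near \oo, forall i j, measurable_fun setT (fun y => C n y i j).
  near=> n => i j; under eq_fun do rewrite CE.
  apply: measurable_funB; apply: measurable_corrmx => //; near: n => //.
have mD : \forall n \near \oo, forall i j, measurable_fun setT (fun y => D n y i j).
  near=> n => i j; have E : forall y i j,
    D n y i j = ((A n y i i)^-1 * S n y i i - 1) *+ (i == j) by near: n.
  rewrite (_ : (fun y => _) = if i == j then (fun y => (A n y i i)^-1 * S n y i i - 1) else cst 0).
    2: by apply/funext => y; rewrite E; case: (i == j).
  case: ifP => _ //; apply: measurable_funB => //.
  apply: measurable_funM => //; apply: measurableT_comp (@measurable_invr R) _.
  by have : forall i j, measurable_fun setT (fun y => A n y i j) by near: n.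
pose Z n y := opnorm (C n y) + opnorm (D n y).
have mZ : \forall n \near \oo, measurable_fun setT (Z n).
  near=> n; apply: measurable_funD; apply: measurableT_comp (@measurable_opnorm _ _ _) _;
    apply: measurable_mx; near: n => //.
have opn0 (M : 'M[R]_k) : 0 <= opnorm M.
  have e0 : euclid_norm (0 : 'cV[R]_k) = 0.
    by rewrite /euclid_norm big1 ?sqrtr0// => i _; rewrite mxE expr0n.
  by have := @opnorm_ub _ _ _ M 0; rewrite mulmx0 e0 => /(_ ler01).
have Z0 n y : 0 <= Z n y by rewrite addr_ge0.
have -> : consistent_cov inv P A S <-> cvgp0 P Z.
  rewrite (cvgp0P _ mZ); split => H e e0; move: (H e e0);
   rewrite (_ : (fun n => P n [set y | e <= `|Z n y|]) = (fun n => P n [set y | e <= Z n y])) //;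
   apply/funext => n; congr (P n _); apply/seteqP; split => y /=; by rewrite ger0_norm.
split=> [hZ|[hC hD]].
  split => a => [b|]; apply: (cvgp0_le _ hZ).
    apply: nearW => n y; rewrite -CE (ger0_norm (Z0 _ _)).
    by apply: le_trans (opnorm_ge_entry _ _ _) _; rewrite lerDl.
  near=> n => y; have E : forall y i j,
    D n y i j = ((A n y i i)^-1 * S n y i i - 1) *+ (i == j) by near: n.
  have := E y a a; rewrite eqxx mulr1n => <-; rewrite (ger0_norm (Z0 _ _)).
  by apply: le_trans (opnorm_ge_entry _ _ _) _; rewrite lerDr.
have abs (X : forall n, 'M[R]_(n, l) -> R) : cvgp0 P X -> cvgp0 P (fun n y => `|X n y|).
  by apply: cvgp0_le; apply: nearW => n y; rewrite normr_id.
have H1 : cvgp0 P (fun n y => \sum_a \sum_b `|C n y a b|).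
  apply: cvgp0_sum => a; apply: cvgp0_sum => b; apply: abs; apply: cvgp0_eq (hC a b).
  by apply: nearW => n y; rewrite CE.
have H2 : cvgp0 P (fun n y => \sum_a `|(A n y a a)^-1 * S n y a a - 1|).
  by apply: cvgp0_sum => a; apply: abs.
apply: (cvgp0_le _ (cvgp0D H1 H2)); near=> n => y.
rewrite (ger0_norm (Z0 _ _)); apply: le_trans (ler_norm _); apply: lerD; first exact: opnorm_le_sum.
apply: le_trans (opnorm_le_sum _) _; apply: ler_sum => i _.
have E : forall y i j,
    D n y i j = ((A n y i i)^-1 * S n y i i - 1) *+ (i == j) by near: n.
rewrite (bigD1 i)//= E eqxx mulr1n big1 ?addr0// => j; rewrite eq_sym E => /negPf ->.
by rewrite mulr0n normr0.
Unshelve. all: by end_near. Qed.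

End consistency.

(** * Standardized arrays *)

Section centered_array.
Variables (R : realType) (l k n : nat) (P : probability 'M[R]_(n, l) R)
  (Q : 'I_n -> probability 'rV[R]_l R) (h : 'I_n -> 'rV[R]_l -> 'cV[R]_k).
Hypothesis hPQ : is_product_law P Q.
Hypothesis mh : forall i, measurable_fun setT (h i).
Hypothesis ih2 : forall i a, (Q i).-integrable setT (EFin \o (fun x => h i x a 0 ^+ 2)).
Hypothesis Eh0 : forall i a, \int[Q i]_x h i x a 0 = 0.

(** By independence and centring this is the covariance matrix of [lead_sum h], in a form adapted to
    estimates row by row. *)
Definition moment2 : 'M[R]_k := \matrix_(a, b) \sum_i \int[Q i]_x (h i x a 0 * h i x b 0).

Let mha i a : measurable_fun setT (fun x => h i x a 0).
Proof. exact: measurableT_comp (@measurable_coord R k 1 a 0) (mh i). Qed.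

Let iha i a : (Q i).-integrable setT (EFin \o (fun x => h i x a 0)).
Proof. exact: integrable_of_sqr. Qed.

Let ihab i a b : (Q i).-integrable setT (EFin \o (fun x => h i x a 0 * h i x b 0)).
Proof. exact: integrable_mul. Qed.

Lemma lead_sumE (y : 'M[R]_(n, l)) a : lead_sum h y a 0 = \sum_i h i (row i y) a 0.
Proof. by rewrite /lead_sum summxE. Qed.

Lemma measurable_lead_sum : measurable_fun setT (lead_sum h).
Proof.
apply: measurable_mx => a b; rewrite (ord1 b); under eq_fun do rewrite lead_sumE.
apply: measurable_sum => i.
exact: measurableT_comp (mha i a) (@measurable_row R l n i).
Qed.

Lemma covmx_lead_sum : covmx P (lead_sum h) = moment2.
Proof.
apply/matrixP => a b; rewrite !mxE covariance.unlock.
have E0 c : fine ('E_P[(fun y => lead_sum h y c 0%R)])%E = 0.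
  rewrite expectation.unlock.
  rewrite -[LHS]/(\int[P]_y (lead_sum h y c 0)); under eq_Rintegral do rewrite lead_sumE.
  rewrite Rintegral_sum => [|i]; last first.
    by apply: (integrable_row hPQ (f := fun x => h i x c 0)).
  by rewrite big1// => i _; rewrite (Rintegral_row hPQ (f := fun x => h i x c 0)).
rewrite !E0 expectation.unlock -[LHS]/(\int[P]_y (((lead_sum h y a 0) - 0) * (lead_sum h y b 0 - 0))).
under eq_Rintegral do rewrite !subr0 !lead_sumE.
by rewrite (Rintegral_sum_mul_sum hPQ (X := fun i x => h i x a 0) (Y := fun i x => h i x b 0)).
Qed.

Lemma dotv_lead_sum t (y : 'M[R]_(n, l)) : dotv t (lead_sum h y) = \sum_i dotv t (h i (row i y)).
Proof. by rewrite /dotv /lead_sum mulmx_sumr summxE. Qed.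

Let dotvE (t x : 'cV[R]_k) : dotv t x = \sum_a t a 0 * x a 0.
Proof. by rewrite /dotv mxE; apply: eq_bigr => a _; rewrite mxE. Qed.

Let mX t i : measurable_fun setT (fun x => dotv t (h i x)).
Proof. exact: measurableT_comp (measurable_dotv t) (mh i). Qed.

Let XX t i x : dotv t (h i x) ^+ 2 =
  \sum_a \sum_b (t a 0 * t b 0) * (h i x a 0 * h i x b 0).
Proof.
rewrite dotvE expr2 mulr_suml; apply: eq_bigr => a _; rewrite mulr_sumr; apply: eq_bigr => b _; ring.
Qed.

Let iX2 t i : (Q i).-integrable setT (EFin \o (fun x => dotv t (h i x) ^+ 2)).
Proof.
under eq_fun do rewrite XX.
by apply: integrable_sumR => a; apply: integrable_sumR => b; exact: integrableZR.
Qed.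

Let EX0 t i : \int[Q i]_x dotv t (h i x) = 0.
Proof.
under eq_Rintegral do rewrite dotvE.
rewrite Rintegral_sum => [|a]; last exact: integrableZR.
by rewrite big1// => a _; rewrite (RintegralZl _ measurableT (iha i a)) Eh0 mulr0.
Qed.

Lemma moment2_bform t : bform moment2 t t = \sum_i \int[Q i]_x (dotv t (h i x) ^+ 2).
Proof.
have -> : bform moment2 t t = \sum_a \sum_b t a 0 * t b 0 * moment2 a b.
  rewrite /bform mxE exchange_big /=; apply: eq_bigr => b _; rewrite mxE mulr_suml.
  by apply: eq_bigr => a _; rewrite mxE; ring.
under [RHS]eq_bigr => i _.
  under eq_Rintegral do rewrite XX.
  rewrite Rintegral_sum => [|a]; last by apply: integrable_sumR => b; exact: integrableZR.
  under eq_bigr => a _.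
    rewrite Rintegral_sum => [|b]; last exact: integrableZR.
    under eq_bigr => b _ do rewrite (RintegralZl _ measurableT (ihab i a b)).
    over.
  over.
rewrite [RHS]exchange_big; apply: eq_bigr => a _.
rewrite [RHS]exchange_big; apply: eq_bigr => b _.
by rewrite mxE mulr_sumr.
Qed.

Lemma psdmx_moment2 : psdmx moment2.
Proof.
split.
  by apply/matrixP => a b; rewrite !mxE; apply: eq_bigr => i _; under eq_Rintegral do rewrite mulrC.
move=> t; rewrite -/(bform moment2 t t) moment2_bform; apply: sumr_ge0 => i _.
by apply: Rintegral_ge0 => x _; exact: sqr_ge0.
Qed.

Definition Lind (e : R) : R := \sum_a \sum_i \int[Q i]_x tail2 (fun x => h i x a 0) e x.

Let T (t : 'cV[R]_k) := \sum_a `|t a 0| + 1.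

Let T0 t : 0 < T t. Proof. by rewrite ltr_wpDl// sumr_ge0. Qed.

(* If |t'h| >= e then the largest |h_a| is at least e / T and dominates |t'h| / T. *)
Lemma tail2_dotv_le t e i x : 0 < e ->
  tail2 (fun x => dotv t (h i x)) e x <=
  T t ^+ 2 * \sum_a tail2 (fun x => h i x a 0) (e / T t) x.
Proof.
move=> e0; rewrite [leLHS]tail2E; case: ifP => [et|_]; last first.
  by rewrite mulr_ge0 ?sqr_ge0// sumr_ge0// => a _; exact: tail2_ge0.
have [a ha] : exists a, `|dotv t (h i x)| <= T t * `|h i x a 0|.
  apply: contrapT => /forallNP H.
  have : `|dotv t (h i x)| <= \sum_a `|t a 0| * (`|dotv t (h i x)| / T t).
    rewrite [in leLHS]dotvE; apply: le_trans (ler_norm_sum _ _ _) _.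
    apply: ler_sum => a _; rewrite normrM ler_wpM2l// ler_pdivlMr// mulrC ltW// ltNge.
    exact/negP/H.
  rewrite -mulr_suml mulrCA ler_pMr ?(lt_le_trans e0)// ler_pdivlMr// mul1r /T; lra.
rewrite (bigD1 a)//= mulrDr -[leLHS]addr0; apply: lerD; last first.
  by rewrite mulr_ge0 ?sqr_ge0// sumr_ge0// => b _; exact: tail2_ge0.
rewrite tail2E (_ : e / T t <= `|h i x a 0|); last first.
  by rewrite ler_pdivrMr// mulrC (le_trans et).
rewrite -exprMn -(real_normK (num_real (dotv _ _))) -(real_normK (num_real (T t * _))).
by rewrite lerXn2r ?nnegrE// normrM (ger0_norm (ltW (T0 t))).
Qed.

Lemma sum_tail2_dotv_le t e : 0 < e ->
  \sum_i \int[Q i]_x tail2 (fun x => dotv t (h i x)) e x <= T t ^+ 2 * Lind (e / T t).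
Proof.
move=> e0; rewrite /Lind exchange_big mulr_sumr; apply: ler_sum => i _.
have it a : (Q i).-integrable setT (EFin \o tail2 (fun x => h i x a 0) (e / T t)).
  exact: integrable_tail2.
have is_ := integrable_sumR (index_enum 'I_k) it.
rewrite -Rintegral_sum// -(RintegralZl _ measurableT is_).
apply: (le_Rintegral measurableT); [exact: integrable_tail2|exact: integrableZR|].
by move=> x _; exact: tail2_dotv_le.
Qed.

(** Cramer-Wold device: [dotv t] reduces the vector array to a scalar one, whose Lindeberg sum is
    controlled by those of the coordinates through [sum_tail2_dotv_le]. *)
Lemma array_clt_bound t e : 0 < e <= 1 ->
  `|\int[P]_y cos (dotv t (lead_sum h y)) - expR (- (bform moment2 t t / 2))| <=
  2 * (e * bform moment2 t t + T t ^+ 2 * Lind (e / T t)) +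
  (e ^+ 2 + T t ^+ 2 * Lind (e / T t)) * bform moment2 t t.
Proof.
move=> e01; have /andP[e0 _] := e01; rewrite moment2_bform.
under eq_Rintegral do rewrite dotv_lead_sum.
apply: le_trans (clt_bound hPQ (X := fun i x => dotv t (h i x)) (mX t) (iX2 t) (EX0 t) e01) _.
have s0 : 0 <= \sum_i \int[Q i]_x (dotv t (h i x) ^+ 2).
  by rewrite -moment2_bform; exact: psdmxP psdmx_moment2.
have tl := sum_tail2_dotv_le t e0.
apply: lerD; first by rewrite ler_wpM2l// lerD2l.
by rewrite ler_wpM2r// lerD2l.
Qed.

Lemma array_lln_bound t e : 0 < e ->
  \int[P]_y `|\sum_i dotv t (h i (row i y)) ^+ 2 - bform moment2 t t| <=
  e * (bform moment2 t t + 1) / 2 + 2 * (T t ^+ 2 * Lind (e / T t)).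
Proof.
move=> e0; rewrite moment2_bform.
apply: le_trans (lln_bound hPQ (X := fun i x => dotv t (h i x)) (mX t) (iX2 t) e0) _.
by rewrite lerD2l ler_wpM2l// sum_tail2_dotv_le.
Qed.

Lemma array_integrable_lln t :
  P.-integrable setT (EFin \o (fun y => \sum_i dotv t (h i (row i y)) ^+ 2 - bform moment2 t t)).
Proof.
rewrite moment2_bform.
exact: (integrable_sum_sqr hPQ (X := fun i x => dotv t (h i x)) (iX2 t)).
Qed.

Lemma lead_sum_unit_tails : (forall a, moment2 a a = 1) -> unit_tails P (lead_sum h).
Proof.
move=> m1 a M M0.
have mi : P.-integrable setT (EFin \o (fun y => lead_sum h y a 0 ^+ 2)).
  under eq_fun do rewrite lead_sumE expr2.
  exact: (integrable_sum_mul_sum hPQ (X := fun i x => h i x a 0) (Y := fun i x => h i x a 0)).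
have := markov_ineq (exprn_gt0 2 M0) mi.
under eq_Rintegral do rewrite (ger0_norm (sqr_ge0 _)) lead_sumE expr2.
rewrite (Rintegral_sum_mul_sum hPQ (X := fun i x => h i x a 0) (Y := fun i x => h i x a 0))//.
have := m1 a; rewrite mxE => ->; rewrite mulr1.
congr (_ <= _)%E; congr (P _); apply/seteqP; split => y /=; rewrite normrX ler_pXn2r// nnegrE ltW//.
Qed.

End centered_array.

Section standardized_array.
Unset Implicit Arguments.
Variables (R : realType) (l k : nat) (P : forall n, probability 'M[R]_(n, l) R)
  (Q : forall n, 'I_n -> probability 'rV[R]_l R).
Hypothesis hPQ : forall n, is_product_law (P n) (Q n).
Variables (thetahat : forall n, 'M[R]_(n, l) -> 'cV[R]_k) (thetastar : nat -> 'cV[R]_k)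
  (g : forall n, 'I_n -> 'rV[R]_l -> 'cV[R]_k) (Delta : forall n, 'M[R]_(n, l) -> 'cV[R]_k).
Set Implicit Arguments.
Hypothesis hE : expansion_condition P Q thetahat thetastar g Delta.

Definition stdev n (a : 'I_k) : R :=
  Num.sqrt (fine ('V_(P n)[(fun y => lead_sum (g n) y a 0%R)])%E).

Definition std_array n (i : 'I_n) x : 'cV[R]_k := \col_a ((stdev n a)^-1 * g n i x a 0).

Arguments std_array : clear implicits.

Definition std_corr n : 'M[R]_k := corrmx (covmx (P n) (lead_sum (g n))).

Lemma near_pos : \forall n \near \oo, (0 < n)%N.
Proof. by near=> n; near: n; exists 1%N. Unshelve. all: by end_near. Qed.

Lemma stdev_gt0 n a : (0 < n)%N -> 0 < stdev n a.
Proof.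
move=> n0; have [H _ _] := hE; have [_ _ _ _ /(_ a)/andP[V0 Voo]] := H n n0.
by rewrite sqrtr_gt0 fine_gt0// V0.
Qed.

Lemma stdev_sqr n a : (0 < n)%N ->
  stdev n a ^+ 2 = fine ('V_(P n)[(fun y => lead_sum (g n) y a 0%R)])%E.
Proof.
move=> n0; have [H _ _] := hE; have [_ _ _ _ /(_ a)/andP[V0 Voo]] := H n n0.
by rewrite sqr_sqrtr// fine_ge0// ltW.
Qed.

Lemma measurable_g n i : (0 < n)%N -> measurable_fun setT (g n i).
Proof. by move=> n0; have [H _ _] := hE; have [mg _ _ _ _] := H n n0. Qed.

Lemma measurable_ga n i a : (0 < n)%N -> measurable_fun setT (fun x => g n i x a 0).
Proof. by move=> n0; exact: measurableT_comp (@measurable_coord R k 1 a 0) (measurable_g i n0). Qed.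

Lemma measurable_Delta n a : (0 < n)%N -> measurable_fun setT (fun y => Delta n y a 0).
Proof.
move=> n0; have [H _ _] := hE; have [_ mD _ _ _] := H n n0.
exact: measurableT_comp (@measurable_coord R k 1 a 0) mD.
Qed.

Lemma expansion_eq n y : (0 < n)%N -> thetahat n y - thetastar n = lead_sum (g n) y + Delta n y.
Proof. by move=> n0; have [H _ _] := hE; have [_ _ E _ _] := H n n0. Qed.

Lemma Rintegral_g n i a : (0 < n)%N -> \int[Q n i]_x g n i x a 0 = 0.
Proof.
move=> n0; have [H _ _] := hE; have [_ _ _ /(_ i a) + _] := H n n0.
by rewrite expectation.unlock => E; rewrite /Rintegral E.
Qed.

Lemma integrable_sqr_of_tail2 d (T : measurableType d) (m : probability T R) (X : T -> R) (e : R) :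
  measurable_fun setT X -> (\int[m]_x (tail2 X e x)%:E < +oo)%E ->
  m.-integrable setT (EFin \o (fun x => X x ^+ 2)).
Proof.
move=> mX tX.
have it : m.-integrable setT (EFin \o tail2 X e).
  apply/integrableP; split; first by apply/measurable_EFinP; exact: measurable_tail2.
  by under eq_integral do rewrite /= ger0_norm ?tail2_ge0//.
apply: (@le_integrable _ _ _ m _ measurableT _ _ _ _ (integrableDR it (integrable_cstR m (e ^+ 2)))).
  by apply/measurable_EFinP; exact: measurable_funX.
move=> x _ /=; rewrite lee_fin (ger0_norm (sqr_ge0 _)) ger0_norm; last first.
  by rewrite addr_ge0 ?sqr_ge0// tail2_ge0.
rewrite tail2E; have [h|h] := lerP e `|X x|; first by rewrite lerDl sqr_ge0.
rewrite add0r -(real_normK (num_real (X x))) lerXn2r ?nnegrE// ?(ltW h)//.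
by rewrite (le_trans _ (ltW h)).
Qed.

(** (E) assumes a finite variance of the sum, not of each row. Finiteness row by row is drawn from
    the Lindeberg condition at [e = 1]: a sequence tending to 0 is eventually finite, so each tail
    integral is finite, and what lies below the threshold is bounded. *)
Lemma near_integrable_sqr_g : \forall n \near \oo, forall i a,
  (Q n i).-integrable setT (EFin \o (fun x => g n i x a 0 ^+ 2)).
Proof.
suff H a : \forall n \near \oo, forall i,
    (Q n i).-integrable setT (EFin \o (fun x => g n i x a 0 ^+ 2)).
  have : \forall n \near \oo, forall a i, (Q n i).-integrable setT (EFin \o (fun x => g n i x a 0 ^+ 2)).
    by apply: filter_forall => a; exact: H.
  by apply: filterS => n H2 i a; exact: H2.
have [_ /(_ a 1 ltr01)/fine_cvgP[fin _] _] := hE.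
pose c n := (fine ('V_(P n)[(fun y => lead_sum (g n) y a 0%R)])%E)^-1.
pose A n := (\sum_(j < n) \int[Q n j]_x (tail2 (fun x => g n j x a 0%R) (1 * stdev n a)%R x)%:E)%E.
have finA : \forall n \near \oo, ((c n)%:E * A n)%E \is a fin_num := fin.
near=> n => i; have n0 : (0 < n)%N by near: n; exact: near_pos.
have c0 : 0 < c n by rewrite /c -stdev_sqr// invr_gt0 exprn_gt0// stdev_gt0.
have t0 j : (0 <= \int[Q n j]_x (tail2 (fun x => g n j x a 0) (1 * stdev n a) x)%:E)%E.
  by apply: integral_ge0 => x _; rewrite lee_fin tail2_ge0.
apply: (@integrable_sqr_of_tail2 _ _ _ _ (1 * stdev n a)); first exact: measurable_ga.
apply: (@le_lt_trans _ _ (A n)).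
  by rewrite /A (bigD1 i)//= leeDl// sume_ge0.
rewrite ltNge leye_eq; apply/eqP => Aoo.
have : ((c n)%:E * A n)%E \is a fin_num by near: n.
by rewrite Aoo gt0_muley.
Unshelve. all: by end_near. Qed.

Section fixed_sample_size.
Variable n : nat.
Hypothesis n0 : (0 < n)%N.
Hypothesis ig2 : forall i a, (Q n i).-integrable setT (EFin \o (fun x => g n i x a 0 ^+ 2)).

Lemma measurable_std i : measurable_fun setT (std_array n i).
Proof.
apply: measurable_mx => a b; rewrite /std_array; under eq_fun do rewrite mxE.
by apply: measurable_funM => //; exact: measurable_ga.
Qed.

Lemma integrable_std i a : (Q n i).-integrable setT (EFin \o (fun x => std_array n i x a 0 ^+ 2)).
Proof. by rewrite /std_array; under eq_fun do rewrite mxE; exact: integrable_sqrZ. Qed.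

Lemma Rintegral_std i a : \int[Q n i]_x std_array n i x a 0 = 0.
Proof.
rewrite /std_array; under eq_Rintegral do rewrite mxE.
have ia := integrable_of_sqr (measurable_ga i a n0) (ig2 i a).
by rewrite (RintegralZl _ measurableT ia) Rintegral_g// mulr0.
Qed.

Lemma lead_sum_std y a : lead_sum (std_array n) y a 0 = (stdev n a)^-1 * lead_sum (g n) y a 0.
Proof. by rewrite !lead_sumE mulr_sumr; apply: eq_bigr => i _; rewrite mxE. Qed.

Lemma covmx_g : covmx (P n) (lead_sum (g n)) = moment2 (Q n) (g n).
Proof.
apply: covmx_lead_sum => //.
- by move=> i; exact: measurable_g.
- by move=> i a; exact: Rintegral_g.
Qed.

Lemma covmx_diag a : covmx (P n) (lead_sum (g n)) a a = stdev n a ^+ 2.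
Proof. by rewrite stdev_sqr// mxE. Qed.

Lemma covmx_diag_gt0 a : 0 < covmx (P n) (lead_sum (g n)) a a.
Proof. by rewrite covmx_diag exprn_gt0// stdev_gt0. Qed.

Lemma moment2_std : moment2 (Q n) (std_array n) = std_corr n.
Proof.
apply/matrixP => a b; rewrite /std_corr corrmxE; last by move=> c; exact: ltW (covmx_diag_gt0 c).
rewrite !covmx_diag !sqrtr_sqr !ger0_norm ?ltW ?stdev_gt0// covmx_g !mxE mulr_sumr mulr_suml.
apply: eq_bigr => i _; rewrite -(RintegralZl _ measurableT); last first.
  by apply: integrable_mul => //; exact: measurable_ga.
rewrite -(RintegralZr _ measurableT); last first.
  by apply: integrableZR; apply: integrable_mul => //; exact: measurable_ga.
by apply: eq_Rintegral => x _; rewrite !mxE; ring.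
Qed.

Lemma std_corr_diag a : std_corr n a a = 1.
Proof.
by apply: corrmx_diag_eq1 => [c|]; [exact: ltW (covmx_diag_gt0 c)|exact: covmx_diag_gt0].
Qed.

Lemma psdmx_std_corr : psdmx (std_corr n).
Proof.
rewrite -moment2_std; apply: psdmx_moment2 => [i|i a]; [exact: measurable_std|exact: integrable_std].
Qed.

Lemma Lind_std e : 0 < e -> Lind (Q n) (std_array n) e =
  \sum_a (fine ('V_(P n)[(fun y => lead_sum (g n) y a 0%R)])%E)^-1 *
    \sum_i \int[Q n i]_x tail2 (fun x => g n i x a 0) (e * stdev n a) x.
Proof.
move=> e0; apply: eq_bigr => a _; rewrite mulr_sumr; apply: eq_bigr => i _.
have s0 := stdev_gt0 a n0; rewrite -stdev_sqr//.
rewrite -(RintegralZl _ measurableT); last first.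
  by apply: integrable_tail2 => //; exact: measurable_ga.
apply: eq_Rintegral => x _; rewrite !tail2E mxE normrM ger0_norm ?invr_ge0 ?(ltW s0)//.
rewrite mulrC ler_pdivlMr//; case: ifP => _; last by rewrite mulr0.
by rewrite exprMn exprVn mulrC.
Qed.

Lemma unit_tails_std : unit_tails (P n) (lead_sum (std_array n)).
Proof.
apply: (lead_sum_unit_tails (hPQ n) measurable_std integrable_std Rintegral_std) => a.
by rewrite moment2_std std_corr_diag.
Qed.

End fixed_sample_size.

Lemma near_Lind_std e d : 0 < e -> 0 < d -> \forall n \near \oo, Lind (Q n) (std_array n) e <= d.
Proof.
move=> e0 d0; have [_ L _] := hE.
pose u a n := (fine ('V_(P n)[(fun y => lead_sum (g n) y a 0%R)])%E)^-1 *
    \sum_i \int[Q n i]_x tail2 (fun x => g n i x a 0) (e * stdev n a) x.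
have cu a : \forall n \near \oo, `|u a n| < d / k.+1%:R.
  have /fine_cvgP[_ /cvgr0Pnorm_lt/(_ (d / k.+1%:R))] := L a e e0.
  rewrite divr_gt0// => /(_ isT) H0.
  pose w n := fine (((fine 'V_(P n)[(fun y => lead_sum (g n) y a 0%R)])^-1)%:E *
      \sum_(i < n) \int[Q n i]_x (tail2 (fun x => g n i x a 0%R) (e * stdev n a)%R x)%:E)%E.
  have H : \forall n \near \oo, `|w n| < d / k.+1%:R := H0.
  near=> n; have n0 : (0 < n)%N by near: n; exact: near_pos.
  have ig2 : forall i a, (Q n i).-integrable setT (EFin \o (fun x => g n i x a 0 ^+ 2)).
    by near: n; exact: near_integrable_sqr_g.
  rewrite (_ : u a n = w n); first by near: n.
  rewrite /w.
  under eq_bigr => i _.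
    rewrite EFin_Rintegral; last by apply: integrable_tail2 => //; exact: measurable_ga.
    over.
  by rewrite sumEFin.
have : \forall n \near \oo, forall a, `|u a n| < d / k.+1%:R by exact: filter_forall.
move=> cua; near=> n; have n0 : (0 < n)%N by near: n; exact: near_pos.
have ig2 : forall i a, (Q n i).-integrable setT (EFin \o (fun x => g n i x a 0 ^+ 2)).
  by near: n; exact: near_integrable_sqr_g.
rewrite Lind_std//; apply: (@le_trans _ _ (\sum_(a < k) d / k.+1%:R)).
  have H : forall a, `|u a n| < d / k.+1%:R by near: n.
  apply: ler_sum => a _; apply: le_trans (ler_norm _) _; exact: ltW (H a).
rewrite sumr_const card_ord -[leLHS]mulr_natr mulrAC ler_pdivrMr// ler_wpM2l ?(ltW d0)//.
by rewrite ler_nat.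
Unshelve. all: by end_near. Qed.

End standardized_array.

(** * Central limit theorem with uniform comparison *)

Section limit_theorems.
Unset Implicit Arguments.
Variables (R : realType) (l k : nat) (P : forall n, probability 'M[R]_(n, l) R)
  (Q : forall n, 'I_n -> probability 'rV[R]_l R).
Hypothesis hPQ : forall n, is_product_law (P n) (Q n).
Variables (thetahat : forall n, 'M[R]_(n, l) -> 'cV[R]_k) (thetastar : nat -> 'cV[R]_k)
  (g : forall n, 'I_n -> 'rV[R]_l -> 'cV[R]_k) (Delta : forall n, 'M[R]_(n, l) -> 'cV[R]_k).
Hypothesis hE : expansion_condition P Q thetahat thetastar g Delta.


Let Gamma n := std_corr P g n.
Let h n := @std_array R l k P g n.
Let W n := lead_sum (h n).
Set Implicit Arguments.

Definition regular n := (0 < n)%N /\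
  forall i a, (Q n i).-integrable setT (EFin \o (fun x => g n i x a 0 ^+ 2)).

Lemma near_regular : \forall n \near \oo, regular n.
Proof.
near=> n; split; first by near: n; exact: near_pos.
by near: n; exact: (near_integrable_sqr_g hE).
Unshelve. all: by end_near. Qed.

Lemma corrlike_std_corr n : regular n -> corrlike (Gamma n).
Proof.
move=> [n0 ig2]; split; first exact: (psdmx_std_corr hPQ hE n0 ig2).
by move=> i; rewrite (std_corr_diag hE).
Qed.

(** With a unit diagonal, nonnegative definiteness bounds all entries by 1 in modulus. The bound
    does not involve [n], which makes the error estimates below uniform. *)
Lemma bform_std_corr_le n t : regular n -> bform (Gamma n) t t <= (\sum_a `|t a 0|) ^+ 2.
Proof.
move=> rn; have [Gp G1] := corrlike_std_corr rn.
rewrite /bform mxE expr2 mulr_sumr; apply: ler_sum => b _; rewrite mxE.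
apply: le_trans (ler_norm _) _; rewrite normrM ler_wpM2r//.
apply: le_trans (ler_norm_sum _ _ _) _; apply: ler_sum => a _; rewrite normrM mxE ler_piMr//.
apply: le_trans (psdmx_entry_le _ _ Gp) _; have := G1 a; have := G1 b; lra.
Qed.

Lemma near_char t (e : R) : 0 < e -> \forall n \near \oo,
  `|\int[P n]_y cos (dotv t (W n y)) - expR (- (bform (Gamma n) t t / 2))| <= e.
Proof.
move=> e0; pose K := (\sum_a `|t a 0|) ^+ 2; have K0 : 0 <= K by exact: sqr_ge0.
pose T := \sum_a `|t a 0| + 1; have T0 : 0 < T by rewrite ltr_wpDl// sumr_ge0.
(* With [s <= K] the variance of the projection, [d] takes care of
   [2 * d * s + d ^+ 2 * s <= 3 * d * K], and [c] below of the Lindeberg terms [(2 + s) * L]; each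
   gets [e / 2]. *)
have [d [d01 dK]] : exists d : R, 0 < d <= 1 /\ 3 * d * K <= e / 2.
  exists (Num.min 1 (e / (6 * (K + 1)))).
  have p0 : 0 < 6 * (K + 1) by lra.
  rewrite ge_min lexx/= lt_min ltr01 divr_gt0//; split => //.
  apply: (@le_trans _ _ (3 * (e / (6 * (K + 1))) * K)).
    by rewrite ler_wpM2r// ler_wpM2l// ge_min lexx orbT.
  rewrite (_ : _ * K = e / 2 * (K / (K + 1))); last by field; lra.
  by rewrite ger_pMr ?divr_gt0// ler_pdivrMr; lra.
have /andP[d0 d1] := d01.
pose c := e / (2 * (2 + K)) / T ^+ 2.
have c0 : 0 < c by rewrite !divr_gt0 ?exprn_gt0//; lra.
near=> n; have rn : regular n by near: n; exact: near_regular.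
have [n0 ig2] := rn.
have := array_clt_bound (hPQ n) (measurable_std hE n0) (integrable_std P ig2)
  (Rintegral_std hE n0 ig2) t d01.
rewrite (moment2_std hPQ hE n0 ig2) -/(W n) -/(Gamma n) => /le_trans; apply.
have : Lind (Q n) (h n) (d / T) <= c.
  by near: n; apply: (near_Lind_std hE) => //; rewrite divr_gt0.
rewrite -(ler_pM2l (_ : 0 < T ^+ 2)) ?exprn_gt0//.
have -> : T ^+ 2 * c = e / (2 * (2 + K)) by rewrite /c; field; rewrite !gt_eqF//; lra.
set L := T ^+ 2 * _ => Lc.
have L0 : 0 <= L.
  rewrite mulr_ge0 ?sqr_ge0// sumr_ge0// => a _; rewrite sumr_ge0// => i _.
  by apply: Rintegral_ge0 => x _; exact: tail2_ge0.
have := bform_std_corr_le t rn; set s := bform _ _ _ => sK.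
have s0 : 0 <= s by apply: psdmxP; case: (corrlike_std_corr rn).
have h1 : d * s <= d * K by rewrite ler_pM2l.
have h2 : d ^+ 2 * s <= d * K.
  by apply: le_trans h1; rewrite ler_wpM2r// expr2 ger_pMl.
have h3 : L * s <= L * K by rewrite ler_wpM2l.
have h4 : (2 + K) * L <= e / 2.
  apply: (@le_trans _ _ ((2 + K) * (e / (2 * (2 + K))))); first by rewrite ler_wpM2l//; lra.
  by rewrite le_eqVlt; apply/orP; left; apply/eqP; field; lra.
rewrite mulrDl; lra.
Unshelve. all: by end_near. Qed.

Lemma near_trig s (e : R) : 0 < e -> \forall n \near \oo,
  `|\int[P n]_y trig s (W n y) - gtrig s (Gamma n)| <= e.
Proof.
elim: s e => [|p s ih] e e0.
  apply: nearW => n; rewrite /gtrig big_nil.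
  under eq_Rintegral do rewrite /trig big_nil.
  by rewrite Rintegral_cstT subr0 normr0 ltW.
have e2 : 0 < e / 2 by rewrite divr_gt0.
have p1 : 0 < `|p.1| + 1 by rewrite ltr_wpDl.
near=> n; have rn : regular n by near: n; exact: near_regular.
have [n0 ig2] := rn.
have mW : measurable_fun setT (W n) by apply: measurable_lead_sum => i; exact: (measurable_std hE n0).
have ic t : (P n).-integrable setT (EFin \o (fun y => cos (dotv t (W n y)))).
  apply: (@bounded_integrable _ _ _ _ _ 1) => [|x]; last exact: cos_max.
  apply: measurableT_comp (continuous_measurable_fun (@continuous_cos R)) _.
  exact: measurableT_comp (measurable_dotv t) mW.
have it : (P n).-integrable setT (EFin \o (fun y => trig s (W n y))).
  by apply: integrable_sumR => q; exact: integrableZR.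
rewrite /gtrig big_cons.
rewrite (_ : \int[P n]_y _ = p.1 * \int[P n]_y cos (dotv p.2 (W n y)) + \int[P n]_y trig s (W n y)); last first.
  rewrite -(RintegralZl _ measurableT (ic p.2)) -(RintegralD measurableT (integrableZR _ (ic p.2)) it).
  by apply: eq_Rintegral => y _; rewrite /trig big_cons.
have H1 : `|\int[P n]_y trig s (W n y) - gtrig s (Gamma n)| <= e / 2 by near: n; exact: ih.
have H2 : `|\int[P n]_y cos (dotv p.2 (W n y)) - expR (- (bform (Gamma n) p.2 p.2 / 2))| <=
    e / 2 / (`|p.1| + 1) by near: n; apply: near_char; rewrite divr_gt0.
rewrite -/(gtrig s (Gamma n)) opprD addrACA -mulrBr.
apply: le_trans (ler_normD _ _) _; rewrite [e]splitr lerD// normrM.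
apply: (@le_trans _ _ (`|p.1| * (e / 2 / (`|p.1| + 1)))); first by rewrite ler_wpM2l.
rewrite mulrCA ger_pMr// ler_pdivrMr// mul1r lerDl//.
Unshelve. all: by end_near. Qed.

(** The error consists of two sandwich errors and one error of [near_trig], each [e / 3]. *)
Lemma near_maxcdf (t r e : R) : 0 <= t -> 0 < r -> 0 < e -> \forall n \near \oo,
  fine (P n [set y | `|W n y| <= t]) <= maxcdf (Gamma n) (t + r) + e /\
  maxcdf (Gamma n) t <= fine (P n [set y | `|W n y| <= t + r]) + e.
Proof.
move=> t0 r0 e0; have e3 : 0 < e / 3 by rewrite divr_gt0.
have [s [hs1 hs2]] := @maxcdf_sandwich R k _ _ _ t0 r0 e3.
near=> n; have rn : regular n by near: n; exact: near_regular.
have [n0 ig2] := rn.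
have mW : measurable_fun setT (W n) by apply: measurable_lead_sum => i; exact: (measurable_std hE n0).
have tW : unit_tails (P n) (W n) := unit_tails_std hPQ hE n0 ig2.
have /andP[h1 h2] := hs1 _ (corrlike_std_corr rn).
have /andP[h3 h4] := hs2 _ _ _ _ mW tW.
have : `|\int[P n]_y trig s (W n y) - gtrig s (Gamma n)| <= e / 3 by near: n; exact: near_trig.
rewrite ler_norml => /andP[h5 h6]; split; lra.
Unshelve. all: by end_near. Qed.

End limit_theorems.

(** * Equivalence of the two consistency conditions *)

Section convergence_in_mean.
Variables (R : realType) (l : nat) (P : forall n, probability 'M[R]_(n, l) R).

Lemma cvgp0_mean (X : forall n, 'M[R]_(n, l) -> R) :
  (\forall n \near \oo, (P n).-integrable setT (EFin \o X n)) ->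
  (forall d : R, 0 < d -> \forall n \near \oo, \int[P n]_y `|X n y| <= d) -> cvgp0 P X.
Proof.
move=> iX LX e e0 d d0; have ed0 : 0 < e * d by rewrite mulr_gt0.
near=> n; have iXn : (P n).-integrable setT (EFin \o X n) by near: n.
have /integrableP[/measurable_EFinP mX _] := iXn.
exists [set y | e <= `|X n y|]; split.
- rewrite -[Y in measurable Y]setTI; apply: measurable_fun_le => //.
  exact: measurableT_comp.
- by move=> y /negP; rewrite -ltNge.
- apply: le_trans (markov_ineq e0 iXn) _; rewrite lee_fin mulrC ler_pdivrMr// mulrC.
  by near: n; exact: LX.
Unshelve. all: by end_near. Qed.

Lemma cvgp0Z (a : R) (X : forall n, 'M[R]_(n, l) -> R) :
  cvgp0 P X -> cvgp0 P (fun n y => a * X n y).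
Proof.
move=> hX e e0; have a1 : 0 < `|a| + 1 by rewrite ltr_wpDl.
have ea : 0 < e / (`|a| + 1) by rewrite divr_gt0.
apply: (asure_imp (hX _ ea)); apply: nearW => n y; rewrite ltr_pdivlMr// normrM => h.
by apply: le_lt_trans h; rewrite mulrC ler_wpM2l// lerDl.
Qed.

End convergence_in_mean.

Section consistency_equivalence.
Unset Implicit Arguments.
Variables (R : realType) (l k : nat) (P : forall n, probability 'M[R]_(n, l) R)
  (Q : forall n, 'I_n -> probability 'rV[R]_l R).
Hypothesis hPQ : forall n, is_product_law (P n) (Q n).
Variables (thetahat : forall n, 'M[R]_(n, l) -> 'cV[R]_k) (thetastar : nat -> 'cV[R]_k)
  (g : forall n, 'I_n -> 'rV[R]_l -> 'cV[R]_k) (Delta : forall n, 'M[R]_(n, l) -> 'cV[R]_k).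
Hypothesis hE : expansion_condition P Q thetahat thetastar g Delta.


Let Gamma n := std_corr P g n.
Let h n := @std_array R l k P g n.
Let W n := lead_sum (h n).
Set Implicit Arguments.


Let quad t n (y : 'M[R]_(n, l)) := \sum_i dotv t (h n i (row i y)) ^+ 2.

Let cvgp0_quad t : cvgp0 P (fun n y => quad t y - bform (Gamma n) t t).
Proof.
pose K := (\sum_a `|t a 0|) ^+ 2; have K0 : 0 <= K by exact: sqr_ge0.
pose T := \sum_a `|t a 0| + 1; have T0 : 0 < T by rewrite ltr_wpDl// sumr_ge0.
apply: cvgp0_mean.
  near=> n; have rn : regular Q g n by near: n; exact: (near_regular hE).
  have [n0 ig2] := rn.
  rewrite /Gamma -(moment2_std hPQ hE n0 ig2).
  exact: (array_integrable_lln (hPQ n) (measurable_std hE n0) (integrable_std P ig2)).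
(* As the form is at most [K], the first term of the bound is at most [d / 2]; the Lindeberg term is
   made at most [2 * (d / 4)]. *)
move=> d d0; pose e := d / (K + 1).
have e0 : 0 < e by rewrite divr_gt0//; lra.
pose c := d / 4 / T ^+ 2; have c0 : 0 < c by rewrite !divr_gt0 ?exprn_gt0.
near=> n; have rn : regular Q g n by near: n; exact: (near_regular hE).
have [n0 ig2] := rn.
have := array_lln_bound (hPQ n) (measurable_std hE n0) (integrable_std P ig2) t e0.
rewrite (moment2_std hPQ hE n0 ig2) -/(Gamma n) => /le_trans; apply.
have : Lind (Q n) (h n) (e / T) <= c.
  by near: n; apply: (near_Lind_std hE) => //; rewrite divr_gt0.
rewrite -(ler_pM2l (_ : 0 < T ^+ 2)) ?exprn_gt0//.
have -> : T ^+ 2 * c = d / 4 by rewrite /c; field; rewrite gt_eqF.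
have := bform_std_corr_le hPQ hE t rn; rewrite -/(Gamma n) -/K => sK Lc.
have : e * (bform (Gamma n) t t + 1) <= d.
  by rewrite /e mulrAC ler_pdivrMr ?ler_pM2l//; lra.
rewrite -/(h n) -/T; lra.
Unshelve. all: by end_near. Qed.

Let U n (y : 'M[R]_(n, l)) a b := (stdev P g n a)^-1 * (stdev P g n b)^-1 * outer_sum (g n) y a b.

Let UE n (y : 'M[R]_(n, l)) a b : U y a b = \sum_i (h n i (row i y) a 0 * h n i (row i y) b 0).
Proof.
rewrite /U /outer_sum summxE mulr_sumr; apply: eq_bigr => i _.
by rewrite !mxE big_ord1 !mxE; ring.
Qed.

(** Polarization: the scalar law of large numbers at [e_a + e_b], [e_a] and [e_b] yields the entry
    [(a, b)]. *)
Let cvgp0_U a b : cvgp0 P (fun n y => U y a b - Gamma n a b).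
Proof.
have H := cvgp0D (cvgp0_quad (delta_mx a 0 + delta_mx b 0))
  (cvgp0D (cvgp0N (cvgp0_quad (delta_mx a 0))) (cvgp0N (cvgp0_quad (delta_mx b 0)))).
apply: cvgp0_eq (cvgp0Z 2^-1 H).
near=> n => y; have rn : regular Q g n by near: n; exact: (near_regular hE).
have [Gp _] := corrlike_std_corr hPQ hE rn.
rewrite !bformDl !bformDr (bformC (delta_mx b 0) (delta_mx a 0) (proj1 Gp)) !bform_delta.
have -> : quad (delta_mx a 0 + delta_mx b 0) y =
    quad (delta_mx a 0) y + quad (delta_mx b 0) y + 2 * U y a b.
  rewrite UE mulr_sumr /quad -!big_split; apply: eq_bigr => i _ /=.
  by rewrite dotvDl !dotv_delta; ring.
rewrite -/(Gamma n); field.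
Unshelve. all: by end_near. Qed.

Let Uaa n (y : 'M[R]_(n, l)) a : 0 <= U y a a.
Proof. by rewrite UE sumr_ge0// => i _; rewrite -expr2 sqr_ge0. Qed.

Let UaaV n (y : 'M[R]_(n, l)) a : (0 < n)%N ->
  U y a a = (covmx (P n) (lead_sum (g n)) a a)^-1 * outer_sum (g n) y a a.
Proof. by move=> n0; rewrite (covmx_diag hE n0) -exprVn expr2. Qed.

Lemma cvgp0_outer_diag a :
  cvgp0 P (fun n y => (covmx (P n) (lead_sum (g n)) a a)^-1 * outer_sum (g n) y a a - 1).
Proof.
apply: cvgp0_eq (cvgp0_U a a); near=> n => y.
have n0 : (0 < n)%N by near: n; exact: near_pos.
by rewrite UaaV// /Gamma (std_corr_diag hE).
Unshelve. all: by end_near. Qed.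

Lemma outer_sum_diag_ge0 n (y : 'M[R]_(n, l)) a : 0 <= outer_sum (g n) y a a.
Proof.
rewrite /outer_sum summxE sumr_ge0// => i _.
by rewrite !mxE big_ord1 !mxE -expr2 sqr_ge0.
Qed.

(** Correlation matrices are invariant under rescaling of the coordinates, so [outer_sum] may be
    replaced by [U]. This tends to [Gamma n], with diagonal tending to 1, and [corr_close]
    applies. *)
Lemma cvgp0_outer_corr a b :
  cvgp0 P (fun n y => corrmx (outer_sum (g n) y) a b - Gamma n a b).
Proof.
move=> e e0; pose kappa := Num.min (1 / 4) (e / 6).
have k0 : 0 < kappa by rewrite lt_min !divr_gt0.
have k4 : kappa <= 1 / 4 by rewrite ge_min lexx.
have ke : 5 * kappa < e.
  have : kappa <= e / 6 by rewrite ge_min lexx orbT.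
  lra.
apply: (asure_imp (asure_and (cvgp0_U a b k0) (asure_and (cvgp0_U a a k0) (cvgp0_U b b k0)))).
near=> n => y [ab [aa bb]]; have rn : regular Q g n by near: n; exact: (near_regular hE).
have [n0 _] := rn; have [Gp G1] := corrlike_std_corr hPQ hE rn.
rewrite /Gamma !(std_corr_diag hE)// in aa bb.
rewrite corrmxE; last by move=> c; exact: outer_sum_diag_ge0.
have sq c : Num.sqrt (outer_sum (g n) y c c) = stdev P g n c * Num.sqrt (U y c c).
  rewrite -[X in X * _](ger0_norm (ltW (stdev_gt0 hE c n0))) -sqrtr_sqr -sqrtrM ?sqr_ge0//.
  by rewrite /U; congr Num.sqrt; field; rewrite gt_eqF// (stdev_gt0 hE).
have -> : (Num.sqrt (outer_sum (g n) y a a))^-1 * outer_sum (g n) y a b *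
    (Num.sqrt (outer_sum (g n) y b b))^-1 =
   (Num.sqrt (U y a a))^-1 * U y a b * (Num.sqrt (U y b b))^-1.
  rewrite !sq !invfM; set ua := Num.sqrt _; set ub := Num.sqrt (U y b b); rewrite /U; ring.
apply: le_lt_trans ke; apply: corr_close => //; try exact: ltW.
apply: le_trans (psdmx_entry_le _ _ Gp) _; have := G1 a; have := G1 b; rewrite /Gamma; lra.
Unshelve. all: by end_near. Qed.

Variable S : forall n, 'M[R]_(n, l) -> 'M[R]_k.
Hypothesis mS : forall n, measurable_fun setT (@S n).
Hypothesis Sp : forall n y, psdmx (@S n y).

Let mSe n i j : measurable_fun setT (fun y => @S n y i j).
Proof. exact: measurableT_comp (@measurable_coord R k k i j) (@mS n). Qed.

Lemma consistentV_entries :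
  consistent_cov (@invmx R k) P (fun n _ => covmx (P n) (lead_sum (g n))) S <->
  (forall a b, cvgp0 P (fun n y => corrmx (@S n y) a b - Gamma n a b)) /\
  (forall a, cvgp0 P (fun n y => (covmx (P n) (lead_sum (g n)) a a)^-1 * @S n y a a - 1)).
Proof.
apply: consistent_covP.
- by apply: nearW => n i j; exact: measurable_cst.
- near=> n => _ i; apply: ltW; apply: (covmx_diag_gt0 hE); near: n; exact: near_pos.
- near=> n => _; apply: invmx_diagpart => i; rewrite gt_eqF//; apply: (covmx_diag_gt0 hE).
  by near: n; exact: near_pos.
- by move=> n i j; exact: mSe.
- by move=> n y i; exact: psdmx_diag_ge0.
Unshelve. all: by end_near. Qed.

Lemma consistentS_entries :
  consistent_cov (@mpinv R k k) P (fun n => outer_sum (g n)) S <->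
  (forall a b, cvgp0 P (fun n y => corrmx (@S n y) a b - corrmx (outer_sum (g n) y) a b)) /\
  (forall a, cvgp0 P (fun n y => (outer_sum (g n) y a a)^-1 * @S n y a a - 1)).
Proof.
apply: consistent_covP.
- near=> n => a b; have n0 : (0 < n)%N by near: n; exact: near_pos.
  rewrite (_ : (fun y => _) = fun y => \sum_i (g n i (row i y) a 0 * g n i (row i y) b 0)).
    apply: measurable_sum => i; apply: measurable_funM.
    + exact: measurableT_comp (measurable_ga hE i a n0) (@measurable_row R l n i).
    + exact: measurableT_comp (measurable_ga hE i b n0) (@measurable_row R l n i).
  apply/funext => y; rewrite /outer_sum summxE; apply: eq_bigr => i _.
  by rewrite !mxE big_ord1 !mxE.
- by apply: nearW => n y i; exact: outer_sum_diag_ge0.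
- by apply: nearW => n y; exact: mpinv_diagpart.
- by move=> n i j; exact: mSe.
- by move=> n y i; exact: psdmx_diag_ge0.
Unshelve. all: by end_near. Qed.

(** The two correlation targets are close by [cvgp0_outer_corr]. The diagonal ratios differ by the
    factor [outer_sum / covmx], which tends to 1: one direction divides by it, through
    [ratio_close], and the other multiplies by it. *)
Lemma consistentV_iff_consistentS :
  consistent_cov (@invmx R k) P (fun n _ => covmx (P n) (lead_sum (g n))) S <->
  consistent_cov (@mpinv R k k) P (fun n => outer_sum (g n)) S.
Proof.
rewrite consistentV_entries consistentS_entries; split=> -[hC hD]; split => a.
- move=> b; apply: cvgp0_eq (cvgp0D (hC a b) (cvgp0N (cvgp0_outer_corr a b))).
  by apply: nearW => n y; rewrite opprB addrA subrK.
- move=> e e0; pose kappa := Num.min (1 / 4) (e / 4).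
  have k0 : 0 < kappa by rewrite lt_min !divr_gt0.
  have k4 : kappa <= 1 / 4 by rewrite ge_min lexx.
  have ke : 3 * kappa < e.
    have : kappa <= e / 4 by rewrite ge_min lexx orbT.
    lra.
  apply: (asure_imp (asure_and (hD a _ k0) (cvgp0_outer_diag a k0))).
  near=> n => y [h1 h2]; have n0 : (0 < n)%N by near: n; exact: near_pos.
  apply: le_lt_trans ke; have V0 := covmx_diag_gt0 hE n0 a.
  have := ratio_close k4 (ltW h1) (ltW h2).
  by rewrite invfM invrK mulrACA mulVf ?gt_eqF// mul1r mulrC.
- move=> b; apply: cvgp0_eq (cvgp0D (hC a b) (cvgp0_outer_corr a b)).
  by apply: nearW => n y; rewrite addrA subrK.
- move=> e e0; pose kappa := Num.min (1 / 4) (e / 4).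
  have k0 : 0 < kappa by rewrite lt_min !divr_gt0.
  have k4 : kappa <= 1 / 4 by rewrite ge_min lexx.
  have ke : 3 * kappa < e.
    have : kappa <= e / 4 by rewrite ge_min lexx orbT.
    lra.
  apply: (asure_imp (asure_and (hD a _ k0) (cvgp0_outer_diag a k0))).
  near=> n => y [h1 h2]; have n0 : (0 < n)%N by near: n; exact: near_pos.
  apply: le_lt_trans ke; have V0 := covmx_diag_gt0 hE n0 a.
  set v := covmx _ _ a a in V0 h2 *; set s := outer_sum _ _ _ _ in h1 h2; set r := @S n y a a in h1 *.
  (* [s / v] is within 1/4 of 1, so [s] is nonzero and [s^-1] is a genuine inverse. *)
  have s0 : s != 0 by apply/eqP => s0; move: h2; rewrite s0 mulr0 sub0r normrN normr1; lra.
  have -> : v^-1 * r - 1 = (s^-1 * r - 1) * (v^-1 * s) + (v^-1 * s - 1).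
    by field; rewrite s0 gt_eqF.
  have h3 : `|v^-1 * s| <= 5 / 4.
    have := ler_normD (v^-1 * s - 1) 1; rewrite subrK normr1; lra.
  apply: le_trans (ler_normD _ _) _; rewrite normrM.
  have : `|s^-1 * r - 1| * `|v^-1 * s| <= kappa * (5 / 4) by apply: ler_pM => //; exact: ltW.
  lra.
Unshelve. all: by end_near. Qed.

End consistency_equivalence.

(** * Coverage *)

Section maxcdf_at_zero.
Variables (R : realType) (k : nat).

(** A coordinate of unit variance has no atom at 0; such a coordinate exists as [0 < k]. This places
    the start of the grid below every positive level. *)
Lemma maxcdf0 (G : 'M[R]_k) : (0 < k)%N -> psdmx G -> (forall i, G i i = 1) -> maxcdf G 0 <= 0.
Proof.
move=> k0 Gp G1; pose j := Ordinal k0.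
have law C : measurable C -> gaussian G ((fun z : 'cV[R]_k => z j 0) @^-1` C) = normal0 1 C.
  move=> mC; rewrite -(G1 j) -(bform_delta G j j) -gaussian_dotv_law//.
  by congr (gaussian G _); apply/seteqP; split => z /=; rewrite dotv_delta.
have := normal0_law_itv law (lexx (0 : R)); rewrite subr0 => H.
rewrite -lee_fin /maxcdf probability_fineK; last exact: measurable_maxnorm_le.
apply: le_trans H; apply: le_measure; rewrite ?inE; first exact: measurable_maxnorm_le.
  rewrite (_ : [set z | _] = (fun z : 'cV[R]_k => z j 0) @^-1` `[0, 0]); last first.
    by apply/seteqP; split => z /=; rewrite in_itv.
  by rewrite -[X in measurable X]setTI; apply: measurable_coord => //; exact: measurable_itv.
move=> z /= z0; have /(_ j 0) := (mx_norm_leP z (lexx 0)).1 z0.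
by rewrite normr_le0 => /eqP ->; rewrite lexx.
Qed.

End maxcdf_at_zero.

Section coverage.
Unset Implicit Arguments.
Variables (R : realType) (l k : nat) (P : forall n, probability 'M[R]_(n, l) R)
  (Q : forall n, 'I_n -> probability 'rV[R]_l R).
Hypothesis hPQ : forall n, is_product_law (P n) (Q n).
Variables (thetahat : forall n, 'M[R]_(n, l) -> 'cV[R]_k) (thetastar : nat -> 'cV[R]_k)
  (g : forall n, 'I_n -> 'rV[R]_l -> 'cV[R]_k) (Delta : forall n, 'M[R]_(n, l) -> 'cV[R]_k).
Hypothesis hE : expansion_condition P Q thetahat thetastar g Delta.


Let Gamma n := std_corr P g n.
Let h n := @std_array R l k P g n.
Let W n := lead_sum (h n).
Set Implicit Arguments.


Variable S : forall n, 'M[R]_(n, l) -> 'M[R]_k.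
Hypothesis mS : forall n, measurable_fun setT (@S n).
Hypothesis Sp : forall n y, psdmx (@S n y).
Hypothesis hC : forall a b, cvgp0 P (fun n y => corrmx (@S n y) a b - Gamma n a b).
Hypothesis hD :
  forall a, cvgp0 P (fun n y => (covmx (P n) (lead_sum (g n)) a a)^-1 * @S n y a a - 1).
Variable p : R.
Hypothesis p01 : 0 < p < 1.
Hypothesis k0 : (0 < k)%N.

Let quant n (y : 'M[R]_(n, l)) := gauss_maxnorm_quantile p (corrmx (@S n y)).

Definition covered n : set 'M[R]_(n, l) :=
  [set y | forall a, `|@thetahat n y a 0 - thetastar n a 0| <= Num.sqrt (@S n y a a) * quant y].

Let mSe n i j : measurable_fun setT (fun y => @S n y i j).
Proof. exact: measurableT_comp (@measurable_coord R k k i j) (@mS n). Qed.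

Let corrlikeS n (y : 'M[R]_(n, l)) : corrlike (corrmx (@S n y)).
Proof.
split; first exact: psdmx_corrmx.
by move=> i; apply: corrmx_diag_le1 => a; exact: psdmx_diag_ge0.
Qed.

Let mquant n : measurable_fun setT (@quant n).
Proof.
apply: measurable_quantile => // i j.
by apply: measurable_corrmx => [a b|y a]; [exact: mSe|exact: psdmx_diag_ge0].
Qed.

Lemma measurable_covered_coord n a : (0 < n)%N -> measurable
  [set y : 'M[R]_(n, l) | `|@thetahat n y a 0 - thetastar n a 0| <= Num.sqrt (@S n y a a) * quant y].
Proof.
move=> n0; rewrite (_ : [set y | _] =
    [set y | `|(lead_sum (g n) y + Delta n y) a 0| <= Num.sqrt (@S n y a a) * quant y]); last first.
  by apply/seteqP; split => y /=; rewrite -(expansion_eq hE)// !mxE.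
rewrite -[X in measurable X]setTI; apply: measurable_fun_le => //.
  apply: measurableT_comp => //; under eq_fun do rewrite mxE.
  apply: measurable_funD; last exact: (measurable_Delta hE).
  apply: measurableT_comp (@measurable_coord R k 1 a 0) _; apply: measurable_lead_sum => i.
  exact: (measurable_g hE).
apply: measurable_funM; last exact: mquant.
exact: measurableT_comp (@measurable_sqrtr R) (mSe a a).
Qed.

Lemma measurable_covered n : (0 < n)%N -> measurable (@covered n).
Proof.
move=> n0; rewrite (_ : @covered n = \bigcap_(a in [set` index_enum 'I_k])
    [set y | `|@thetahat n y a 0 - thetastar n a 0| <= Num.sqrt (@S n y a a) * quant y]).
  by rewrite bigcap_seq; apply: bigsetI_measurable => a _; exact: measurable_covered_coord.
apply/seteqP; split => y /=; first by move=> H a _; exact: H.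
by move=> H a; have /= := H a; rewrite mem_index_enum => /(_ isT).
Qed.

Lemma asure_maxcdf_close (t r e : R) : 0 <= t -> 0 < r -> 0 < e ->
  asure P (fun n y => maxcdf (Gamma n) t <= maxcdf (corrmx (@S n y)) (t + r) + e /\
                      maxcdf (corrmx (@S n y)) t <= maxcdf (Gamma n) (t + r) + e).
Proof.
move=> t0 r0 e0; have [d d0 H] := @maxcdf_close R k _ _ _ t0 r0 e0.
have hCd := asure_forall (fun a => asure_forall (fun b => hC a b d0)).
apply: (asure_imp hCd); near=> n => y close.
have rn : regular Q g n by near: n; exact: (near_regular hE).
have Gc := corrlike_std_corr hPQ hE rn; have Sc := corrlikeS y.
have c1 i j : `|Gamma n i j - corrmx (@S n y) i j| <= d by rewrite distrC ltW//; exact: close.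
have c2 i j : `|corrmx (@S n y) i j - Gamma n i j| <= d by exact: ltW (close i j).
by split; [exact: (H _ _ Gc Sc c1)|exact: (H _ _ Sc Gc c2)].
Unshelve. all: by end_near. Qed.

Lemma asure_scale (e : R) : 0 < e -> asure P (fun n y => forall a,
  `|Num.sqrt (@S n y a a) / stdev P g n a - 1| <= e /\ `|(stdev P g n a)^-1 * Delta n y a 0| <= e).
Proof.
move=> e0; apply: asure_forall => a.
have hDelta : cvgp0 P (fun n y => (stdev P g n a)^-1 * Delta n y a 0).
  apply/cvgp0P; last by move=> d d0; case: hE => _ _ /(_ a d d0).
  near=> n; apply: measurable_funM => //; apply: (measurable_Delta hE).
  by near: n; exact: near_pos.
apply: (asure_imp (asure_and (hD a e0) (hDelta e e0))); near=> n => y [h1 h2].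
have n0 : (0 < n)%N by near: n; exact: near_pos.
split; last exact: ltW.
have s0 := stdev_gt0 hE a n0; rewrite (covmx_diag hE n0) in h1.
have S0 := psdmx_diag_ge0 a (Sp y).
have -> : Num.sqrt (@S n y a a) / stdev P g n a = Num.sqrt ((stdev P g n a ^+ 2)^-1 * @S n y a a).
  rewrite sqrtrM ?invr_ge0 ?sqr_ge0// mulrC -exprVn sqrtr_sqr ger0_norm// invr_ge0 ltW//.
apply: le_trans (ltW h1); apply: sqrt_close; rewrite mulr_ge0 ?invr_ge0 ?sqr_ge0//.
Unshelve. all: by end_near. Qed.

(** Division by the standard deviations: in each coordinate, a vanishing perturbation of [W n] is
    compared with the quantile times a factor tending to 1. *)
Lemma coveredE n (y : 'M[R]_(n, l)) : (0 < n)%N -> covered y <-> forall a,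
  `|W n y a 0 + (stdev P g n a)^-1 * Delta n y a 0| <=
  Num.sqrt (@S n y a a) / stdev P g n a * quant y.
Proof.
move=> n0; have E a : (`|thetahat n y a 0 - thetastar n a 0| <= Num.sqrt (@S n y a a) * quant y) =
    (`|W n y a 0 + (stdev P g n a)^-1 * Delta n y a 0| <=
     Num.sqrt (@S n y a a) / stdev P g n a * quant y).
  have s0 := stdev_gt0 hE a n0.
  have := expansion_eq hE y n0 => /matrixP/(_ a 0); rewrite !mxE => ->.
  rewrite (lead_sum_std P g y) -mulrDr normrM ger0_norm ?invr_ge0 ?(ltW s0)//.
  have sV0 : 0 < (stdev P g n a)^-1 by rewrite invr_gt0.
  by rewrite -[LHS](ler_pM2l sV0) mulrA [_ * Num.sqrt _]mulrC.
by split=> H a; have := H a; rewrite /covered E.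
Qed.

Lemma grid_crossing (F : nat -> R) (q : R) N : F 0%N < q -> q <= F N ->
  exists2 r, (r < N)%N & F r < q <= F r.+1.
Proof.
move=> F0 FN; have [[|r] qr rmin] := ex_minnP (ex_intro (fun r => q <= F r) N FN).
  by move: F0; rewrite ltNge qr.
exists r; first exact: rmin.
by rewrite qr andbT ltNge; apply/negP => /rmin; rewrite ltnn.
Qed.

(* On a fine grid the distribution function of |Z|, Z ~ N(0, Gamma_n), crosses the levels
   p + d and p - d within two consecutive points; with high probability the estimated quantile
   lies between these crossing points, up to two steps of the grid. *)
Lemma near_covered (d : R) : 0 < d -> 3 * d <= p -> 3 * d <= 1 - p ->
  \forall n \near \oo, `|p - fine (P n (@covered n))| <= 4 * d.
Proof.
move=> d0 dp d1p.
(* Four grid steps change the Gaussian distribution function by at most [d], by [maxcdf_lip]. *)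
pose eta := d / (8 * k%:R).
have k1 : 0 < k%:R :> R by rewrite ltr0n.
have eta0 : 0 < eta by rewrite divr_gt0// mulr_gt0.
have etad : 2 * k%:R * (4 * eta) = d by rewrite /eta; field; rewrite gt_eqF.
(* [k / B0 ^+ 2 <= k / B0 <= d], so the Gaussian distribution function is at least [1 - d] from [B0]
   on. *)
pose B0 := k%:R / d + 1.
have B01 : 1 <= B0 by rewrite lerDr divr_ge0 ?ltW.
have B00 : 0 < B0 by rewrite (lt_le_trans ltr01).
pose T r : R := r%:R * eta.
have T0 r : 0 <= T r by rewrite mulr_ge0// ltW.
have TS r : T r + eta = T r.+1 by rewrite /T -[in RHS]natr1 mulrDl mul1r.
have TD r j : T (r + j)%N = T r + j%:R * eta by rewrite /T natrD mulrDl.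
have [N NB] : exists N, B0 <= T N.
  exists (Num.bound (B0 / eta)); rewrite /T -ler_pdivrMr//; apply: ltW.
  by apply: archi_boundP; rewrite divr_ge0 ?ltW.
have Tle r s : (r <= s)%N -> T r <= T s by move=> rs; rewrite /T ler_wpM2r ?(ltW eta0)// ler_nat.
(* A relative error [kappa] of the scale and an absolute error [kappa] from [Delta] together shift a
   threshold [t <= T N + eta] by at most one grid step. *)
pose kappa := eta / (T N + eta + 2).
have den0 : 0 < T N + eta + 2 by have := T0 N; lra.
have kappa0 : 0 < kappa by rewrite divr_gt0.
have kappaT t : t <= T N + eta -> kappa * (t + 1) <= eta.
  move=> tN; rewrite /kappa mulrAC ler_pdivrMr//; rewrite ler_pM2l//; lra.
have kappa1 : kappa <= 1.
  by rewrite /kappa ler_pdivrMr// mul1r; have := T0 N; lra.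
pose F n t := maxcdf (Gamma n) t.
(* The indices run up to [N + 2], because a crossing at [r < N] is bracketed by points up to
   [T r.+3]. *)
have A1 := asure_forall (fun r : 'I_N.+3 => asure_maxcdf_close (T0 r) eta0 d0).
have AF := asure_fine d0 (asure_and A1 (asure_scale kappa0)).
have HW : \forall n \near \oo, forall r : 'I_N.+3,
    fine (P n [set y | `|W n y| <= T r]) <= maxcdf (Gamma n) (T r + eta) + d /\
    maxcdf (Gamma n) (T r) <= fine (P n [set y | `|W n y| <= T r + eta]) + d.
  apply: filter_forall => r; exact: (near_maxcdf hPQ hE).
near=> n; have rn : regular Q g n by near: n; exact: (near_regular hE).
have [n0 ig2] := rn.
have [Gp _] := corrlike_std_corr hPQ hE rn.
have Gc := corrlike_std_corr hPQ hE rn.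
have G1 a : Gamma n a a = 1 by rewrite /Gamma (std_corr_diag hE).
have mW : measurable_fun setT (W n) by apply: measurable_lead_sum => i; exact: (measurable_std hE n0).
have mC := measurable_covered n0.
have Flip t u : 0 <= t -> t <= u -> F n u <= F n t + 2 * k%:R * (u - t) by exact: maxcdf_lip.
have F0 : F n (T 0%N) <= 0 by rewrite /T mul0r; exact: maxcdf0.
have FN : 1 - d <= F n (T N).
  apply: (@le_trans _ _ (F n B0)); last exact: maxcdf_le.
  apply: le_trans (maxcdf_ge Gc B00); rewrite lerD2l lerN2.
  apply: (@le_trans _ _ (k%:R / B0)).
    rewrite ler_wpM2l ?(ltW k1)// lef_pV2 ?posrE ?exprn_gt0// expr2 ler_peMl//.
    exact: ltW.
  rewrite ler_pdivrMr// /B0 mulrDr mulr1 mulrCA divff ?gt_eqF// mulr1 lerDl ltW//.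
have HWn : forall r : 'I_N.+3,
    fine (P n [set y | `|W n y| <= T r]) <= F n (T r + eta) + d /\
    F n (T r) <= fine (P n [set y | `|W n y| <= T r + eta]) + d by near: n.
have bad : forall E : set 'M[R]_(n, l), measurable E -> (forall y, E y -> ~ (
     (forall r : 'I_N.+3, F n (T r) <= maxcdf (corrmx (@S n y)) (T r + eta) + d /\
       maxcdf (corrmx (@S n y)) (T r) <= F n (T r + eta) + d) /\
     (forall a, `|Num.sqrt (@S n y a a) / stdev P g n a - 1| <= kappa /\
        `|(stdev P g n a)^-1 * Delta n y a 0| <= kappa))) -> fine (P n E) <= d.
  by near: n.
have split_le (E1 E2 : set 'M[R]_(n, l)) : measurable E1 -> measurable E2 ->
    fine (P n (E1 `\` E2)) <= d -> fine (P n E1) <= fine (P n E2) + d.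
  move=> m1 m2 D12; apply: (@le_trans _ _ (fine (P n (E2 `|` (E1 `\` E2))))).
    apply: le_fine_probability => //; first by apply: measurableU => //; exact: measurableD.
    by move=> y E1y; have [?|?] := pselect (E2 y); [left|right].
  apply: le_trans (fine_probabilityU _ _ _) _ => //; first exact: measurableD.
  by rewrite lerD2l.
(* The crossing exists since [p + d <= 1 - d]. From [F n (T r.+1) >= p + d] the quantile is at most
   [T r.+2], so coverage forces [|W n y| <= T r.+3], outside an event of mass [d]. That cube has
   mass at most [F n (T r.+4) + d], and going back four steps to [T r] costs another [d]. *)
have upper : fine (P n (@covered n)) <= p + 4 * d.
  have [||r rN /andP[r1 r2]] := @grid_crossing (F n \o T) (p + d) N; rewrite /=; [lra..|].
  rewrite /= in r1 r2.
  have rN3 : (r.+3 < N.+3)%N by [].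
  have rN1 : (r.+1 < N.+3)%N by exact: leq_trans rN (leqW (leqnSn N)).
  have TrN : T r.+1 <= T N by exact: Tle.
  apply: (@le_trans _ _ (fine (P n [set y | `|W n y| <= T r.+3]) + d)).
    apply: split_le => //; first exact: measurable_norm_le.
    apply: bad; first by apply: measurableD => //; exact: measurable_norm_le.
    move=> y [/(coveredE y n0) Cy Wy] [/(_ (Ordinal rN1))[/= c1 _] sc]; apply: Wy => /=.
    have Kle : quant y <= T r.+2.
      by rewrite -TS; apply: (quantile_le p01 (corrlikeS y)); lra.
    have K0 : 0 <= quant y by exact: (quantile_ge0 p01 (corrlikeS y)).
    apply/mx_norm_leP => // a b; rewrite (ord1 b).
    have [s1 s2] := sc a; have := Cy a.
    set rho := Num.sqrt _ / _ in s1 *; set del := _ * Delta _ _ _ _ in s2 *.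
    move=> Wa; have Wle := ler_normB (W n y a 0 + del) del; rewrite addrK in Wle.
    have : rho * quant y <= (1 + kappa) * T r.+2.
      apply: ler_pM => //; first by move: s1; rewrite ler_norml; lra.
      by move: s1; rewrite ler_norml; lra.
    have := kappaT (T r.+2); rewrite -!TS => /(_ _) kk.
    have : kappa * (T r + eta + eta + 1) <= eta by apply: kk; rewrite TS lerD2r.
    lra.
  have [Wr _] := HWn (Ordinal rN3); rewrite /= in Wr.
  have Fr : F n (T r.+3 + eta) <= F n (T r) + d.
    rewrite TS -addn4 TD -etad; apply: le_trans (Flip (T r) _ _ _) _ => //.
      by rewrite lerDl mulr_ge0// ltW.
    by rewrite addrAC subrr add0r.
  lra.
have lower : p - 4 * d <= fine (P n (@covered n)).
  have [||r rN /andP[r1 r2]] := @grid_crossing (F n \o T) (p - d) N; rewrite /=; [lra..|].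
  rewrite /= in r1 r2.
  (* Room for three steps below the crossing: for [r < 3] the point [T r.+1] is within four steps of
     0, so [F n (T r.+1) <= d < p - d]. *)
  have r3 : (3 <= r)%N.
    rewrite leqNgt; apply/negP => rlt; have := Tle _ _ rlt => Tr3.
    have /= := Flip (T 0%N) (T r.+1) (T0 0%N) (Tle _ _ (leq0n _)).
    have : T r.+1 - T 0%N <= 4 * eta by rewrite {2}/T mul0r subr0; exact: (Tle _ 4%N (leqW rlt)).
    have k2 : 0 < 2 * k%:R :> R by rewrite mulr_gt0.
    by rewrite -(ler_pM2l k2) etad; lra.
  have [s rs] : exists s, r = s.+3 by exists (r - 3)%N; rewrite -addn3 subnK.
  rewrite {}rs in rN r1 r2 r3.
  have sN : (s < N.+3)%N by exact: leq_trans (leqW (leqW (leqnSn s.+1))) (leq_trans rN (leqW (leqW (leqnSn N)))).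
  have sN2 : (s.+2 < N.+3)%N by exact: leq_trans (leqnSn s.+3) (leq_trans rN (leqW (leqW (leqnSn N)))).
  have TsN : T s.+2 <= T N by exact: Tle (ltnW (ltnW rN)).
  have [_ Wr] := HWn (Ordinal sN); rewrite /= TS in Wr.
  have Fs : F n (T s.+4) <= F n (T s) + d.
    rewrite -addn4 TD -etad; apply: le_trans (Flip (T s) _ _ _) _ => //.
      by rewrite lerDl mulr_ge0// ltW.
    by rewrite addrAC subrr add0r.
  (* From [F n (T s.+3) < p - d] the quantile is at least [T s.+2]; hence [|W n y| <= T s.+1]
     implies coverage, one step being spent on the scale and on [Delta]. *)
  suff : fine (P n [set y | `|W n y| <= T s.+1]) <= fine (P n (@covered n)) + d by lra.
  apply: split_le => //; first exact: measurable_norm_le.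
  apply: bad; first by apply: measurableD => //; exact: measurable_norm_le.
  move=> y [Wy nC] [/(_ (Ordinal sN2))[/= _ c1] sc]; apply: nC; apply/(coveredE y n0) => a.
  have Kge : T s.+2 <= quant y by apply: (quantile_ge p01 (corrlikeS y)); rewrite TS in c1; lra.
  have [s1 s2] := sc a; have /(_ a 0) Wa := (mx_norm_leP _ (T0 s.+1)).1 Wy.
  set rho := Num.sqrt _ / _ in s1 *; set del := _ * Delta _ _ _ _ in s2 *.
  apply: le_trans (ler_normD _ _) _.
  apply: (@le_trans _ _ ((1 - kappa) * T s.+2)); last first.
    apply: ler_pM => //; first by rewrite subr_ge0.
    by move: s1; rewrite ler_norml; lra.
  have : kappa * (T s.+2 + 1) <= eta by apply: kappaT; rewrite (le_trans TsN)// lerDl ltW.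
  rewrite -(TS s.+1); lra.
by rewrite ler_norml; apply/andP; split; lra.
Unshelve. all: by end_near. Qed.

Lemma coverage_cvg : P n (@covered n) @[n --> \oo] --> p%:E.
Proof.
apply/fine_cvgP; split.
  near=> n; rewrite fin_num_measure//; apply: measurable_covered.
  by near: n; exact: near_pos.
apply/cvgrPdist_le => e e0.
have /andP[p0 p1] := p01.
pose d := Num.min (e / 4) (Num.min (p / 3) ((1 - p) / 3)).
have d0 : 0 < d by rewrite !lt_min !divr_gt0// subr_gt0.
have de : d <= e / 4 by rewrite ge_min lexx.
have dp : d <= p / 3 by rewrite !ge_min lexx/= orbT.
have dq : d <= (1 - p) / 3 by rewrite !ge_min lexx/= !orbT.
have h1 : 3 * d <= p by lra.
have h2 : 3 * d <= 1 - p by lra.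
near=> n; apply: (@le_trans _ _ (4 * d)); last by lra.
by near: n; exact: near_covered.
Unshelve. all: by end_near. Qed.

End coverage.

Lemma mxcol_Rank (R : realType) d (m : 'I_d -> nat) (B : forall j, 'cV[R]_(m j)) j (i : 'I_(m j)) :
  (\mxcol_(j < d) B j) (tagnat.Rank j i) 0 = B j i 0.
Proof. by rewrite mxE /tagnat.sig1 /tagnat.sig2 /tagnat.Rank tagnat.rankK. Qed.

Lemma conf_intervalP (R : realType) d (m : 'I_d -> nat) (alpha : R)
    (theta theta0 : forall j, 'cV[R]_(m j)) (Sigma : 'M[R]_(\sum_(j < d) m j)) j (i : 'I_(m j)) :
  (theta0 j i 0 \in conf_interval alpha theta Sigma j i) =
  (`|(\mxcol_(j < d) theta j) (tagnat.Rank j i) 0 - (\mxcol_(j < d) theta0 j) (tagnat.Rank j i) 0| <=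
   Num.sqrt (Sigma (tagnat.Rank j i) (tagnat.Rank j i)) *
   gauss_maxnorm_quantile (1 - alpha) (corrmx Sigma)).
Proof.
by rewrite !mxcol_Rank /conf_interval in_itv/= distrC ler_distl.
Qed.

Lemma limn_einf_ge (R : realType) (u v : (\bar R)^nat) (a : R) :
  v n @[n --> \oo] --> a%:E -> (\forall n \near \oo, (v n <= u n)%E) -> (a%:E <= limn_einf u)%E.
Proof.
move=> va vu; apply/lee_addgt0Pr => e e0; rewrite -leeBlDr//.
rewrite limn_einf_lim; apply: lime_ge; first exact: is_cvg_einfs.
have /fine_cvgP[vfin /cvgrPdist_le/(_ _ e0) ve] := va.
have : \forall n \near \oo, ((a%:E - e%:E) <= u n)%E.
  near=> n; apply: (@le_trans _ _ (v n)); last by near: n.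
  have vn : v n \is a fin_num by near: n.
  have : `|a - fine (v n)| <= e by near: n.
  rewrite -(fineK vn) -EFinB lee_fin ler_norml => /andP[_]; lra.
move=> [N _ HN]; exists N => // n Nn; apply: le_ereal_inf_tmp => _ [j /= nj <-].
by apply: HN; exact: leq_trans Nn nj.
Unshelve. all: by end_near. Qed.

Theorem theorem2p4 (R : realType) (l d : nat) (hl : (0 < l)%N) (hd : (0 < d)%N)
    (P : forall n, probability 'M[R]_(n, l) R)
    (Q : forall n, 'I_n -> probability 'rV[R]_l R)
    (hPQ : forall n, is_product_law (P n) (Q n))
    (Model : forall n, 'I_d -> set (probability 'M[R]_(n, l) R))
    (hModel0 : forall n j, (0 < n)%N -> Model n j !=set0)
    (hModel_inj : forall n, (0 < n)%N -> injective (Model n))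
    (m : 'I_d -> nat) (hm : (0 < \sum_(j < d) m j)%N)
    (thetastar : forall n j, 'cV[R]_(m j))
    (thetahat : forall n, 'M[R]_(n, l) -> forall j, 'cV[R]_(m j))
    (hthetahat : forall n j, measurable_fun setT (fun y => thetahat n y j))
    (g : forall n, 'I_n -> 'rV[R]_l -> 'cV[R]_(\sum_(j < d) m j))
    (Delta : forall n, 'M[R]_(n, l) -> 'cV[R]_(\sum_(j < d) m j))
    (hE : expansion_condition P Q (fun n y => \mxcol_(j < d) thetahat n y j)
            (fun n => \mxcol_(j < d) thetastar n j) g Delta)
    (alpha : R) (halpha : 0 < alpha < 1)
    (Shat : forall n, 'M[R]_(n, l) -> 'M[R]_(\sum_(j < d) m j))
    (hShat : forall n, measurable_fun setT (Shat n))
    (hShat_psd : forall n y, psdmx (Shat n y)) :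
  let CI n y (j : 'I_d) (i : 'I_(m j)) :=
    conf_interval alpha (thetahat n y) (Shat n y) j i in
  let consistentV := consistent_cov (@invmx R _) P
        (fun n _ => covmx (P n) (lead_sum (g n))) Shat in
  let consistentS := consistent_cov (@mpinv R _ _) P
        (fun n => outer_sum (g n)) Shat in
  (consistentV <-> consistentS) /\
  (consistentV \/ consistentS ->
    P n [set y | forall (j : 'I_d) (i : 'I_(m j)),
                   thetastar n j i 0 \in CI n y j i]
      @[n --> \oo] --> (1 - alpha)%:E /\
    forall Mhat : forall n, 'M[R]_(n, l) -> 'I_d,
      (forall n j, measurable (Mhat n @^-1` [set j])) ->
      ((1 - alpha)%:E <=
       limn_einf (fun n => P n [set y | forall i : 'I_(m (Mhat n y)),
          (thetastar n (Mhat n y) i 0 \in CI n y (Mhat n y) i)%R]))%E).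
Proof.
move=> CI consistentV consistentS.
have VS : consistentV <-> consistentS by exact: (consistentV_iff_consistentS hPQ hE hShat hShat_psd).
split=> // VoS.
have cV : consistentV by case: VoS => [//|]; exact: VS.2.
have [hC hD] := (consistentV_entries hE hShat hShat_psd).1 cV.
have p01 : 0 < 1 - alpha < 1 by lra.
pose th n (y : 'M[R]_(n, l)) := \mxcol_(j < d) thetahat n y j.
pose ts n := \mxcol_(j < d) thetastar n j.
have CIP n y j i : (thetastar n j i 0 \in CI n y j i) =
    (`|th n y (tagnat.Rank j i) 0 - ts n (tagnat.Rank j i) 0| <=
     Num.sqrt (Shat n y (tagnat.Rank j i) (tagnat.Rank j i)) *
     gauss_maxnorm_quantile (1 - alpha) (corrmx (Shat n y))).
  exact: conf_intervalP.
have covE n : [set y | forall (j : 'I_d) (i : 'I_(m j)), thetastar n j i 0 \in CI n y j i] =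
    covered th ts Shat (1 - alpha) (n := n).
  apply/seteqP; split => y /= H.
    by move=> s; have := H (tagnat.sig1 s) (tagnat.sig2 s); rewrite CIP tagnat.sig2K.
  by move=> j i; rewrite CIP; exact: H.
have cov := coverage_cvg hPQ hE hShat hShat_psd hC hD p01 hm.
split; first by under eq_fun do rewrite covE; exact: cov.
(* Simultaneous coverage implies coverage for whichever model is selected, so the convergent
   simultaneous probabilities bound the others from below. *)
move=> Mhat mMhat; apply: (limn_einf_ge cov); near=> n.
have n0 : (0 < n)%N by near: n; exact: near_pos.
apply: le_measure; rewrite ?inE.
- exact: (measurable_covered hE hShat hShat_psd p01).
(* The number of intervals depends on the selected model; splitting by the finitely many values of
   [Mhat] fixes it on each piece. *)
- rewrite (_ : [set y | _] = \big[setU/set0]_(j < d) (Mhat n @^-1` [set j] `&`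
      \bigcap_(i in [set` index_enum 'I_(m j)]) [set y | thetastar n j i 0 \in CI n y j i])).
    apply: bigsetU_measurable => j _; apply: measurableI => //.
    rewrite bigcap_seq; apply: bigsetI_measurable => i _.
    under eq_set do rewrite CIP.
    exact: (measurable_covered_coord hE hShat hShat_psd p01).
  rewrite -bigcup_seq; apply/seteqP; split => y /=.
    move=> H; exists (Mhat n y) => /=; first by rewrite mem_index_enum.
    by split => // i _; exact: H.
  move=> [j /= _ [<- H]] i; apply: H; exact: mem_index_enum.
- by rewrite -covE => y /= H i; exact: H.
Unshelve. all: by end_near. Qed.
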